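(* Let $m=1$ and $\tilde m\in\mathbb{N}$ with $\tilde m+1\in2\mathbb{N}$. Let $p\in\mathbb{N}_0$. Then $$L_2(\mathbb{R})=\overline{\bigoplus_{j\in\mathbb{Z}}W_{p,j}^{\star}}=\overline{\bigoplus_{j\in\mathbb{Z}}\hat{\bigoplus}_{q=0}^{p}W_{q,j}^{\star\star}}$$ and $$L_2(\mathbb{R})=\overline{V_{p,0}\oplus\bigoplus_{j=0}^\infty W_{p,j}^{\star}}=\overline{V_{p,0}\oplus\bigoplus_{j=0}^\infty\hat{\bigoplus}_{q=0}^{p}W_{q,j}^{\star\star}}.$$ Here $\oplus$ denotes the (in general non-orthogonal) algebraic direct sum and $\hat\oplus$ the orthogonal direct sum.
   Context: $\mathbb{N}=\{1,2,\dots\}$, $\mathbb{N}_0=\mathbb{N}\cup\{0\}$. For $m=1$ the quarks are $\varphi_q(x)=x^q\chi_{[0,1)}(x)$, $q\in\mathbb{N}_0$. Coefficients $b_k$ (for $m=1$): put $K=(1+\tilde m)/2$ and for $|z|=1$ let $\tilde a(z)=z^{-\lfloor\tilde m/2\rfloor}\big(\tfrac{1+z}{2}\big)^{\tilde m}\sum_{n=0}^{K-1}\binom{K-1+n}{n}\big(\tfrac{2-z-z^{-1}}{4}\big)^n$ (symbol of the Cohen--Daubechies--Feauveau dual generator). The finitely supported real sequence $(b_k)_{k\in\mathbb{Z}}$ is determined by $\frac12\sum_kb_kz^k=-z\,\overline{\tilde a(-z)}$ for $|z|=1$. Quarklets: $\psi_q=\sum_kb_k\varphi_q(2\cdot-k)$.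 Fourier transform: $(\mathcal{F}f)(\xi)=\frac1{\sqrt{2\pi}}\int f(x)e^{-ix\xi}dx$. For $f,g\in L_2(\mathbb{R})$ put $[f,g](x)=\sum_{k\in\mathbb{Z}}f(x+2\pi k)\overline{g(x+2\pi k)}$. Modified quarklets: $\psi_0^\star=\psi_0$ and, for $1\le q\le p$, $\mathcal{F}\psi_q^\star=\mathcal{F}\psi_q-\sum_{l=0}^{q-1}\frac{[\mathcal{F}\psi_q,\mathcal{F}\psi_l^\star]}{[\mathcal{F}\psi_l^\star,\mathcal{F}\psi_l^\star]}\mathcal{F}\psi_l^\star$, with the convention $\frac00=0$. For $j\in\mathbb{Z}$: $V_{p,j}=\overline{\mathrm{span}\{2^{j/2}\varphi_q(2^j\cdot-k):0\le q\le p,k\in\mathbb{Z}\}}$, $W^\star_{p,j}=\overline{\mathrm{span}\{2^{j/2}\psi^\star_q(2^j\cdot-k):0\le q\le p,k\in\mathbb{Z}\}}$, and $W^{\star\star}_{q,j}=\overline{\mathrm{span}\{2^{j/2}\psi^\star_q(2^j\cdot-k):k\in\mathbb{Z}\}}$ for $0\le q\le p$. Span means finite linear combinations, closures are in $L_2(\mathbb{R})$, and infinite direct sums consist of finite sums of elements. *)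

(* Defs.v *)
From HB Require Import structures.
From mathcomp Require Import all_boot all_order all_algebra.
From mathcomp Require Import all_classical all_reals all_analysis.
From mathcomp Require Export complex.
Set Implicit Arguments.
Unset Strict Implicit.
Unset Printing Implicit Defensive.
Import Order.TTheory GRing.Theory Num.Theory.
Import numFieldNormedType.Exports.
Local Open Scope classical_set_scope.
Local Open Scope complex_scope.
Local Open Scope ring_scope.

Section L2.
Context {R : realType}.
Local Notation mu := (@lebesgue_measure R).
Implicit Types (f g : R -> R[i]) (A : set (R -> R[i])).

(* Elements of L_2(R) are represented by complex-valued square-integrable
   functions; equality of elements is equality almost everywhere.  Subspaces
   are sets of functions; those of the form [L2closure A] are saturated for
   almost-everywhere equality. *)
Definition L2 : set (R -> R[i]) :=
  [set f : R -> R[i] | ((@complex.Re R \o f) \in Lfun mu 2%:E)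
        /\ ((@complex.Im R \o f) \in Lfun mu 2%:E)].

Definition L2norm f : \bar R :=
  Lnorm mu 2%:E (fun x => (ComplexField.Normc.normc (f x))%:E).

Definition L2closure A : set (R -> R[i]) :=
  [set f : R -> R[i] | L2 f /\ forall e : R, 0 < e ->
     exists2 g, A g & (L2norm (fun x => (f x - g x)%R) < e%:E)%E].

Definition cintegral (D : set R) f : R[i] :=
  (\int[mu]_(x in D) complex.Re (f x)) +i* (\int[mu]_(x in D) complex.Im (f x)).

Definition L2dot f g : R[i] := cintegral setT (fun x => f x * (g x)^*).

Definition lin_span A : set (R -> R[i]) :=
  [set f : R -> R[i] | exists (n : nat) (c : 'I_n -> R[i]) (g : 'I_n -> R -> R[i]),
     (forall i, A (g i)) /\ f = fun x => \sum_(i < n) c i * g i x].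

Definition closed_span A := L2closure (lin_span A).

Definition sum_space (I : choiceType) (U : I -> set (R -> R[i])) :
    set (R -> R[i]) :=
  [set f : R -> R[i] | exists (s : seq I) (w : I -> R -> R[i]),
     [/\ uniq s, {in s, forall i, U i (w i)} &
         f = fun x => \sum_(i <- s) w i x]].

Definition direct_family (I : choiceType) (U : I -> set (R -> R[i])) : Prop :=
  forall (s : seq I) (w : I -> R -> R[i]),
    uniq s -> {in s, forall i, U i (w i)} ->
    (fun x => \sum_(i <- s) w i x) = cst 0 %[ae mu] ->
    {in s, forall i, w i = cst 0 %[ae mu]}.

Definition orthogonal_family (I : choiceType) (U : I -> set (R -> R[i])) : Prop :=
  forall i j f g, i != j -> U i f -> U j g -> L2dot f g = 0.

(* 1/sqrt(2 pi) times the integral of f(x) e^{-ix xi} over [-n, n]. *)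
Definition fourier_trunc (n : nat) f : R -> R[i] := fun xi =>
  ((Num.sqrt (2 * pi))^-1)%:C *
  cintegral `[- n%:R, n%:R] (fun x => f x * (cos (x * xi) -i* sin (x * xi))).

(* Fourier transform on L_2(R): the L_2-limit of the truncated integrals.  It
   agrees a.e. with the Fourier integral for f in both L_1 and L_2, and it is
   determined up to a.e. equality; [xget] selects a representative. *)
Definition is_fourier f g : Prop :=
  L2 g /\ L2norm (fun xi => fourier_trunc n f xi - g xi) @[n --> \oo] --> 0%E.

Definition fourier f : R -> R[i] := xget (cst 0) [set g | is_fourier f g].

(* Sum over all integers, as the limit of the symmetric partial sums; for f, g
   in L_2(R) the series in [bracket] converges absolutely for a.e. x. *)
Definition sum_int (u : int -> R[i]) : R[i] :=
  limn (fun n : nat => \sum_(i < n.*2.+1) complex.Re (u (i%:Z - n%:Z)))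
  +i* limn (fun n : nat => \sum_(i < n.*2.+1) complex.Im (u (i%:Z - n%:Z))).

Definition bracket f g : R -> R[i] := fun x =>
  sum_int (fun k => f (x + 2 * pi * k%:~R) * (g (x + 2 * pi * k%:~R))^*).

Definition dilate (j k : int) f : R -> R[i] := fun x =>
  (2 `^ (j%:~R / 2))%:C * f (2 ^ j * x - k%:~R).

End L2.

Section Quarklets.
Context {R : realType}.

Definition quark (q : nat) : R -> R[i] := fun x => (x ^+ q * \1_(`[0, 1[) x)%:C.

Definition cdf_dual_symbol (mt : nat) (z : R[i]) : R[i] :=
  let K := ((1 + mt) %/ 2)%N in
  z ^- (mt %/ 2) * ((1 + z) / 2) ^+ mt *
  \sum_(0 <= n < K) ('C(K - 1 + n, n))%:R * ((2 - z - z^-1) / 4) ^+ n.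

Definition is_quarklet_mask (mt : nat) (b : int -> R) : Prop :=
  finite_set [set k | b k != 0] /\
  forall z : R[i], `|z| = 1 ->
    2^-1 * (\sum_(k \in [set: int]) (b k)%:C * z ^ k)
    = - z * (cdf_dual_symbol mt (- z))^*.

Definition quarklet (b : int -> R) (q : nat) : R -> R[i] := fun x =>
  \sum_(k \in [set: int]) (b k)%:C * quark q (2 * x - k%:~R).

(* psi^star_0, ..., psi^star_p are defined only up to a.e. equality, by their
   Fourier transforms; the values of psis beyond p are irrelevant.  Division
   by zero in R[i] yields 0, as in the convention 0/0 = 0. *)
Definition modified_quarklets (b : int -> R) (p : nat)
    (psis : nat -> R -> R[i]) : Prop :=
  [/\ forall q, (q <= p)%N -> L2 (psis q),
      psis 0%N = quarklet b 0 %[ae @lebesgue_measure R] &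
      forall q, (1 <= q <= p)%N ->
        fourier (psis q) =
        (fun xi => fourier (quarklet b q) xi -
           \sum_(l < q)
              bracket (fourier (quarklet b q)) (fourier (psis l)) xi /
              bracket (fourier (psis l)) (fourier (psis l)) xi *
              fourier (psis l) xi)
        %[ae @lebesgue_measure R]].

Definition Vspace (p : nat) (j : int) : set (R -> R[i]) :=
  closed_span [set f | exists (q : nat) (k : int),
                         (q <= p)%N /\ f = dilate j k (quark q)].

Definition Wstar (psis : nat -> R -> R[i]) (p : nat) (j : int) :
    set (R -> R[i]) :=
  closed_span [set f | exists (q : nat) (k : int),
                         (q <= p)%N /\ f = dilate j k (psis q)].

Definition Wstarstar (psis : nat -> R -> R[i]) (q : nat) (j : int) :
    set (R -> R[i]) :=
  closed_span [set f | exists k : int, f = dilate j k (psis q)].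

Definition Wstarstar_family (psis : nat -> R -> R[i]) (p : nat) (j : int) :
    'I_p.+1 -> set (R -> R[i]) :=
  fun q => Wstarstar psis q j.

(* The family (V, W_0, W_1, ...): index None is V, index Some j is W_j. *)
Definition with_base (V : set (R -> R[i])) (W : int -> set (R -> R[i])) :
    option nat -> set (R -> R[i]) :=
  fun o => if o is Some j then W j%:Z else V.

End Quarklets.

Arguments Wstarstar_family {R} psis p j _ _.

(* Main.v *)
Require Import Defs.
From HB Require Import structures.
From mathcomp Require Import all_boot all_order all_algebra.
From mathcomp Require Import all_classical all_reals all_analysis.
From mathcomp Require Import measurable_realfun.
From mathcomp Require Import ring lra zify.
Import Order.TTheory GRing.Theory Num.Theory.
Import numFieldNormedType.Exports.
Set Implicit Arguments.
Unset Strict Implicit.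
Unset Printing Implicit Defensive.
Local Open Scope classical_set_scope.
Local Open Scope ring_scope.

(** Write phi for the quark of degree 0, mt = 2k+1, and B for the polynomial
    [mask_poly], which carries the mask (b_j) shifted by 2k. Every
    decomposition asks for totality, for directness, and (inside one scale) for
    orthogonality.

    Totality. As psi*_0 and psi_0 agree a.e., it suffices that the dilated
    translates of the single function psi_0 are total, or total together with
    the translates of phi. A Bezout identity for binomial sums ([bezout_hom])
    gives (1+z) B(-z) - (1-z) B(z) = 4 z^(2k+1) ([mask_bezout]), so every
    polynomial splits against the filters 1+z and B ([mask_split]): a fine
    translate of phi is a combination of coarse translates of phi and of psi_0
    ([tsum_split]). Descending from the dense dyadic step functions to scale 0
    settles the case with a base space ([base_total]). Without it, let delta be
    the difference of order 2k+1 of phi. Because (1-z)^(2k+1) divides B, the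
    coarse part of a fine translate of delta is again a combination of
    translates of delta, with small coefficients ([mask_split_pow]); each
    coarser scale improves the bound for the distance of delta to the span of
    the dilated quarklets by the factor sqrt 2 / 2 ([delta_near]). Thus delta
    lies in the closed span. The differences are then removed one at a time by
    averaging over long runs of translates ([average_step]), and phi itself
    lies in the closed span ([quarklet_total]).

    Orthogonality. The modification of the quarklets is Gram-Schmidt in the
    square summable sequences over each fibre x + 2 pi Z, and by Plancherel and
    the uniqueness of Fourier coefficients a bracket of transforms vanishes
    a.e. iff one function is orthogonal to all integer translates of the other
    ([bracket_trans]). Hence modified quarklets of different degrees have
    orthogonal translates ([star_orth]), and whatever is orthogonal to all
    translates of the psi_q is orthogonal to all translates of the psi*_q
    ([trans_orth_star]). As only the vanishing of inner products is at stake,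
    Plancherel's identity is proved up to a positive constant ([plancherel]).

    Directness. The quotients of brackets may be unbounded, so the spaces
    generated by the psi*_q are handled through double orthogonal complements
    ([perp2]): W*_j lies in that of the quarklets at scale j, and all spaces of
    lower scale lie in that of the quarks at scale j. In a vanishing finite sum
    the term of top scale therefore lies in both ([direct_chain]), and these
    meet only in 0 ([perp2_inter]): a common element is Q_n(2 (x-n)) on each
    interval [n, n+1), for polynomials Q_n of degree at most p, and
    orthogonality to the functions [antiwave], which are orthogonal to all
    translated quarklets, yields 2 Q_(n-k) = - sum_i B_(2i) (Q_(n-i)(X+1) -
    Q_(n-i)). Differences lower the degree, so all Q_n vanish. *)

(** * Integration on the real line *)

Section RealIntegral.
Context {R : realType}.
Local Notation mu := (@lebesgue_measure R).
Implicit Types (f g h : R -> R).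

Definition itg f : Prop := mu.-integrable [set: R] (EFin \o f).
Definition rint f : R := \int[mu]_x f x.
Definition rmeas f : Prop := measurable_fun [set: R] f.

Lemma aeS (P Q : R -> Prop) : (forall x, P x -> Q x) ->
  (\forall x \ae mu, P x) -> (\forall x \ae mu, Q x).
Proof. by move=> PQ; apply: negligibleS => x /= nQ /PQ. Qed.

Lemma aeI (P Q : R -> Prop) : (\forall x \ae mu, P x) ->
  (\forall x \ae mu, Q x) -> (\forall x \ae mu, P x /\ Q x).
Proof.
move=> p q; have := negligibleU p q; apply: negligibleS => x /=.
by move/not_andP.
Qed.

Lemma aeA (P : nat -> R -> Prop) : (forall n, \forall x \ae mu, P n x) ->
  \forall x \ae mu, forall n, P n x.
Proof.
move=> p; have := negligible_bigcup p; apply: negligibleS => x /=.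
by move/existsNP => [n np]; exists n.
Qed.

Lemma aeT (P : R -> Prop) : (forall x, P x) -> (\forall x \ae mu, P x).
Proof. by move=> p; exact: (aeW mu p). Qed.

Lemma itg_meas f : itg f -> rmeas f.
Proof. by move=> /measurable_int/measurable_EFinP. Qed.

Lemma rmeasE f : rmeas f -> measurable_fun [set: R] (fun x => (f x)%:E).
Proof. by move=> mf; apply/measurable_EFinP. Qed.

Lemma limn_einf_ge0 (u : nat -> \bar R) : (forall n, 0 <= u n)%E ->
  (0 <= limn_einf u)%E.
Proof.
move=> u0; rewrite limn_einf_lim; apply: lime_ge; first exact: is_cvg_einfs.
by apply: nearW => n; apply: le_ereal_inf_tmp => _ [m _ <-].
Qed.

Lemma limn_einf_le (u : nat -> \bar R) C : (forall n, u n <= C)%E ->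
  (limn_einf u <= C)%E.
Proof.
move=> u0; rewrite limn_einf_lim; apply: lime_le; first exact: is_cvg_einfs.
apply: nearW => n; apply: le_trans (u0 n); apply: ereal_inf_lbound.
by exists n => /=.
Qed.

Lemma itgP f : itg f <-> rmeas f /\ (\int[mu]_x `|(f x)%:E| < +oo)%E.
Proof.
split=> [|[mf fi]].
- move=> fi; split; first exact: itg_meas.
  by case/integrableP: fi.
- by apply/integrableP; split=> //; apply/measurable_EFinP.
Qed.

Lemma itg_int f : itg f -> (\int[mu]_x (f x)%:E)%E = (rint f)%:E.
Proof. by move=> fi; rewrite /rint /Rintegral fineK //; apply: integrable_fin_num. Qed.

Lemma itg_le f g : rmeas f -> itg g -> (forall x, `|f x| <= g x) -> itg f.
Proof.
move=> mf gi fg; apply: (le_integrable _ _ _ gi) => //.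
- exact/measurable_EFinP.
- move=> x _ /=; rewrite lee_fin; apply: (le_trans (fg x)); exact: ler_norm.
Qed.

Lemma itgD f g : itg f -> itg g -> itg (fun x => f x + g x).
Proof. by move=> fi gi; apply: (integrableD _ fi gi). Qed.

Lemma itgB f g : itg f -> itg g -> itg (fun x => f x - g x).
Proof. by move=> fi gi; apply: (integrableB _ fi gi). Qed.

Lemma itgN f : itg f -> itg (fun x => - f x).
Proof. by move=> fi; apply: (integrableN fi). Qed.

Lemma itgZ c f : itg f -> itg (fun x => c * f x).
Proof. by move=> fi; apply: (integrableZl _ c fi). Qed.

Lemma itg0 : itg (fun=> 0).
Proof. exact: integrable0. Qed.

Lemma itg_sum (I : Type) (s : seq I) (F : I -> R -> R) :
  (forall i, itg (F i)) -> itg (fun x => \sum_(i <- s) F i x).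
Proof.
move=> Fi; elim: s => [|i s ih].
  by under eq_fun do rewrite big_nil; exact: itg0.
under eq_fun do rewrite big_cons; exact: itgD.
Qed.

Lemma itg_norm f : itg f -> itg (fun x => `|f x|).
Proof. by move=> fi; apply: (integrable_norm fi). Qed.

Lemma rintD f g : itg f -> itg g -> rint (fun x => f x + g x) = rint f + rint g.
Proof. by move=> fi gi; apply: RintegralD. Qed.

Lemma rintB f g : itg f -> itg g -> rint (fun x => f x - g x) = rint f - rint g.
Proof. by move=> fi gi; apply: RintegralB. Qed.

Lemma rintZ c f : itg f -> rint (fun x => c * f x) = c * rint f.
Proof. by move=> fi; apply: RintegralZl. Qed.

Lemma rintN f : itg f -> rint (fun x => - f x) = - rint f.
Proof.
move=> fi; rewrite -[RHS]mulN1r -rintZ //; congr rint.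
by apply/funext => x; rewrite mulN1r.
Qed.

Lemma rint0 : rint (fun=> 0) = 0.
Proof. by rewrite /rint Rintegral_cst //= mul0r. Qed.

Lemma rint_sum (I : Type) (s : seq I) (F : I -> R -> R) :
  (forall i, itg (F i)) ->
  rint (fun x => \sum_(i <- s) F i x) = \sum_(i <- s) rint (F i).
Proof.
move=> Fi; elim: s => [|i s ih].
  by under eq_fun do rewrite big_nil; rewrite big_nil rint0.
under eq_fun do rewrite big_cons; rewrite big_cons -ih rintD //.
exact: itg_sum.
Qed.

Lemma rint_le f g : itg f -> itg g -> (forall x, f x <= g x) -> rint f <= rint g.
Proof. by move=> fi gi fg; apply: le_Rintegral. Qed.

Lemma rint_ge0 f : (forall x, 0 <= f x) -> 0 <= rint f.
Proof. by move=> f0; apply: Rintegral_ge0. Qed.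

Lemma rint_norm f : itg f -> `|rint f| <= rint (fun x => `|f x|).
Proof. by move=> fi; apply: le_normr_Rintegral. Qed.

Lemma rint_ae f g : rmeas f -> rmeas g -> f = g %[ae mu] -> rint f = rint g.
Proof.
move=> mf mg fg; rewrite /rint /Rintegral; congr fine.
apply: ae_eq_integral => //; [exact/measurable_EFinP|exact/measurable_EFinP|].
by apply: aeS fg => x h Dx /=; rewrite h.
Qed.

Lemma itg_ae f g : rmeas g -> f = g %[ae mu] -> itg f -> itg g.
Proof.
move=> mg fg fi; have mf := itg_meas fi; apply/itgP; split=> //.
case/itgP: fi => _; congr (_ < _)%E.
apply: ge0_ae_eq_integral => //.
- by apply/measurable_EFinP/measurableT_comp.
- by apply/measurable_EFinP/measurableT_comp.
- by apply: aeS fg => x h Dx /=; rewrite h.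
Qed.

Lemma rint_eq0 f : itg f -> (forall x, 0 <= f x) -> rint f = 0 ->
  f = cst 0 %[ae mu].
Proof.
move=> fi f0 h.
have mf := itg_meas fi.
have [H _] := ae_eq_integral_abs mu measurableT (rmeasE mf).
have : (\int[mu]_x `|(f x)%:E| = 0)%E.
  rewrite -[RHS]/(0%:E) -h -itg_int //; apply: eq_integral => x _ /=.
  by rewrite ger0_norm.
move/H; apply: aeS => x hx Dx; by have [] := hx Dx.
Qed.

Lemma cvg_ge0 (u : nat -> R) (l : R) : u n @[n --> \oo] --> l ->
  (forall n, 0 <= u n) -> 0 <= l.
Proof.
move=> ul u0; rewrite -(cvg_lim _ ul) //; apply: limr_ge.
  by apply/cvg_ex; exists l.
exact: nearW.
Qed.

Lemma rdct (F : nat -> R -> R) f g : (forall n, rmeas (F n)) -> rmeas f ->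
  itg g -> (forall n x, `|F n x| <= g x) ->
  (\forall x \ae mu, F n x @[n --> \oo] --> f x) ->
  itg f /\ rint (F n) @[n --> \oo] --> rint f.
Proof.
move=> mF mf gi Fg Ff.
have Fi n : itg (F n) by apply: itg_le gi _.
have [] := @dominated_convergence _ _ _ mu setT measurableT
  (fun n x => (F n x)%:E) (fun x => (f x)%:E) (fun x => (g x)%:E).
- by move=> n; exact: rmeasE.
- exact: rmeasE.
- by apply: aeS Ff => x h _; apply: cvg_EFin h; exact: nearW.
- exact: gi.
- by apply: aeW => x n _; rewrite lee_fin.
- move=> fi _ h; split; first exact: fi.
  have := h; rewrite itg_int //.
  under eq_fun do rewrite itg_int //.
  by move/fine_cvgP => [].
Qed.

Lemma rfatou (F : nat -> R -> R) f (C : R) : (forall n, itg (F n)) ->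
  (forall n x, 0 <= F n x) -> rmeas f ->
  (\forall x \ae mu, F n x @[n --> \oo] --> f x) ->
  (forall n, rint (F n) <= C) -> itg f /\ rint f <= C.
Proof.
move=> Fi F0 mf Ff FC.
have ff := @fatou _ _ _ mu setT measurableT (fun n x => (F n x)%:E).
have {}ff : (\int[mu]_x `|(f x)%:E| <= C%:E)%E.
  apply: (@le_trans _ _ (\int[mu]_x limn_einf (fun n => (F n x)%:E))%E).
    apply: ae_ge0_le_integral; rewrite ?measurableT //.
    - by apply: (rmeasE (f := fun x => `|f x|)); apply: measurableT_comp.
    - by move=> x _; apply: limn_einf_ge0 => n; rewrite lee_fin.
    - under eq_fun => x.
        rewrite (_ : limn_einf _ = - limn_esup (fun n => - (F n x)%:E))%E; last first.
          by rewrite -limn_einfN; congr limn_einf; apply/funext => n; rewrite /= opprK.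
        over.
      apply: (@measurableT_comp _ _ _ _ _ _ (@oppe R) _
        (fun x => limn_esup (fun n => - (F n x)%:E)%E)) => //.
      apply: (@measurable_fun_limn_esup _ _ _ setT (fun n x => (- (F n x)%:E)%E)) => n.
      by apply: (@measurableT_comp _ _ _ _ _ _ (@oppe R)) => //; apply: rmeasE; exact: itg_meas.
    - apply: aeS Ff => x h _.
      have h' : (F n x)%:E @[n --> \oo] --> (f x)%:E by apply: cvg_EFin h; exact: nearW.
      rewrite (is_cvg_limn_einfE _); last by apply/cvg_ex; exists (f x)%:E.
      rewrite (cvg_lim _ h') // lee_fin ger0_norm //.
      exact: cvg_ge0 h _.
  apply: (le_trans (ff _ _)) => //.
  - by move=> n; apply: rmeasE; exact: itg_meas.
  - by move=> n x _; rewrite lee_fin.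
  - by apply: limn_einf_le => n; rewrite itg_int // lee_fin.
have fi : itg f.
  apply/itgP; split=> //; exact: le_lt_trans ff (ltry _).
split=> //; rewrite -lee_fin -itg_int //; apply: le_trans ff.
by apply: (le_trans (lee_abs _)); apply: le_abse_integral => //; exact: rmeasE.
Qed.

Lemma meas_affine (a b : R) : measurable_fun [set: R] (fun x : R => a * x + b).
Proof.
by apply: measurable_funD => //; apply: measurable_funM.
Qed.

Definition affine (a b x : R) : R := a * x + b.

(** By uniqueness of Lebesgue measure: |a| times the image measure gives every
    half-open interval its length. *)
Lemma lebesgue_affine (a b : R) : a != 0 -> forall A : set R, measurable A ->
  mu A = (`|a|%:E * mu (affine a b @^-1` A))%E.
Proof.
move=> a0 A mA.
have na : 0 <= `|a| by [].
have mph : measurable_fun [set: measurableTypeR R]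
    (affine a b : measurableTypeR R -> measurableTypeR R) by exact: meas_affine.
pose phi : {mfun measurableTypeR R >-> measurableTypeR R} :=
  HB.pack (affine a b : measurableTypeR R -> measurableTypeR R)
    (isMeasurableFun.Build _ _ _ _ _ mph).
rewrite (@lebesgue_measure_unique R (mscale (NngNum na) (pushforward mu phi)))
  //=.
move=> X [[c d] /= cd <-].
rewrite /mscale /= /pushforward lebesgue_measure_itv /= lte_fin.
have [a_gt0|a_lt0|/eqP] := ltgtP 0 a; last by rewrite eq_sym (negbTE a0).
- rewrite (_ : _ @^-1` _ = `](c - b) / a, (d - b) / a]%classic); last first.
    apply/seteqP; split => x /=; rewrite !in_itv /= /affine;
     by rewrite ltr_pdivrMr // ler_pdivlMr // ltrBlDr lerBrDr (mulrC x).
  rewrite lebesgue_measure_itv /= lte_fin ltr_pM2r ?invr_gt0 // ltrD2r.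
  case: ifP => _; rewrite ?mule0 // -EFinB -EFinM; congr EFin.
  by rewrite gtr0_norm //; field.
- rewrite (_ : _ @^-1` _ = `[(d - b) / a, (c - b) / a[%classic); last first.
    apply/seteqP; split => x /=; rewrite !in_itv /= /affine;
     by rewrite ltr_ndivlMr // ler_ndivrMr // ltrBlDr lerBrDr (mulrC x) andbC.
  rewrite lebesgue_measure_itv /= lte_fin ltr_nM2r ?invr_lt0 // ltrD2r.
  case: ifP => _; rewrite ?mule0 // -EFinB -EFinM; congr EFin.
  by rewrite ltr0_norm //; field.
Qed.

Lemma ge0_integral_affine (a b : R) (f : R -> \bar R) : a != 0 ->
  measurable_fun [set: R] f -> (forall x, 0 <= f x)%E ->
  (\int[mu]_x f x = `|a|%:E * \int[mu]_x f (affine a b x))%E.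
Proof.
move=> a0 mf f0.
have na : 0 <= `|a| by [].
have mph : measurable_fun [set: measurableTypeR R]
    (affine a b : measurableTypeR R -> measurableTypeR R) by exact: meas_affine.
pose phi : {mfun measurableTypeR R >-> measurableTypeR R} :=
  HB.pack (affine a b : measurableTypeR R -> measurableTypeR R)
    (isMeasurableFun.Build _ _ _ _ _ mph).
have := @ge0_integral_pushforward _ _ (measurableTypeR R) (measurableTypeR R) R (affine a b) mph mu setT f
   measurableT mf.
rewrite preimage_setT => <-; last by move=> x _; exact: f0.
rewrite -[(`|a|%:E)]/((NngNum na)%:num%:E).
rewrite -(@ge0_integral_mscale _ _ _ (pushforward mu phi) _ measurableT (NngNum na)) //.
apply: eq_measure_integral => A mA _.
exact: lebesgue_affine.
Qed.

Lemma meas_affine_comp a b f : rmeas f -> rmeas (fun x => f (a * x + b)).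
Proof. by move=> mf; apply: (measurableT_comp mf); exact: meas_affine. Qed.

Lemma itg_affine (a b : R) f : a != 0 -> itg f ->
  itg (fun x => f (a * x + b)).
Proof.
move=> a0 /itgP[mf fi]; apply/itgP; split; first exact: meas_affine_comp.
move: fi; rewrite (@ge0_integral_affine a b (fun x => `|(f x)%:E|%E)) //; last first.
  by apply: (rmeasE (f := fun x => `|f x|)); apply: measurableT_comp.
have := @integral_ge0 _ _ _ mu setT (fun x => `|(f (affine a b x))%:E|%E) _.
move/(_ (fun x _ => abse_ge0 _)).
rewrite /affine; case: (\int[_]_x _)%E => [r|//|] // _.
- by move=> _; rewrite ltry.
- by rewrite mulry gtr0_sg ?normr_gt0 // mul1e.
Qed.

Lemma rint_affine (a b : R) f : a != 0 -> itg f ->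
  rint f = `|a| * rint (fun x => f (a * x + b)).
Proof.
move=> a0 fi; have mf := itg_meas fi.
pose fp := fun x => Num.max (f x) 0; pose fn := fun x => Num.max (- f x) 0.
have E : f = (fun x => fp x - fn x).
  apply/funext => x; rewrite /fp /fn /Num.max.
  by case: (ltP (f x) 0); case: (ltP (- f x) 0); lra.
have mp : rmeas fp by apply: measurable_maxr.
have mn : rmeas fn by apply: measurable_maxr => //; exact: measurable_funN.
have ip : itg fp.
  apply: itg_le mp (itg_norm fi) _ => x; rewrite /fp /Num.max.
  by case: ltP; rewrite ?normr0.
have in_ : itg fn.
  apply: itg_le mn (itg_norm fi) _ => x; rewrite /fn /Num.max.
  by case: ltP; rewrite ?normr0 ?normrN.
have K h : itg h -> (forall x, 0 <= h x) ->
    rint h = `|a| * rint (fun x => h (a * x + b)).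
  move=> hi h0; apply: EFin_inj; rewrite EFinM -!itg_int //; last exact: itg_affine.
  apply: (@ge0_integral_affine a b (fun x => (h x)%:E)) => //.
  by apply: rmeasE; exact: itg_meas.
rewrite [in LHS]E [X in _ * rint X](_ : _ = fun x => fp (a * x + b) - fn (a * x + b)); last first.
  by apply/funext => x; rewrite [in LHS]E.
rewrite !rintB //; try exact: itg_affine.
by rewrite mulrBr -!K // => x; rewrite /fp /fn le_max lexx orbT.
Qed.

Lemma ae_affine (a b : R) (P : R -> Prop) : a != 0 -> (\forall x \ae mu, P x) ->
  \forall x \ae mu, P (a * x + b).
Proof.
move=> a0 [A [mA A0 PA]]; exists (affine a b @^-1` A); split.
- by rewrite -[_ @^-1` _]setTI; apply: meas_affine.
- have := lebesgue_affine b a0 mA; rewrite A0 => /esym/eqP.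
  by rewrite mule_eq0 eqe normr_eq0 (negbTE a0) /= => /eqP.
- by move=> x /= nP; exact: PA.
Qed.

(** Monotone convergence for series, with a finite-valued representative of the
    sum. *)
Lemma itg_series (u : nat -> R -> R) (C : R) : (forall n, itg (u n)) ->
  (forall n x, 0 <= u n x) -> (forall n, \sum_(i < n) rint (u i) <= C) ->
  exists g, [/\ itg g, rint g <= C &
   \forall x \ae mu, (fun n => \sum_(i < n) u i x) n @[n --> \oo] --> g x].
Proof.
move=> ui u0 uC.
pose G x := (\sum_(n <oo) (u n x)%:E)%E.
have iG : (\int[mu]_x G x <= C%:E)%E.
  rewrite integral_nneseries //; first last.
  - by move=> n x _; rewrite lee_fin.
  - by move=> n; apply: rmeasE; exact: itg_meas.
  apply: lime_le; first by apply: is_cvg_nneseries => n _ _; apply: integral_ge0 => x _; rewrite lee_fin.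
  apply: nearW => n; rewrite big_mkord.
  under eq_bigr do rewrite itg_int //.
  by rewrite sumEFin lee_fin.
have G0 x : (0 <= G x)%E by apply: nneseries_ge0 => n _ _; rewrite lee_fin.
have mG : measurable_fun [set: R] G.
  apply: ge0_emeasurable_sum => // n *; rewrite ?lee_fin //.
  by apply: rmeasE; exact: itg_meas.
have GI : mu.-integrable [set: R] G.
  apply/integrableP; split => //; apply: le_lt_trans (ltry C).
  by under eq_integral do rewrite gee0_abs //.
have aG := integrable_ae measurableT GI.
have fG : \forall x \ae mu, G x = (fine (G x))%:E.
  by apply: aeS aG => x h; rewrite fineK //; exact: h.
have mfG : rmeas (fun x => fine (G x)).
  exact: (measurableT_comp (fine_measurable measurableT) mG).
have ig : itg (fun x => fine (G x)).
  apply/itgP; split => //; apply: le_lt_trans (ltry C); apply: le_trans iG.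
  apply: ge0_le_integral => //.
  - by apply: (rmeasE (f := fun x => `|fine (G x)|)); apply: measurableT_comp.
  - move=> x _ /=; rewrite ger0_norm ?fine_ge0 //.
    by case: (G x) (G0 x) => [r|//|//] _; rewrite ?leey.
exists (fun x => fine (G x)); split => //.
- rewrite -lee_fin -itg_int //; apply: le_trans iG.
  apply: ge0_le_integral => //.
  - by move=> x _; rewrite lee_fin fine_ge0.
  - by apply: rmeasE.
  - by move=> x _ /=; case: (G x) (G0 x) => [r|//|//] _; rewrite ?leey.
- apply: aeS fG => x hx.
  have : (\sum_(0 <= i < n) (u i x)%:E)%E @[n --> \oo] --> G x.
    by apply: is_cvg_nneseries => n _ _; rewrite lee_fin.
  rewrite hx; under eq_fun do rewrite sumEFin big_mkord.
  by move/fine_cvgP => [].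
Qed.

End RealIntegral.

(** * Complex square-integrable functions *)

Section ComplexL2.
Context {R : realType}.
Local Notation mu := (@lebesgue_measure R).
Local Open Scope complex_scope.
Local Notation Re := complex.Re.
Local Notation Im := complex.Im.
Implicit Types (f g h : R -> R[i]) (z w c : R[i]).

(** The squared modulus as an element of [R], so that it can be integrated and
    compared. *)
Definition sqc z : R := Re z ^+ 2 + Im z ^+ 2.

Lemma ReD z w : Re (z + w) = Re z + Re w. Proof. by case: z; case: w. Qed.
Lemma ImD z w : Im (z + w) = Im z + Im w. Proof. by case: z; case: w. Qed.
Lemma ReN z : Re (- z) = - Re z. Proof. by case: z. Qed.
Lemma ImN z : Im (- z) = - Im z. Proof. by case: z. Qed.
Lemma ReM z w : Re (z * w) = Re z * Re w - Im z * Im w.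
Proof. by case: z; case: w. Qed.
Lemma ImM z w : Im (z * w) = Re z * Im w + Im z * Re w.
Proof. by case: z; case: w => a b c d /=. Qed.
Lemma ReJ z : Re z^* = Re z. Proof. by case: z. Qed.
Lemma ImJ z : Im z^* = - Im z. Proof. by case: z. Qed.
Lemma ReC (x : R) : Re x%:C = x. Proof. by []. Qed.
Lemma ImC (x : R) : Im x%:C = 0. Proof. by []. Qed.
Lemma ReK (x y : R) : Re (x +i* y) = x. Proof. by []. Qed.
Lemma ImK (x y : R) : Im (x +i* y) = y. Proof. by []. Qed.
Lemma Re0 : Re (0 : R[i]) = 0. Proof. by []. Qed.
Lemma Im0 : Im (0 : R[i]) = 0. Proof. by []. Qed.
Lemma Re1 : Re (1 : R[i]) = 1. Proof. by []. Qed.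
Lemma Im1 : Im (1 : R[i]) = 0. Proof. by []. Qed.
Definition cE := (ReK, ImK, ReC, ImC, Re0, Im0, Re1, Im1,
  ReD, ImD, ReN, ImN, ReM, ImM, ReJ, ImJ).

Lemma eqcP z w : Re z = Re w -> Im z = Im w -> z = w.
Proof. by case: z; case: w => a b c d /= -> ->. Qed.

Lemma sqc_ge0 z : 0 <= sqc z.
Proof. by rewrite addr_ge0 ?sqr_ge0. Qed.

Lemma sqc0 : sqc 0 = 0. Proof. by rewrite /sqc !cE expr0n /= addr0. Qed.

Lemma sqc_eq0 z : sqc z = 0 -> z = 0.
Proof.
move=> /eqP; rewrite paddr_eq0 ?sqr_ge0 // !sqrf_eq0 => /andP[/eqP a /eqP b].
exact: eqcP.
Qed.

Lemma sqcM z w : sqc (z * w) = sqc z * sqc w.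
Proof. by rewrite /sqc !cE; ring. Qed.

Lemma sqcJ z : sqc z^* = sqc z.
Proof. by rewrite /sqc !cE; ring. Qed.

Lemma sqcN z : sqc (- z) = sqc z.
Proof. by rewrite /sqc !cE; ring. Qed.

Lemma sqcC (x : R) : sqc x%:C = x ^+ 2.
Proof. by rewrite /sqc !cE; ring. Qed.

Lemma sqcD_le z w : sqc (z + w) <= 2 * sqc z + 2 * sqc w.
Proof.
rewrite /sqc !cE.
have := sqr_ge0 (Re z - Re w); have := sqr_ge0 (Im z - Im w); nra.
Qed.

Lemma mulJ_sqc z : z * z^* = (sqc z)%:C.
Proof. by apply: eqcP; rewrite !cE /sqc; ring. Qed.

Lemma normcE z : ComplexField.Normc.normc z = Num.sqrt (sqc z).
Proof. by case: z. Qed.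

Definition cmeas f := rmeas (fun x => Re (f x)) /\ rmeas (fun x => Im (f x)).
Definition citg f := itg (fun x => Re (f x)) /\ itg (fun x => Im (f x)).
Definition cint f : R[i] := rint (fun x => Re (f x)) +i* rint (fun x => Im (f x)).
(** The squared norm, which spares the root and the extended reals of [L2norm].
    *)
Definition N2 f : R := rint (fun x => sqc (f x)).

Lemma citg_meas f : citg f -> cmeas f.
Proof. by case=> /itg_meas ? /itg_meas. Qed.

Lemma cmeas_sqc f : cmeas f -> rmeas (fun x => sqc (f x)).
Proof. by case=> a b; apply: measurable_funD; apply: measurable_funX. Qed.

Lemma cmeasD f g : cmeas f -> cmeas g -> cmeas (fun x => f x + g x).
Proof.
move=> [a b] [c d]; split; under eq_fun do rewrite cE; exact: measurable_funD.
Qed.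

Lemma cmeasM f g : cmeas f -> cmeas g -> cmeas (fun x => f x * g x).
Proof.
move=> [a b] [c d]; split; under eq_fun do rewrite cE.
  by apply: measurable_funB; apply: measurable_funM.
by apply: measurable_funD; apply: measurable_funM.
Qed.

Lemma cmeasJ f : cmeas f -> cmeas (fun x => (f x)^*).
Proof.
move=> [a b]; split; under eq_fun do rewrite cE => //.
  exact: a.
exact: measurable_funN.
Qed.

Lemma cmeas_cst c : cmeas (fun=> c).
Proof. by split; apply: measurable_cst. Qed.

Lemma cmeasZ c f : cmeas f -> cmeas (fun x => c * f x).
Proof. by move=> mf; apply: cmeasM => //; exact: cmeas_cst. Qed.

Lemma cmeas_affine a b f : cmeas f -> cmeas (fun x => f (a * x + b)).
Proof.
case=> mr mi; split.
  exact: (meas_affine_comp a b mr).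
exact: (meas_affine_comp a b mi).
Qed.

Lemma citgD f g : citg f -> citg g -> citg (fun x => f x + g x).
Proof. by move=> [a b] [c d]; split; under eq_fun do rewrite cE; exact: itgD. Qed.

Lemma citgZ c f : citg f -> citg (fun x => c * f x).
Proof.
move=> [a b]; split; under eq_fun do rewrite cE.
  by apply: itgB; exact: itgZ.
by apply: itgD; exact: itgZ.
Qed.

Lemma citg0 : citg (fun=> 0).
Proof. by split; exact: itg0. Qed.

Lemma citg_sum (I : Type) (s : seq I) (F : I -> R -> R[i]) :
  (forall i, citg (F i)) -> citg (fun x => \sum_(i <- s) F i x).
Proof.
move=> Fi; elim: s => [|i s ih].
  by under eq_fun do rewrite big_nil; exact: citg0.
under eq_fun do rewrite big_cons; exact: citgD.
Qed.

Lemma cintD f g : citg f -> citg g -> cint (fun x => f x + g x) = cint f + cint g.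
Proof.
move=> [a b] [c d]; apply: eqcP; rewrite !cE /= -rintD //; congr rint;
  by apply/funext => x; rewrite !cE.
Qed.

Lemma cintZ c f : citg f -> cint (fun x => c * f x) = c * cint f.
Proof.
move=> [a b]; apply: eqcP; rewrite !cE /= -!rintZ // -?rintD -?rintB; try exact: itgZ;
  by congr rint; apply/funext => x; rewrite !cE.
Qed.

Lemma cint0 : cint (fun=> 0) = 0.
Proof. by apply: eqcP; rewrite /= rint0. Qed.

Lemma cint_sum (I : Type) (s : seq I) (F : I -> R -> R[i]) :
  (forall i, citg (F i)) ->
  cint (fun x => \sum_(i <- s) F i x) = \sum_(i <- s) cint (F i).
Proof.
move=> Fi; elim: s => [|i s ih].
  by under eq_fun do rewrite big_nil; rewrite big_nil cint0.
under eq_fun do rewrite big_cons; rewrite big_cons -ih cintD //.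
exact: citg_sum.
Qed.

Lemma cint_ae f g : cmeas f -> cmeas g -> f = g %[ae mu] -> cint f = cint g.
Proof.
move=> [a b] [c d] fg; apply: eqcP; rewrite /=; apply: rint_ae => //;
  by apply: aeS fg => x h Dx; rewrite h.
Qed.

Lemma cint_affine (a b : R) f : a != 0 -> citg f ->
  cint f = `|a|%:C * cint (fun x => f (a * x + b)).
Proof.
move=> a0 [c d]; apply: eqcP; rewrite !cE !mul0r ?subr0 ?addr0 /=.
  exact: (rint_affine b a0 c).
exact: (rint_affine b a0 d).
Qed.

Lemma L2P f : L2 f <-> cmeas f /\ itg (fun x => sqc (f x)).
Proof.
split=> [[fr fi]|[[mr mi] fs]].
- have mr : rmeas (fun x => Re (f x)).
    by move: fr; rewrite inE => /andP[]; rewrite inE.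
  have mi : rmeas (fun x => Im (f x)).
    by move: fi; rewrite inE => /andP[]; rewrite inE.
  split=> //; apply: itgD.
    exact: (Lfun2_integrable_sqr fr).
  exact: (Lfun2_integrable_sqr fi).
- have K (u : R -> R) : rmeas u -> (forall x, u x ^+ 2 <= sqc (f x)) ->
      u \in Lfun mu 2%:E.
    move=> mu_ us; rewrite inE; apply/andP; split; rewrite inE //=.
    rewrite /finite_norm unlock /=; apply: poweR_lty.
    have : itg (fun x => u x ^+ 2).
      apply: (itg_le _ fs) => [|x]; first exact: measurable_funX.
      by rewrite ger0_norm ?sqr_ge0.
    case/itgP => _; congr (_ < _)%E; apply: eq_integral => x _ /=.
    by rewrite powR_mulrn // normrX.
  by split; apply: K => // x; rewrite /sqc ?lerDl ?lerDr sqr_ge0.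
Qed.

Lemma L2_meas f : L2 f -> cmeas f. Proof. by case/L2P. Qed.
Lemma L2_sqc f : L2 f -> itg (fun x => sqc (f x)). Proof. by case/L2P. Qed.

Lemma N2_ge0 f : 0 <= N2 f.
Proof. by apply: rint_ge0 => x; exact: sqc_ge0. Qed.

Lemma L2norm_N2 f : L2 f -> L2norm f = (Num.sqrt (N2 f))%:E.
Proof.
move=> /L2P[mf fi]; rewrite /L2norm unlock /=.
rewrite (_ : (\int[mu]_x _)%E = (N2 f)%:E).
  by rewrite poweR_EFin powR12_sqrt // N2_ge0.
rewrite /N2 -itg_int //; apply: eq_integral => x _ /=.
by rewrite normcE powR_mulrn // real_normK ?num_real // sqr_sqrtr // sqc_ge0.
Qed.

Lemma L2norm_lt f (e : R) : L2 f -> 0 < e ->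
  (L2norm f < e%:E)%E = (N2 f < e ^+ 2).
Proof.
move=> Lf e0; rewrite L2norm_N2 // lte_fin.
by rewrite -[X in _ < X](gtr0_norm e0) -sqrtr_sqr ltr_sqrt // exprn_gt0.
Qed.

Lemma L2D f g : L2 f -> L2 g -> L2 (fun x => f x + g x).
Proof.
move=> /L2P[mf fi] /L2P[mg gi]; apply/L2P; split; first exact: cmeasD.
apply: (itg_le _ (itgD (itgZ 2 fi) (itgZ 2 gi))).
  by apply: cmeas_sqc; exact: cmeasD.
by move=> x; rewrite ger0_norm ?sqc_ge0 // sqcD_le.
Qed.

Lemma L2_bddM (M : R) g f : cmeas g -> (forall x, sqc (g x) <= M) -> L2 f ->
  L2 (fun x => g x * f x).
Proof.
move=> mg gM /L2P[mf fi]; apply/L2P; split; first exact: cmeasM.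
apply: (itg_le _ (itgZ M fi)).
  by apply: cmeas_sqc; exact: cmeasM.
by move=> x; rewrite ger0_norm ?sqc_ge0 // sqcM ler_wpM2r ?sqc_ge0.
Qed.

Lemma L2Z c f : L2 f -> L2 (fun x => c * f x).
Proof.
by apply: (@L2_bddM (sqc c) (fun=> c)) => //; exact: cmeas_cst.
Qed.

Lemma L2N f : L2 f -> L2 (fun x => - f x).
Proof. by move=> /(L2Z (-1)); under eq_fun do rewrite mulN1r. Qed.

Lemma L2B f g : L2 f -> L2 g -> L2 (fun x => f x - g x).
Proof. by move=> Lf Lg; apply: L2D => //; exact: L2N. Qed.

Lemma L2_0 : L2 (fun=> 0 : R[i]).
Proof.
apply/L2P; split; first exact: cmeas_cst.
by under eq_fun do rewrite sqc0; exact: itg0.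
Qed.

Lemma L2_sum (I : Type) (s : seq I) (F : I -> R -> R[i]) :
  (forall i, L2 (F i)) -> L2 (fun x => \sum_(i <- s) F i x).
Proof.
move=> Fi; elim: s => [|i s ih].
  by under eq_fun do rewrite big_nil; exact: L2_0.
under eq_fun do rewrite big_cons; exact: L2D.
Qed.

Lemma L2_affine (a b : R) f : a != 0 -> L2 f -> L2 (fun x => f (a * x + b)).
Proof.
move=> a0 /L2P[mf fi]; apply/L2P; split; first exact: cmeas_affine.
exact: (itg_affine b a0 fi).
Qed.

Lemma N2_affine (a b : R) f : a != 0 -> L2 f ->
  N2 f = `|a| * N2 (fun x => f (a * x + b)).
Proof. by move=> a0 /L2_sqc fi; exact: (rint_affine b a0 fi). Qed.

Lemma N2_ae f g : cmeas f -> cmeas g -> f = g %[ae mu] -> N2 f = N2 g.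
Proof.
move=> mf mg fg; apply: rint_ae; try exact: cmeas_sqc.
by apply: aeS fg => x h Dx; rewrite h.
Qed.

Lemma N2_eq0 f : L2 f -> N2 f = 0 -> f = cst 0 %[ae mu].
Proof.
move=> /L2P[mf fi] f0; have := rint_eq0 fi (fun x => sqc_ge0 (f x)) f0.
by apply: aeS => x h Dx; apply: sqc_eq0; apply: h.
Qed.

Lemma N2D_le f g : L2 f -> L2 g -> N2 (fun x => f x + g x) <= 2 * N2 f + 2 * N2 g.
Proof.
move=> Lf Lg; rewrite /N2 -!rintZ ?L2_sqc //; try exact: L2_sqc.
rewrite -rintD; try by apply: itgZ; exact: L2_sqc.
apply: rint_le; first exact: L2_sqc (L2D Lf Lg).
  by apply: itgD; apply: itgZ; exact: L2_sqc.
by move=> x; exact: sqcD_le.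
Qed.

Lemma N2Z c f : L2 f -> N2 (fun x => c * f x) = sqc c * N2 f.
Proof.
move=> Lf; rewrite -rintZ; last exact: L2_sqc.
by congr rint; apply/funext => x; rewrite sqcM.
Qed.

Lemma N2N f : N2 (fun x => - f x) = N2 f.
Proof. by congr rint; apply/funext => x; rewrite sqcN. Qed.

Lemma citg_dot f g : L2 f -> L2 g -> citg (fun x => f x * (g x)^*).
Proof.
move=> Lf Lg; have [mf fi] := (L2P f).1 Lf; have [mg gi] := (L2P g).1 Lg.
have [m1 m2] := cmeasM mf (cmeasJ mg).
have ii := itgD fi gi.
split; apply: (itg_le _ ii) => // x; rewrite /sqc !cE ler_norml.
  have := sqr_ge0 (Re (f x) - Re (g x)); have := sqr_ge0 (Im (f x) - Im (g x)).
  have := sqr_ge0 (Re (f x) + Re (g x)); have := sqr_ge0 (Im (f x) + Im (g x)).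
  by move=> *; apply/andP; split; nra.
have := sqr_ge0 (Re (f x) - Im (g x)); have := sqr_ge0 (Im (f x) - Re (g x)).
have := sqr_ge0 (Re (f x) + Im (g x)); have := sqr_ge0 (Im (f x) + Re (g x)).
by move=> *; apply/andP; split; nra.
Qed.

Lemma dotE f g : L2dot f g = cint (fun x => f x * (g x)^*).
Proof. by []. Qed.

Lemma dotDl f g h : L2 f -> L2 g -> L2 h ->
  L2dot (fun x => f x + g x) h = L2dot f h + L2dot g h.
Proof.
move=> Lf Lg Lh; rewrite !dotE -cintD; try exact: citg_dot.
by congr cint; apply/funext => x; rewrite mulrDl.
Qed.

Lemma dotDr f g h : L2 f -> L2 g -> L2 h ->
  L2dot h (fun x => f x + g x) = L2dot h f + L2dot h g.
Proof.
move=> Lf Lg Lh; rewrite !dotE -cintD; try exact: citg_dot.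
by congr cint; apply/funext => x; rewrite rmorphD mulrDr.
Qed.

Lemma dotZl c f h : L2 f -> L2 h -> L2dot (fun x => c * f x) h = c * L2dot f h.
Proof.
move=> Lf Lh; rewrite !dotE -cintZ; last exact: citg_dot.
by congr cint; apply/funext => x; rewrite mulrA.
Qed.

Lemma dotZr c f h : L2 f -> L2 h -> L2dot h (fun x => c * f x) = c^* * L2dot h f.
Proof.
move=> Lf Lh; rewrite !dotE -cintZ; last exact: citg_dot.
by congr cint; apply/funext => x; rewrite rmorphM mulrCA.
Qed.

Lemma dotNl f h : L2 f -> L2 h -> L2dot (fun x => - f x) h = - L2dot f h.
Proof.
move=> Lf Lh; rewrite -[RHS]mulN1r -dotZl // dotE [RHS]dotE.
by congr cint; apply/funext => x; rewrite mulN1r.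
Qed.

Lemma dotBl f g h : L2 f -> L2 g -> L2 h ->
  L2dot (fun x => f x - g x) h = L2dot f h - L2dot g h.
Proof. by move=> Lf Lg Lh; rewrite dotDl ?dotNl //; exact: L2N. Qed.

Lemma dot0l h : L2dot (fun=> 0) h = 0.
Proof.
rewrite dotE -[RHS]cint0; congr cint; apply/funext => x; exact: mul0r.
Qed.

Lemma dotC f g : L2 f -> L2 g -> L2dot g f = (L2dot f g)^*.
Proof.
move=> Lf Lg; have [a b] := citg_dot Lf Lg; apply: eqcP; rewrite !cE /=.
  by congr rint; apply/funext => x; rewrite !cE; ring.
rewrite -rintN //; congr rint; apply/funext => x; rewrite !cE; ring.
Qed.

Lemma dot_suml (I : Type) (s : seq I) (F : I -> R -> R[i]) h :
  (forall i, L2 (F i)) -> L2 h ->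
  L2dot (fun x => \sum_(i <- s) F i x) h = \sum_(i <- s) L2dot (F i) h.
Proof.
move=> LF Lh; rewrite -cint_sum; last by move=> i; exact: citg_dot.
by congr cint; apply/funext => x; rewrite mulr_suml.
Qed.

Lemma dot_self f : L2dot f f = (N2 f)%:C.
Proof.
apply: eqcP; rewrite /= ?ReC.
  by congr rint; apply/funext => x; rewrite mulJ_sqc.
by rewrite -[RHS]rint0; congr rint; apply/funext => x; rewrite mulJ_sqc.
Qed.

Lemma N2D f g : L2 f -> L2 g ->
  N2 (fun x => f x + g x) = N2 f + N2 g + 2 * Re (L2dot f g).
Proof.
move=> Lf Lg; apply: complexI; rewrite -dot_self.
rewrite dotDl ?dotDr //; try exact: L2D.
rewrite !dot_self (dotC Lf Lg).
by apply: eqcP; rewrite !cE; ring.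
Qed.

Lemma cauchy_schwarz f g : L2 f -> L2 g -> sqc (L2dot f g) <= N2 f * N2 g.
Proof.
move=> Lf Lg; set d := L2dot f g.
(* the squared norm of f - t d g *)
have K (t : R) : 0 <= N2 f - 2 * t * sqc d + t ^+ 2 * sqc d * N2 g.
  have Lh : L2 (fun x => (- t%:C * d) * g x) by exact: L2Z.
  have := N2_ge0 (fun x => f x + (- t%:C * d) * g x).
  rewrite N2D // N2Z // dotZr // -/d sqcM sqcN sqcC.
  rewrite [X in _ <= X -> _](_ : _ = N2 f - 2 * t * sqc d + t ^+ 2 * sqc d * N2 g) //.
  by rewrite /sqc !cE; ring.
have := N2_ge0 g; have := sqc_ge0 d; rewrite le_eqVlt => /predU1P[<-|d0].
  by move=> ?; rewrite mulr_ge0 ?N2_ge0.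
rewrite le_eqVlt => /predU1P[g0|g0].
  (* for null [g] the bound [K] is affine in [t] and fails at this value *)
  have := K ((N2 f + 1) / (2 * sqc d)); rewrite -g0 !mulr0 addr0 => h.
  move: h; rewrite (_ : 2 * _ * sqc d = N2 f + 1); first by lra.
  by field; rewrite gt_eqF.
have := K (N2 g)^-1 => h.
rewrite -ler_pdivrMr // -subr_ge0.
move: h; congr (_ <= _); field; rewrite gt_eqF //.
Qed.

Definition nrm f : R := Num.sqrt (N2 f).

Lemma nrm_ge0 f : 0 <= nrm f. Proof. exact: sqrtr_ge0. Qed.

Lemma nrm_sqr f : nrm f ^+ 2 = N2 f.
Proof. by rewrite sqr_sqrtr // N2_ge0. Qed.

Lemma nrmD f g : L2 f -> L2 g -> nrm (fun x => f x + g x) <= nrm f + nrm g.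
Proof.
move=> Lf Lg; rewrite -(@ler_pXn2r _ 2) ?nnegrE ?addr_ge0 ?nrm_ge0 //.
rewrite nrm_sqr N2D // sqrrD !nrm_sqr.
have : Re (L2dot f g) <= nrm f * nrm g.
  apply: le_trans (ler_norm _) _.
  rewrite -(@ler_pXn2r _ 2) ?nnegrE ?mulr_ge0 ?nrm_ge0 // exprMn !nrm_sqr.
  apply: le_trans (cauchy_schwarz Lf Lg); rewrite real_normK ?num_real // /sqc lerDl.
  exact: sqr_ge0.
lra.
Qed.

Lemma nrmZ c f : L2 f -> nrm (fun x => c * f x) = Num.sqrt (sqc c) * nrm f.
Proof. by move=> Lf; rewrite /nrm N2Z // sqrtrM // sqc_ge0. Qed.

Lemma nrm_affine (a b : R) f : a != 0 -> L2 f ->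
  nrm f = Num.sqrt `|a| * nrm (fun x => f (a * x + b)).
Proof. by move=> a0 Lf; rewrite /nrm (N2_affine b a0 Lf) sqrtrM. Qed.

Lemma nrm_sum (I : Type) (s : seq I) (F : I -> R -> R[i]) :
  (forall i, L2 (F i)) ->
  nrm (fun x => \sum_(i <- s) F i x) <= \sum_(i <- s) nrm (F i).
Proof.
move=> Fi; elim: s => [|i s ih].
  rewrite big_nil; under eq_fun do rewrite big_nil.
  rewrite /nrm /N2; under eq_fun do rewrite sqc0; by rewrite rint0 sqrtr0.
rewrite big_cons; under eq_fun do rewrite big_cons.
apply: le_trans (nrmD _ _) _ => //; first exact: L2_sum.
by rewrite lerD2l.
Qed.

Lemma clP (A : set (R -> R[i])) f : A `<=` L2 ->
  L2closure A f <-> L2 f /\ forall e : R, 0 < e ->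
    exists2 g, A g & N2 (fun x => f x - g x) < e.
Proof.
move=> AL; split=> -[Lf H]; split => // e e0.
- have [|g Ag] := H (Num.sqrt e); first by rewrite sqrtr_gt0.
  have Lg := AL _ Ag.
  rewrite L2norm_lt ?sqrtr_gt0 ?sqr_sqrtr ?ltW //; last exact: L2B.
  by exists g.
- have [|g Ag] := H (e ^+ 2); first by rewrite exprn_gt0.
  have Lg := AL _ Ag.
  by move=> h; exists g => //; rewrite L2norm_lt //; exact: L2B.
Qed.

(** Orthogonality passes to closures by the Cauchy-Schwarz inequality. *)
Lemma cl_dot0 (A : set (R -> R[i])) f h : A `<=` L2 -> L2 h ->
  (forall g, A g -> L2dot g h = 0) -> L2closure A f -> L2dot f h = 0.
Proof.
move=> AL Lh Ah /(clP _ AL)[Lf fA]; apply: sqc_eq0; apply/eqP.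
rewrite eq_le sqc_ge0 andbT; apply/ler_addgt0Pl => e e0; rewrite addr0.
have [|g Ag] := fA (e / (N2 h + 1)).
  by rewrite divr_gt0 // ltr_wpDl ?N2_ge0.
have Lg := AL _ Ag; have Lfg := L2B Lf Lg.
rewrite ltr_pdivlMr ?ltr_wpDl ?N2_ge0 // => fg.
have -> : L2dot f h = L2dot (fun x => f x - g x) h.
  by rewrite dotBl // (Ah _ Ag) subr0.
apply: le_trans (cauchy_schwarz Lfg Lh) _; apply: le_trans (ltW fg).
by rewrite ler_wpM2l ?N2_ge0 // lerDl.
Qed.

Lemma span_L2 (A : set (R -> R[i])) : A `<=` L2 -> lin_span A `<=` L2.
Proof.
move=> AL f [n [c [g [Ag ->]]]]; apply: L2_sum => i; apply: L2Z.
exact: AL.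
Qed.

Lemma span_dot0 (A : set (R -> R[i])) f h : A `<=` L2 -> L2 h ->
  (forall g, A g -> L2dot g h = 0) -> lin_span A f -> L2dot f h = 0.
Proof.
move=> AL Lh Ah [n [c [g [Ag ->]]]].
rewrite dot_suml //; last by move=> i; apply: L2Z; exact: AL.
by rewrite big1 // => i _; rewrite dotZl ?Ah ?mulr0 //; exact: AL.
Qed.

Lemma clspan_dot0 (A : set (R -> R[i])) f h : A `<=` L2 -> L2 h ->
  (forall g, A g -> L2dot g h = 0) -> closed_span A f -> L2dot f h = 0.
Proof.
move=> AL Lh Ah; apply: cl_dot0 => //; first exact: span_L2.
by move=> g; apply: span_dot0.
Qed.

Lemma sub_span (A : set (R -> R[i])) : A `<=` lin_span A.
Proof.
move=> f Af; exists 1%N, (fun=> 1), (fun=> f); split => //.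
by apply/funext => x; rewrite big_ord_recl big_ord0 addr0 mul1r.
Qed.

Lemma sub_cl (A : set (R -> R[i])) : A `<=` L2 -> A `<=` L2closure A.
Proof.
move=> AL f Af; apply/(clP _ AL); split; first exact: AL.
move=> e e0; exists f => //; rewrite /N2; under eq_fun do rewrite subrr sqc0.
by rewrite rint0.
Qed.

Lemma clS (A B : set (R -> R[i])) : A `<=` B -> L2closure A `<=` L2closure B.
Proof.
by move=> AB f [Lf H]; split=> // e /H[g Ag h]; exists g => //; exact: AB.
Qed.

Lemma spanS (A B : set (R -> R[i])) : A `<=` B -> lin_span A `<=` lin_span B.
Proof.
by move=> AB f [n [c [g [Ag ->]]]]; exists n, c, g; split => // i; exact: AB.
Qed.

Lemma spanD (A : set (R -> R[i])) f g : lin_span A f -> lin_span A g ->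
  lin_span A (fun x => f x + g x).
Proof.
move=> [n [c [u [Au ->]]]] [m [d [v [Av ->]]]].
exists (n + m)%N, (fun i => match fintype.split i with inl j => c j | inr k => d k end),
  (fun i => match fintype.split i with inl j => u j | inr k => v k end); split.
  by move=> i; case: fintype.split.
apply/funext => x; rewrite big_split_ord /=; congr (_ + _); apply: eq_bigr => i _.
  by rewrite (unsplitK (inl i)).
by rewrite (unsplitK (inr i)).
Qed.

Lemma spanZ (A : set (R -> R[i])) c f : lin_span A f -> lin_span A (fun x => c * f x).
Proof.
move=> [n [d [u [Au ->]]]]; exists n, (fun i => c * d i), u; split => //.
by apply/funext => x; rewrite mulr_sumr; apply: eq_bigr => i _; rewrite mulrA.
Qed.

Lemma span0 (A : set (R -> R[i])) : lin_span A (fun=> 0).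
Proof.
exists 0%N, (fun=> 0), (fun=> fun=> 0); split; first by case.
by apply/funext => x; rewrite big_ord0.
Qed.

Lemma span_sum (I : Type) (s : seq I) (A : set (R -> R[i])) (F : I -> R -> R[i]) :
  (forall i, lin_span A (F i)) -> lin_span A (fun x => \sum_(i <- s) F i x).
Proof.
move=> AF; elim: s => [|i s ih].
  by under eq_fun do rewrite big_nil; exact: span0.
under eq_fun do rewrite big_cons; exact: spanD.
Qed.

Lemma cl_idem (A : set (R -> R[i])) : A `<=` L2 ->
  L2closure (L2closure A) `<=` L2closure A.
Proof.
move=> AL f /clP[]; first by move=> g [].
move=> Lf H; apply/(clP _ AL); split => // e e0.
have [|g /(clP _ AL)[Lg Hg] fg] := H (e / 4); first by rewrite divr_gt0.
have [|h Ah gh] := Hg (e / 4); first by rewrite divr_gt0.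
exists h => //; have Lh := AL _ Ah.
have := N2D_le (L2B Lf Lg) (L2B Lg Lh).
rewrite (_ : (fun x => _) = (fun x => f x - h x)).
  by move: fg gh; lra.
by apply/funext => x; rewrite addrA subrK.
Qed.

End ComplexL2.

(** * Density of dyadic step functions *)

Section StepDensity.
Context {R : realType}.
Local Notation mu := (@lebesgue_measure R).
Local Open Scope complex_scope.
Local Notation Re := complex.Re.
Local Notation Im := complex.Im.
Implicit Types (f g h : R -> R[i]) (z w c : R[i]).

Lemma clD (A : set (R -> R[i])) f g : A `<=` L2 ->
  (forall u v, A u -> A v -> A (fun x => u x + v x)) ->
  L2closure A f -> L2closure A g -> L2closure A (fun x => f x + g x).
Proof.
move=> AL AD /(clP _ AL)[Lf Hf] /(clP _ AL)[Lg Hg]; apply/(clP _ AL); split.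
  exact: L2D.
move=> e e0; have [|u Au fu] := Hf (e / 4); first by rewrite divr_gt0.
have [|v Av gv] := Hg (e / 4); first by rewrite divr_gt0.
exists (fun x => u x + v x); first exact: AD.
have := N2D_le (L2B Lf (AL _ Au)) (L2B Lg (AL _ Av)).
rewrite (_ : (fun x => _) = (fun x => f x + g x - (u x + v x))); last first.
  by apply/funext => x; ring.
by move: fu gv; lra.
Qed.

Lemma clZ (A : set (R -> R[i])) f c : A `<=` L2 ->
  (forall u c, A u -> A (fun x => c * u x)) ->
  L2closure A f -> L2closure A (fun x => c * f x).
Proof.
move=> AL AZ /(clP _ AL)[Lf Hf]; apply/(clP _ AL); split; first exact: L2Z.
move=> e e0; have [|u Au fu] := Hf (e / (sqc c + 1)).
  by rewrite divr_gt0 // ltr_wpDl ?sqc_ge0.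
exists (fun x => c * u x); first exact: AZ.
rewrite (_ : (fun x => _) = (fun x => c * (f x - u x))); last first.
  by apply/funext => x; ring.
rewrite N2Z; last exact: L2B (AL _ Au).
move: fu; rewrite ltr_pdivlMr ?ltr_wpDl ?sqc_ge0 //.
have := N2_ge0 (fun x => f x - u x); have := sqc_ge0 c; nra.
Qed.

(** A closure contains the a.e. limits of its elements under an integrable
    bound for the squared distances; approximation then only has to be checked
    pointwise. *)
Lemma cl_dct (A : set (R -> R[i])) f (F : nat -> R -> R[i]) (g : R -> R) :
  A `<=` L2 -> (forall n, L2closure A (F n)) -> cmeas f -> itg g ->
  (forall n x, sqc (F n x - f x) <= g x) ->
  (\forall x \ae mu, sqc (F n x - f x) @[n --> \oo] --> 0) -> L2closure A f.
Proof.
move=> AL AF mf gi Fg Ff.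
have LF n : L2 (F n) by case: (AF n).
have mF n : cmeas (F n) by exact: L2_meas.
have mB n : cmeas (fun x => F n x - f x).
  apply: cmeasD => //; under eq_fun do rewrite -mulN1r; exact: cmeasZ.
have iB n : itg (fun x => sqc (F n x - f x)).
  apply: (itg_le _ gi); first exact: cmeas_sqc.
  by move=> x; rewrite ger0_norm ?sqc_ge0.
have Lf : L2 f.
  have : L2 (fun x => F 0%N x - (F 0%N x - f x)).
    by apply: L2B => //; apply/L2P.
  by under eq_fun do rewrite subKr.
apply: cl_idem => //; apply/clP; first by move=> u [].
split => // e e0.
have [_] : itg (fun=> 0 : R) /\ rint (fun x => sqc (F n x - f x)) @[n --> \oo] --> rint (fun=> 0 : R).
  apply: (@rdct R (fun n x => sqc (F n x - f x)) (fun=> 0) g _ _ gi _ Ff).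
  - by move=> n; exact: cmeas_sqc.
  - exact: measurable_cst.
  - by move=> n x; rewrite ger0_norm ?sqc_ge0.
rewrite rint0 => /cvgrPdist_lt /(_ e e0) [n _ /(_ n (leqnn n))].
rewrite sub0r normrN ger0_norm; last exact: N2_ge0.
move=> h; exists (F n) => //; move: h; rewrite /N2.
rewrite (_ : (fun x => sqc (F n x - f x)) = (fun x => sqc (f x - F n x))) //.
by apply/funext => x; rewrite -sqcN opprB.
Qed.

(** The indicator of [k 2^-J, (k+1) 2^-J), written as a dilated translate of
    the quark of degree 0 because this is what the refinement argument
    approximates. *)
Definition dyad (J : nat) (k : int) : R -> R[i] :=
  fun x => quark 0 (2 ^+ J * x - k%:~R).

Definition dyads : set (R -> R[i]) := [set f | exists J k, f = dyad J k].

Lemma dyadE J k x : dyad J k x = (if k%:~R <= 2 ^+ J * x < k%:~R + 1 then 1 else 0).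
Proof.
rewrite /dyad /quark expr0 mul1r indicE mem_setE in_itv /= subr_ge0 ltrBlDr addrC.
by case: ifP.
Qed.

Lemma dyad_ind J k : dyad J k =
  fun x => (\1_(`[k%:~R / 2 ^+ J, (k%:~R + 1) / 2 ^+ J[) x)%:C.
Proof.
apply/funext => x; rewrite dyadE indicE mem_setE in_itv /=.
rewrite ler_pdivrMr ?exprn_gt0 // ltr_pdivlMr ?exprn_gt0 // (mulrC x).
by case: ifP.
Qed.

Lemma L2_ind (a b : R) : L2 (fun x => (\1_(`[a, b[) x : R)%:C).
Proof.
apply/L2P; split.
  split => /=; first exact: measurable_indic.
  exact: measurable_cst.
rewrite (_ : (fun x => _) = \1_(`[a, b[) ).
  exact: integrable_indic_itv.
apply/funext => x; rewrite sqcC indicE; case: (_ \in _) => /=.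
  by rewrite expr1n.
by rewrite expr0n.
Qed.

Lemma dyads_L2 : dyads `<=` L2.
Proof. by move=> f [J [k ->]]; rewrite dyad_ind; exact: L2_ind. Qed.

(** On each cell of the dyadic grid in [-N, N), the value of [h] at the left
    end of the cell ([sampleE]). *)
Definition sample (N J : nat) (h : R -> R[i]) : R -> R[i] := fun x =>
  \sum_(k < 2 * N * 2 ^ J) h (- N%:R + k%:R / 2 ^+ J)
     * dyad J (k%:Z - (N * 2 ^ J)%:Z) x.

Lemma sample_span N J h : lin_span dyads (sample N J h).
Proof.
by apply: span_sum => k; apply: spanZ; apply: (@sub_span R dyads); exists J, (k%:Z - (N * 2 ^ J)%:Z).
Qed.

Lemma sampleE N J h x : sample N J h x =
  if - N%:R <= x < N%:R then
    h (- N%:R + (Num.truncn ((x + N%:R) * 2 ^+ J))%:R / 2 ^+ J) else 0.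
Proof.
have e2 : 0 < 2 ^+ J :> R by rewrite exprn_gt0.
have D (k : nat) : dyad J (k%:Z - (N * 2 ^ J)%:Z) x =
   if k%:R <= (x + N%:R) * 2 ^+ J < k%:R + 1 then 1 else 0.
  rewrite dyadE intrB /= -!pmulrn natrM natrX lerBlDr addrAC ltrBrDr.
  by rewrite (_ : 2 ^+ J * x + _ = (x + N%:R) * 2 ^+ J) //; ring.
rewrite /sample; under eq_bigr do rewrite D.
set y := (x + N%:R) * 2 ^+ J; case: ifP => [/andP[x1 x2]|xN].
- have xN : 0 <= x + N%:R by lra.
  have y0 : 0 <= y by rewrite mulr_ge0 // ltW.
  have /andP[t1 t2] := truncn_itv y0.
  have tl : (Num.truncn y < 2 * N * 2 ^ J)%N.
    rewrite -(ltr_nat R); apply: le_lt_trans t1 _.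
    rewrite natrM natrX /y ltr_pM2r // natrM; lra.
  rewrite (bigD1 (Ordinal tl)) //= t1 natr1 t2 /= mulr1.
  rewrite big1 ?addr0 // => i /eqP ni; case: ifP => [/andP[i1 i2]|]; rewrite ?mulr0 //.
  exfalso; apply: ni; apply: val_inj => /=; apply/esym/truncn_def.
  by rewrite i1 -natr1.
- rewrite big1 // => i _; case: ifP => [/andP[i1 i2]|]; rewrite ?mulr0 //.
  move/negP: xN; case; apply/andP; split.
    have : 0 <= y by apply: le_trans i1.
    by rewrite /y pmulr_lge0 //; lra.
  have : y < (2 * N * 2 ^ J)%:R.
    by apply: lt_le_trans i2 _; rewrite natr1 ler_nat.
  by rewrite natrM natrX /y ltr_pM2r // natrM; lra.
Qed.

Definition cut (A : set R) f : R -> R[i] := fun x => (\1_A x : R)%:C * f x.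

Lemma cmeas_ind (A : set R) : measurable A -> cmeas (fun x => (\1_A x : R)%:C).
Proof.
move=> mA; split; first exact: measurable_indic.
exact: measurable_cst.
Qed.

Lemma indic01 (A : set R) x : (\1_A x : R) = 0 \/ (\1_A x : R) = 1.
Proof. by rewrite indicE; case: (_ \in _); [right|left]. Qed.

Lemma L2_cut (A : set R) f : measurable A -> L2 f -> L2 (cut A f).
Proof.
move=> mA; apply: (@L2_bddM R 1); first exact: cmeas_ind.
by move=> x; rewrite sqcC; case: (indic01 A x) => ->; rewrite ?expr0n ?expr1n.
Qed.

Local Notation I_ N := (`[- (N%:R : R), N%:R[%classic : set R).

Lemma itg_cst_ind (c : R) (a b : R) : itg (fun x => c * \1_(`[a, b[) x).
Proof. by apply: itgZ; exact: integrable_indic_itv. Qed.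

(** The samplings of a bounded continuous function on finer and finer grids are
    bounded and converge pointwise. *)
Lemma cl_cont (h : R -> R) (M : R) (N : nat) : continuous h ->
  (forall x, `|h x| <= M) ->
  closed_span dyads (fun x => (\1_(I_ N) x * h x)%:C).
Proof.
move=> ch hM.
have mh : rmeas h by exact: continuous_measurable_fun.
have M0 : 0 <= M by apply: le_trans (hM 0).
apply: (@cl_dct _ _ (fun J => sample N J (fun x => (h x)%:C))
  (fun x => (2 * M) ^+ 2 * \1_(I_ N) x)).
- exact: span_L2 dyads_L2.
- move=> J; apply: (@sub_cl R); first exact: span_L2 dyads_L2.
  exact: sample_span.
- split; last exact: measurable_cst.
  by apply: measurable_funM => //; exact: measurable_indic.
- exact: itg_cst_ind.
- move=> J x; rewrite sampleE indicE mem_setE in_itv /=.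
  case: ifP => _; last by rewrite !mul0r mulr0 subr0 sqc0.
  rewrite mul1r mulr1 -rmorphB sqcC.
  set u := h _; set v := h _.
  have hu : `|u| <= M by exact: hM.
  have hv : `|v| <= M by exact: hM.
  rewrite ler_norml in hu; rewrite ler_norml in hv.
  case/andP: hu => *; case/andP: hv => *.
  rewrite -subr_ge0 subr_sqr mulr_ge0 //; lra.
- apply: aeT => x; under eq_fun do rewrite sampleE indicE mem_setE in_itv /=.
  case: (boolP (- N%:R <= x < N%:R)) => [/andP[x1 x2]|_]; last first.
    by under eq_fun do rewrite mul0r subr0 sqc0; exact: cvg_cst.
  under eq_fun do rewrite mul1r -rmorphB sqcC.
  pose p (J : nat) : R := - N%:R + (Num.truncn ((x + N%:R) * 2 ^+ J))%:R / 2 ^+ J.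
  have px : p J @[J --> \oo] --> x.
    apply/cvgrPdist_le => e e0.
    have : (geometric 1 2^-1) n @[n --> \oo] --> (0 : R).
      by apply: cvg_geometric; rewrite ger0_norm ?invr_ge0 // invf_lt1 // ltr1n.
    move=> /cvgrPdist_le /(_ e e0); apply: filterS => J.
    rewrite /= sub0r normrN mul1r exprVn ger0_norm ?invr_ge0 ?exprn_ge0 // => Je.
    apply: le_trans Je.
    have e2 : 0 < 2 ^+ J :> R by rewrite exprn_gt0.
    have xN : 0 <= x + N%:R by lra.
    have y0 : 0 <= (x + N%:R) * 2 ^+ J by rewrite mulr_ge0 // ltW.
    have /andP[t1 t2] := truncn_itv y0; rewrite -[X in _ < X]natr1 in t2.
    rewrite /p; set k := _%:R in t1 t2 *.
    have -> : x - (- N%:R + k / 2 ^+ J) = ((x + N%:R) * 2 ^+ J - k) / 2 ^+ J.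
      by field; rewrite gt_eqF.
    rewrite ger0_norm ?divr_ge0 ?subr_ge0 ?(ltW e2) //.
    rewrite -[X in _ <= X]mul1r ler_wpM2r ?invr_ge0 ?(ltW e2) //; lra.
  have hpx : h (p J) @[J --> \oo] --> h x by apply: (cvg_comp _ _ px); exact: ch.
  have : (h (p J) - h x) * (h (p J) - h x) @[J --> \oo] --> (0 : R).
    have h0 : h (p J) - h x @[J --> \oo] --> (0 : R).
      by rewrite -(subrr (h x)); apply: cvgB => //; exact: cvg_cst.
    by rewrite -(mulr0 (0 : R)); apply: cvgM.
  by under eq_fun do rewrite -expr2.
Qed.

Lemma restrict_indE (D : set R) (u : R -> R) :
  (EFin \o u) \_ D = EFin \o (fun x => \1_D x * u x).
Proof.
apply/funext => x /=; rewrite patchE indicE; case: ifP => _.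
  by rewrite mul1r.
by rewrite mul0r.
Qed.

Lemma itg_restrict (D : set R) (u : R -> R) : measurable D ->
  mu.-integrable D (EFin \o u) <-> itg (fun x => \1_D x * u x).
Proof.
by move=> mD; have := @integrable_mkcond _ _ _ mu D (EFin \o u) mD; rewrite restrict_indE.
Qed.

Lemma int_restrict (D : set R) (u : R -> R) :
  (\int[mu]_(x in D) (u x)%:E = \int[mu]_x (\1_D x * u x)%:E)%E.
Proof. by rewrite integral_mkcond restrict_indE. Qed.

(** Continuous functions approximate [u] in L1. Once they are truncated at the
    bound [M], the squared error is at most 2 M times the error, so they
    approximate in L2 as well. *)
Lemma cl_bdd (u : R -> R) (M : R) (N : nat) : rmeas u ->
  (forall x, `|u x| <= M) -> (forall x, x \notin `[- N%:R, N%:R[ -> u x = 0) ->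
  closed_span dyads (fun x => (u x)%:C).
Proof.
move=> mu_ uM u0; have M0 : 0 <= M by apply: le_trans (uM 0).
have SL := span_L2 dyads_L2.
apply: cl_idem => //; apply/clP; first by move=> g [].
split.
  apply/L2P; split; first by split => //; exact: measurable_cst.
  have ii : itg (fun x => M ^+ 2 * \1_(I_ N) x) by exact: itg_cst_ind.
  apply: (itg_le _ ii); first by under eq_fun do rewrite sqcC; exact: measurable_funX.
  move=> x; rewrite sqcC ger0_norm ?sqr_ge0 // indicE mem_setE.
  case: (boolP (x \in _)) => [_|/u0 ->]; last by rewrite expr0n mulr0.
  by rewrite mulr1 -(real_normK (num_real (u x))) ler_pXn2r ?nnegrE.
move=> e e0.
have iu : mu.-integrable (I_ N) (EFin \o u).
  apply: (@integrableS _ _ _ _ setT) => //.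
  have ii : itg (fun x => M * \1_(I_ N) x) by exact: itg_cst_ind.
  apply: (itg_le _ ii) => // x; rewrite indicE mem_setE.
  by case: (boolP (x \in _)) => [_|/u0 ->]; rewrite ?mulr1 ?normr0 ?mulr0.
have [||g [gc gi gu]] := @approximation_continuous_integrable R (I_ N) u _ _ iu.
- by [].
- have := @lebesgue_measure_itv R `[- (N%:R : R), N%:R[; rewrite /= => ->.
  by case: ifP => _; rewrite ?ltry.
pose d := e / (2 * M + 1).
have d0 : 0 < d by rewrite divr_gt0 // ltr_wpDl // mulr_ge0.
have [n nd] : exists n, (\int[mu]_(z in I_ N) `|(u z - g n z)%:E| < d%:E)%E.
  move/fine_cvgP : gu => [[n1 _ Hf] /cvgrPdist_lt /(_ d d0)[n2 _ Hd]].
  exists (maxn n1 n2).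
  rewrite -(fineK (Hf _ (leq_maxl _ _))) lte_fin.
  have := Hd _ (leq_maxr n1 n2); rewrite /= sub0r normrN => h.
  exact: le_lt_trans (ler_norm _) h.
pose h x := Num.max (- M) (Num.min M (g n x)).
have hc : continuous h.
  move=> x; apply: (@continuous_max R R (cst (- M)) (cst M \min g n) x).
    exact: cvg_cst.
  by apply: (@continuous_min R R (cst M) (g n) x); [exact: cvg_cst|exact: gc].
have hM x : `|h x| <= M.
  rewrite /h ler_norml; apply/andP; split; first by rewrite le_max lexx.
  by rewrite ge_max ge_min lexx /= andbT; lra.
exists (fun x => (\1_(I_ N) x * h x)%:C); first exact: (@cl_cont h M).
have mg : rmeas (g n) by exact: continuous_measurable_fun.
have mh : rmeas h by exact: continuous_measurable_fun.
have ig : itg (fun x => \1_(I_ N) x * `|u x - g n x|).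
  have i1 := (itg_restrict u (measurable_itv _)).1 iu.
  have i2 := (itg_restrict (g n) (measurable_itv _)).1 (gi n).
  have := itg_norm (itgB i1 i2); congr itg; apply/funext => x.
  by rewrite -mulrBr normrM ger0_norm // indicE.
have hu x : \1_(I_ N) x * u x = u x.
  rewrite indicE mem_setE; case: (boolP (x \in _)) => [_|/u0 ->].
    by rewrite mul1r.
  by rewrite mulr0.
have hg x : `|u x - h x| <= `|u x - g n x|.
  have := uM x; rewrite /h ler_norml => /andP[*].
  rewrite /Num.max /Num.min; case: (ltP M (g n x)) => ?; case: ltP => ?;
    have n1 := ler_norm (u x - g n x);
    (have n2 : - (u x - g n x) <= `|u x - g n x| by rewrite -normrN ler_norm);
    rewrite ler_norml; apply/andP; split; lra.
have ih : itg (fun x => sqc ((u x)%:C - (\1_(I_ N) x * h x)%:C)).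
  apply: (itg_le _ (itgZ (2 * M) ig)).
    apply: cmeas_sqc; split; last exact: measurable_cst.
    by apply: measurable_funB => //; apply: measurable_funM.
  move=> x; rewrite -rmorphB sqcC ger0_norm ?sqr_ge0 // -{1}hu -mulrBr exprMn.
  case: (indic01 (I_ N) x) => ->; first by rewrite expr0n !mul0r mulr0.
  rewrite expr1n !mul1r -[X in X <= _](real_normK (num_real _)) expr2 ler_pM //.
  by apply: le_trans (ler_normB _ _) _; rewrite mulr2n mulrDl !mul1r lerD.
have E x : sqc ((u x)%:C - (\1_(I_ N) x * h x)%:C) <=
    2 * M * (\1_(I_ N) x * `|u x - g n x|).
  rewrite -rmorphB sqcC -{1}hu -mulrBr exprMn.
  case: (indic01 (I_ N) x) => ->; first by rewrite expr0n !mul0r mulr0.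
  rewrite expr1n !mul1r -[X in X <= _](real_normK (num_real _)) expr2 ler_pM //.
  by apply: le_trans (ler_normB _ _) _; rewrite mulrDl !mul1r lerD.
apply: le_lt_trans (rint_le ih (itgZ (2 * M) ig) E) _.
rewrite rintZ //; move: nd; rewrite int_restrict itg_int // lte_fin /d.
rewrite ltr_pdivlMr ?ltr_wpDl ?mulr_ge0 // => ?.
have : 0 <= rint (fun x => \1_(I_ N) x * `|u x - g n x|).
  by apply: rint_ge0 => x; rewrite mulr_ge0 // indicE.
nra.
Qed.

Lemma spanI (A : set (R -> R[i])) f : lin_span A f -> A `<=` L2 -> L2closure (lin_span A) f.
Proof. by move=> Af AL; apply: (@sub_cl R) => //; exact: span_L2. Qed.

Lemma clspanD (A : set (R -> R[i])) f g : A `<=` L2 ->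
  closed_span A f -> closed_span A g -> closed_span A (fun x => f x + g x).
Proof. by move=> AL; apply: clD; [exact: span_L2|move=> u v; exact: spanD]. Qed.

Lemma clspanZ (A : set (R -> R[i])) f c : A `<=` L2 ->
  closed_span A f -> closed_span A (fun x => c * f x).
Proof. by move=> AL; apply: clZ; [exact: span_L2|move=> u d; exact: spanZ]. Qed.

Lemma meas_le (u : R -> R) (c : R) : rmeas u -> measurable [set x | u x <= c].
Proof.
move=> mu_; rewrite -[X in measurable X]setTI (_ : [set x | _] = u @^-1` `]-oo, c]).
  by apply: mu_ => //; exact: measurable_itv.
by apply/seteqP; split => x /=; rewrite in_itv.
Qed.

Lemma cut_cvg (f : R -> R[i]) x : sqc (cut (`[- n%:R, n%:R[ `&` [set x | sqc (f x) <= n%:R]) f x - f x)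
  @[n --> \oo] --> (0 : R).
Proof.
apply/cvgrPdist_lt => e e0.
exists (Num.truncn (`|x| + sqc (f x))).+1 => //= n /= hn.
have := truncnS_gt (`|x| + sqc (f x)) => h0.
have h1 : `|x| + sqc (f x) < n%:R by apply: (lt_le_trans h0); rewrite ler_nat.
have hs := sqc_ge0 (f x); have hx := normr_ge0 x.
rewrite /cut indicE mem_set /=; last first.
  split; last by rewrite /=; lra.
  rewrite /= in_itv /=; have : `|x| < n%:R by lra.
  by rewrite ltr_norml => /andP[a b]; rewrite ltW.
by rewrite mul1r subrr sqc0 subrr normr0.
Qed.

(** Cutting a function off in space and in modulus reduces to bounded functions
    of compact support. *)
Theorem step_dense f : L2 f -> closed_span dyads f.
Proof.
move=> Lf; have [mf fi] := (L2P f).1 Lf.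
pose A (n : nat) : set R := `[- n%:R, n%:R[ `&` [set x | sqc (f x) <= n%:R].
have mA n : measurable (A n).
  by apply: measurableI; [exact: measurable_itv|apply: meas_le; exact: cmeas_sqc].
apply: (@cl_dct _ _ (fun n => cut (A n) f) (fun x => sqc (f x))) => //.
- exact: span_L2 dyads_L2.
- move=> n.
  have K (u : R -> R) : rmeas u -> (forall x, u x ^+ 2 <= sqc (f x)) ->
      closed_span dyads (fun x => (\1_(A n) x * u x)%:C).
    move=> mu_ us; apply: (@cl_bdd _ (Num.sqrt n%:R) n).
    - by apply: measurable_funM => //; exact: measurable_indic.
    - move=> x; rewrite indicE; case: (boolP (x \in A n)) => [|_]; last first.
        by rewrite mul0r normr0 sqrtr_ge0.
      rewrite inE => -[_ /= h]; rewrite mul1r -sqrtr_sqr ler_sqrt //.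
      exact: le_trans h.
    - move=> x xn; rewrite indicE memNset ?mul0r // => -[h _].
      by move/negP: xn.
  have [j [j1 j2]] : exists j : R[i], Re j = 0 /\ Im j = 1 by exists (0 +i* 1).
  rewrite (_ : cut _ _ = fun x => (\1_(A n) x * Re (f x))%:C + j * (\1_(A n) x * Im (f x))%:C).
    apply: clspanD; first exact: dyads_L2.
      by apply: K; [case: mf|move=> x; rewrite /sqc lerDl sqr_ge0].
    apply: clspanZ; first exact: dyads_L2.
    by apply: K; [case: mf|move=> x; rewrite /sqc lerDr sqr_ge0].
  apply/funext => x; apply: eqcP; rewrite /cut !cE j1 j2; ring.
- move=> n x; rewrite /cut; case: (indic01 (A n) x) => ->.
    by rewrite mul0r sub0r sqcN.
  by rewrite mul1r subrr sqc0 sqc_ge0.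
- by apply: aeT => x; exact: cut_cvg.
Qed.

End StepDensity.

(** * Fourier integrals of intervals *)

Section Plancherel.
Context {R : realType}.
Local Notation mu := (@lebesgue_measure R).
Local Open Scope complex_scope.
Local Notation Re := complex.Re.
Local Notation Im := complex.Im.
Implicit Types (f g h : R -> R[i]) (z w c : R[i]).

Definition ew (t : R) : R[i] := cos t -i* sin t.

Lemma sqc_ew t : sqc (ew t) = 1.
Proof. by rewrite /sqc /ew !cE sqrrN cos2Dsin2. Qed.

Lemma ewD s t : ew (s + t) = ew s * ew t.
Proof. by apply: eqcP; rewrite /ew !cE ?cosD ?sinD; ring. Qed.

Lemma ewN t : ew (- t) = (ew t)^*.
Proof. by apply: eqcP; rewrite /ew !cE ?cosN ?sinN; ring. Qed.

Lemma cont_compM (k : R -> R) (y : R) : continuous k -> continuous (fun x : R => k (x * y)).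
Proof.
move=> ck x; have h : z * y @[z --> x] --> x * y by exact: mulrr_continuous.
by apply: (cvg_comp _ _ h); exact: ck.
Qed.

Lemma cont_compMl (k : R -> R) (y : R) : continuous k -> continuous (fun x : R => k (y * x)).
Proof.
move=> ck x; have h : y * z @[z --> x] --> y * x by exact: mulrl_continuous.
by apply: (cvg_comp _ _ h); exact: ck.
Qed.

Lemma cont_cosM (y : R) : continuous (fun x : R => cos (x * y)).
Proof. by apply: cont_compM; exact: continuous_cos. Qed.

Lemma cont_sinM (y : R) : continuous (fun x : R => sin (x * y)).
Proof. by apply: cont_compM; exact: continuous_sin. Qed.

Lemma cmeas_ew (y : R) : cmeas (fun x => ew (x * y)).
Proof.
split => /=; first by apply: continuous_measurable_fun; exact: cont_cosM.
by apply: measurable_funN; apply: continuous_measurable_fun; exact: cont_sinM.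
Qed.

Lemma citg_bddM f g : citg f -> cmeas g -> (forall x, sqc (g x) <= 1) ->
  citg (fun x => f x * g x).
Proof.
move=> cf mg g1; have mf := citg_meas cf; have [fr fi] := cf.
have [m1 m2] := cmeasM mf mg.
have ii := itgD (itg_norm fr) (itg_norm fi).
have K x : `|Re (g x)| <= 1 /\ `|Im (g x)| <= 1.
  have := g1 x; rewrite /sqc => h; split; rewrite -(@ler_pXn2r _ 2) ?nnegrE //;
    rewrite real_normK ?num_real // expr1n; apply: le_trans h.
    by rewrite lerDl sqr_ge0.
  by rewrite lerDr sqr_ge0.
split; apply: (itg_le _ ii) => // x; rewrite !cE; have [k1 k2] := K x.
  apply: le_trans (ler_normB _ _) _; rewrite !normrM lerD //; exact: ler_piMr.
apply: le_trans (ler_normD _ _) _; rewrite !normrM lerD //; exact: ler_piMr.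
Qed.

(** The Fourier integral without the factor 1 / sqrt (2 pi). *)
Definition ft f : R -> R[i] := fun xi => cint (fun x => f x * ew (x * xi)).

Lemma citg_ft f xi : citg f -> citg (fun x => f x * ew (x * xi)).
Proof.
by move=> cf; apply: citg_bddM => //; [exact: cmeas_ew|move=> x; rewrite sqc_ew].
Qed.

Lemma ftD f g : citg f -> citg g -> ft (fun x => f x + g x) = fun xi => ft f xi + ft g xi.
Proof.
move=> cf cg; apply/funext => xi; rewrite /ft -cintD; try exact: citg_ft.
by congr cint; apply/funext => x; rewrite mulrDl.
Qed.

Lemma ftZ c f : citg f -> ft (fun x => c * f x) = fun xi => c * ft f xi.
Proof.
move=> cf; apply/funext => xi; rewrite /ft -cintZ; last exact: citg_ft.
by congr cint; apply/funext => x; rewrite mulrA.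
Qed.

Lemma ftB f g : citg f -> citg g -> ft (fun x => f x - g x) = fun xi => ft f xi - ft g xi.
Proof.
move=> cf cg; have := ftD cf (citgZ (-1) cg); rewrite ftZ //.
rewrite (_ : (fun x => f x + -1 * g x) = fun x => f x - g x); last first.
  by apply/funext => x; rewrite mulN1r.
by move=> ->; apply/funext => x; rewrite mulN1r.
Qed.

Lemma ft_sum (I : Type) (s : seq I) (F : I -> R -> R[i]) : (forall i, citg (F i)) ->
  ft (fun x => \sum_(i <- s) F i x) = fun xi => \sum_(i <- s) ft (F i) xi.
Proof.
move=> cF; apply/funext => xi; rewrite /ft -cint_sum; last by move=> i; exact: citg_ft.
by congr cint; apply/funext => x; rewrite mulr_suml.
Qed.

Lemma cont_rint (u : R -> R) (k : R -> R) : itg u -> continuous k ->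
  (forall x, `|k x| <= 1) -> continuous (fun xi : R => rint (fun x => u x * k (x * xi))).
Proof.
move=> iu ck k1 xi.
have mk y : rmeas (fun x => k (x * y)).
  by apply: continuous_measurable_fun; exact: cont_compM.
have H : {in `](xi - 1), (xi + 1)[%classic, continuous (fun y => \int[mu]_(x in setT) (u x * k (x * y)))}.
  apply: (@continuity_under_integral _ _ _ mu (fun y x => u x * k (x * y)) setT
   measurableT (xi - 1) (xi + 1) _ _ (fun x => `|u x|)).
  - move=> y _; apply: (itg_le _ (itg_norm iu)).
      by apply: measurable_funM; [exact: itg_meas|exact: mk].
    by move=> x; rewrite normrM; exact: ler_piMr.
  - apply: aeT => x _ y _.
    have cx : continuous (fun y => u x * k (x * y)).
      by move=> z; apply: cvgM; [exact: cvg_cst|exact: (cont_compMl (y := x) ck)].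
    exact: cx.
  - exact: itg_norm.
  - move=> y _; apply: aeT => x _; rewrite normrM; exact: ler_piMr.
by apply: H; rewrite inE /= in_itv /=; apply/andP; split; lra.
Qed.

Lemma ftE f xi : citg f -> ft f xi =
  (rint (fun x => Re (f x) * cos (x * xi)) + rint (fun x => Im (f x) * sin (x * xi))) +i*
  (rint (fun x => Im (f x) * cos (x * xi)) - rint (fun x => Re (f x) * sin (x * xi))).
Proof.
move=> [fr fi].
have kc : citg (fun x => (Re (f x))%:C) by split => //=; exact: itg0.
have ki : citg (fun x => (Im (f x))%:C) by split => //=; exact: itg0.
have [a b] := citg_ft xi kc; have [c d] := citg_ft xi ki.
apply: eqcP; rewrite /ft /=.
  rewrite -rintD; [|move: a|move: d].
  - by congr rint; apply/funext => x; rewrite !cE /=; ring.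
  - by congr itg; apply/funext => x; rewrite !cE /=; ring.
  - by move=> /itgN; congr itg; apply/funext => x; rewrite !cE /=; ring.
rewrite -rintB; [|move: c|move: b].
- by congr rint; apply/funext => x; rewrite !cE /=; ring.
- by congr itg; apply/funext => x; rewrite !cE /=; ring.
- by move=> /itgN; congr itg; apply/funext => x; rewrite !cE /=; ring.
Qed.

Lemma cmeas_ft f : citg f -> cmeas (ft f).
Proof.
move=> cf; have [fr fi] := cf; have sm x : `|sin x| <= 1 :> R.
  by rewrite ler_norml sin_geN1 sin_le1.
split; under eq_fun do rewrite ftE //=.
- apply: measurable_funD; apply: continuous_measurable_fun; apply: cont_rint => //;
    by [exact: continuous_cos|exact: continuous_sin|exact: cos_max].
- apply: measurable_funB; apply: continuous_measurable_fun; apply: cont_rint => //;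
    by [exact: continuous_cos|exact: continuous_sin|exact: cos_max].
Qed.

Definition ind (a b : R) : R -> R[i] := fun x => (\1_(`[a, b[) x : R)%:C.

Lemma citg_ind a b : citg (ind a b).
Proof. by split; [exact: integrable_indic_itv|exact: itg0]. Qed.

Lemma rint_ind_FTC a b (k K : R -> R) : a <= b -> continuous k ->
  (forall x : R, is_derive x 1 K (k x)) ->
  rint (fun x => \1_(`[a, b[) x * k x) = K b - K a.
Proof.
rewrite le_eqVlt => /predU1P[->|ab] ck dK.
  rewrite subrr -[RHS]rint0; congr rint; apply/funext => x.
  rewrite indicE mem_setE in_itv /=.
  rewrite (_ : (_ <= x < _) = false) ?mul0r //; apply/negbTE/negP => /andP[h1 h2].
  by have := le_lt_trans h1 h2; rewrite ltxx.
rewrite /rint /Rintegral -int_restrict.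
have mk : rmeas k by exact: continuous_measurable_fun.
rewrite (@integral_itv_bndo_bndc R (BLeft a) b (fun x => (k x)%:E)).
  rewrite (@continuous_FTC2 _ _ K) //.
  - exact: continuous_subspaceT.
  - split.
    + by move=> x _; case: (dK x).
    + apply: cvg_at_right_filter.
      by apply/differentiable_continuous/derivable1_diffP; case: (dK a).
    + apply: cvg_at_left_filter.
      by apply/differentiable_continuous/derivable1_diffP; case: (dK b).
  - by move=> x _; rewrite derive1E; case: (dK x).
apply/measurable_EFinP; exact: measurable_funTS.
Qed.

Lemma is_derive_scaled (k k' : R -> R) (xi x : R) :
  (forall x : R, is_derive x 1 k (k' x)) ->
  is_derive x 1 (fun x : R => k (x * xi)) (xi * k' (x * xi)).
Proof.
move=> dk; have h : is_derive x 1 (fun x : R => x * xi) xi.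
  have := @is_deriveM R R id (cst xi) x 1 1 0 (is_derive_id _ _) (is_derive_cst _ _ _).
  by rewrite scaler0 add0r /GRing.scale /= mulr1.
by have := @is_derive1_comp R k (fun x => x * xi) x _ _ (dk _) h; rewrite mulrC.
Qed.

(** The factor [xi] clears the denominator of the transform of an interval, so
    that no case is made at 0. *)
Lemma ft_ind a b xi : a <= b -> xi%:C * ft (ind a b) xi =
   (sin (b * xi) - sin (a * xi)) +i* (cos (b * xi) - cos (a * xi)).
Proof.
move=> ab; have i1 : itg (fun x => \1_(`[a, b[) x * cos (x * xi)).
  have [] := citg_ft xi (citg_ind a b); move=> i1 _; move: i1; congr itg.
  by apply/funext => x; rewrite !cE mul0r subr0.
have i2 : itg (fun x => \1_(`[a, b[) x * sin (x * xi)).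
  have [] := citg_ft xi (citg_ind a b); move=> _ /itgN; congr itg.
  by apply/funext => x; rewrite !cE mul0r addr0 mulrN opprK.
rewrite ftE; last exact: citg_ind.
rewrite [X in _ + X](_ : _ = 0); last first.
  by rewrite -[RHS]rint0; congr rint; apply/funext => x; rewrite mul0r.
rewrite [X in X - _](_ : _ = 0); last first.
  by rewrite -[RHS]rint0; congr rint; apply/funext => x; rewrite mul0r.
rewrite addr0 sub0r; apply: eqcP; rewrite !cE mul0r ?subr0 ?addr0 ?mulrN -rintZ //.
- have D1 (x : R) : is_derive x 1 (fun x => sin (x * xi)) (xi * cos (x * xi)).
    by apply: (@is_derive_scaled sin cos) => y; exact: is_derive_sin.
  rewrite -(rint_ind_FTC ab _ D1).
    by congr rint; apply/funext => x; rewrite /ind !cE; ring.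
  by move=> x; apply: cvgM; [exact: cvg_cst|exact: cont_cosM].
- have D1 (x : R) : is_derive x 1 (fun x => cos (x * xi)) (- (xi * sin (x * xi))).
    by rewrite -mulrN; apply: (@is_derive_scaled cos (fun x => - sin x)) => y; exact: is_derive_cos.
  have C1 : continuous (fun x : R => - (xi * sin (x * xi))).
    by move=> x; apply: cvgN; apply: cvgM; [exact: cvg_cst|exact: cont_sinM].
  rewrite -(rint_ind_FTC ab C1 D1) -rintN; last exact: (itgZ xi i2).
  by congr rint; apply/funext => x; rewrite /ind !cE; ring.
Qed.

Lemma sqc_ft_ind a b xi : a <= b ->
  xi ^+ 2 * sqc (ft (ind a b) xi) = 2 * (1 - cos ((b - a) * xi)).
Proof.
move=> ab; rewrite -sqcC -sqcM ft_ind // /sqc !cE mulrBl cosB.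
have := cos2Dsin2 (a * xi); have := cos2Dsin2 (b * xi); nra.
Qed.

Lemma itg_inv1sqr : itg (fun x : R => (1 + x ^+ 2)^-1).
Proof.
apply/itgP; split.
  by apply: continuous_measurable_fun => x; exact: continuous_oneDsqrV.
under eq_integral do rewrite gee0_abs ?lee_fin ?invr_ge0 ?addr_ge0 ?sqr_ge0 //.
rewrite (@ge0_symfun_integralT R (fun x => (1 + x ^+ 2)^-1)).
- rewrite (_ : [set x | 0 <= x] = `[0, +oo[%classic).
    by rewrite integral0y_oneDsqr ltry.
  by apply/seteqP; split => x /=; rewrite in_itv /= andbT.
- by move=> x; rewrite invr_ge0 addr_ge0 ?sqr_ge0.
- by move=> x; exact: continuous_oneDsqrV.
- by move=> x /=; rewrite sqrrN.
Qed.

Lemma rint_ind a b : a <= b -> rint (\1_(`[a, b[) : R -> R) = b - a.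
Proof.
move=> ab; rewrite -(@rint_ind_FTC a b (fun=> 1) id ab).
- by congr rint; apply/funext => x; rewrite mulr1.
- by move=> x; exact: cvg_cst.
Qed.

Lemma sqc_ft_ind_le a b xi : a <= b -> sqc (ft (ind a b) xi) <= 2 * (b - a) ^+ 2.
Proof.
move=> ab; have [i1 i2] := citg_ft xi (citg_ind a b).
have K : itg (\1_(`[a, b[) : R -> R) by exact: integrable_indic_itv.
have B (u : R -> R) : itg (fun x => \1_(`[a, b[) x * u x) -> (forall x, `|u x| <= 1) ->
    (rint (fun x => \1_(`[a, b[) x * u x)) ^+ 2 <= (b - a) ^+ 2.
  move=> iu u1; rewrite -real_normK ?num_real // ler_pXn2r ?nnegrE ?subr_ge0 //.
  rewrite -rint_ind //; apply: le_trans (rint_norm iu) _.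
  apply: rint_le => //; first exact: itg_norm.
  by move=> x; rewrite normrM ger0_norm ?indicE //; exact: ler_piMr.
have E1 : (fun x => Re (ind a b x * ew (x * xi))) = (fun x => \1_(`[a, b[) x * cos (x * xi)).
  by apply/funext => x; rewrite /ind /ew !cE; ring.
have E2 : (fun x => Im (ind a b x * ew (x * xi))) = (fun x => \1_(`[a, b[) x * - sin (x * xi)).
  by apply/funext => x; rewrite /ind /ew !cE; ring.
rewrite E1 in i1; rewrite E2 in i2.
rewrite /sqc /ft /cint !cE E1 E2 mulr2n mulrDl mul1r lerD //.
  by apply: B => // x; exact: cos_max.
by apply: B => // x; rewrite normrN ler_norml sin_geN1 sin_le1.
Qed.

Lemma L2_ft_ind a b : a <= b -> L2 (ft (ind a b)).
Proof.
move=> ab; apply/L2P; split; first exact: cmeas_ft (citg_ind a b).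
apply: (itg_le _ (itgZ (2 * (b - a) ^+ 2 + 4) itg_inv1sqr)).
  by apply: cmeas_sqc; exact: cmeas_ft (citg_ind a b).
move=> x; have x2 : 0 < 1 + x ^+ 2 by rewrite ltr_pwDl ?sqr_ge0.
rewrite ger0_norm ?sqc_ge0 // ler_pdivlMr // mulrDr mulr1 lerD //.
  exact: sqc_ft_ind_le.
rewrite mulrC sqc_ft_ind //; have := cos_geN1 ((b - a) * x); lra.
Qed.

(** This is (1 - cos (t xi)) / xi^2 for nonzero xi ([GfE]). Presenting it
    through the transform of an interval gives its integrability for free. *)
Definition Gf (t xi : R) : R := 2^-1 * sqc (ft (ind 0 `|t|) xi).

Lemma itg_Gf t : itg (Gf t).
Proof. by apply: itgZ; apply: L2_sqc; exact: L2_ft_ind. Qed.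

Lemma GfE t xi : xi ^+ 2 * Gf t xi = 1 - cos (t * xi).
Proof.
rewrite /Gf mulrCA sqc_ft_ind // subr0 mulKf //.
by have [_|_] := ger0P t => //; rewrite mulNr cosN.
Qed.

Lemma Gf_eq t xi (x : R) : xi != 0 -> xi ^+ 2 * x = 1 - cos (t * xi) -> x = Gf t xi.
Proof. by move=> x0; rewrite -GfE => /mulfI; apply; rewrite sqrf_eq0. Qed.

Lemma ae_neq0 : \forall x \ae mu, (x : R) != 0.
Proof.
exists [set 0]; split => //; first exact: lebesgue_measure_set1.
by move=> x /= /negP; rewrite negbK => /eqP.
Qed.

(** The integral of (1 - cos x) / x^2 over the line. *)
Definition kap : R := rint (Gf 1).

(** The substitution of t x for x shows that the integral is proportional to
    |t|. Plancherel's identity for intervals rests on this single integral. *)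
Lemma rint_Gf t : rint (Gf t) = `|t| * kap.
Proof.
have [->|t0] := eqVneq t 0.
  rewrite normr0 mul0r -[RHS]rint0; apply: rint_ae.
  - exact: itg_meas (itg_Gf 0).
  - exact: measurable_cst.
  - apply: aeS ae_neq0 => x x0 _; apply/esym; apply: (Gf_eq x0).
    by rewrite mulr0 mul0r cos0 subrr.
have i1 := itg_affine 0 t0 (itg_Gf 1).
rewrite /kap (rint_affine 0 t0 (itg_Gf 1)) mulrA -expr2 -rintZ //.
apply: rint_ae; first exact: itg_meas (itg_Gf t).
  exact: itg_meas (itgZ _ i1).
apply: aeS ae_neq0 => x x0 _; apply/esym; apply: (Gf_eq x0).
by rewrite addr0 real_normK ?num_real // mulrA -exprMn (mulrC x) GfE mul1r.
Qed.

Lemma kap_gt0 : 0 < kap.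
Proof.
have k0 : 0 <= kap by apply: rint_ge0 => x; rewrite mulr_ge0 ?sqc_ge0.
rewrite lt_neqAle k0 andbT; apply/negP => /eqP /esym h.
have := rint_eq0 (itg_Gf 1) _ h => /(_ _) H.
have {}H : \forall x \ae mu, cos x = 1.
  apply: aeS (H _) => [x hx|x]; last by rewrite mulr_ge0 ?sqc_ge0.
  have := GfE 1 x; rewrite hx // mulr0 mul1r; lra.
have := aeI H (ae_affine pi (oner_neq0 R) H).
move=> [A [mA A0 AT]]; have : mu `[0, 1]%classic = 0.
  apply: (@subset_measure0 _ _ _ mu _ A) => // x _; apply: AT => /=.
  by rewrite mul1r cosDpi => -[->]; lra.
have := @lebesgue_measure_itv R `[0, 1]; rewrite /= lte_fin ltr01 => ->.
by rewrite oppr0 adde0 => /eqP; rewrite eqe oner_eq0.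
Qed.

End Plancherel.

(** * Plancherel's identity for compactly supported functions *)

Section PlancherelL2.
Context {R : realType}.
Local Notation mu := (@lebesgue_measure R).
Local Open Scope complex_scope.
Local Notation Re := complex.Re.
Local Notation Im := complex.Im.
Local Notation I_ N := (`[- (N%:R : R), N%:R[%classic : set R).
Implicit Types (f g h : R -> R[i]) (z w c : R[i]).

Lemma dot_sumr (I : Type) (s : seq I) (F : I -> R -> R[i]) h :
  (forall i, L2 (F i)) -> L2 h ->
  L2dot h (fun x => \sum_(i <- s) F i x) = \sum_(i <- s) L2dot h (F i).
Proof.
move=> LF Lh; rewrite -cint_sum; last by move=> i; exact: citg_dot.
by congr cint; apply/funext => x; rewrite rmorph_sum mulr_sumr.
Qed.

Lemma dotBr f g h : L2 f -> L2 g -> L2 h ->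
  L2dot f (fun x => g x - h x) = L2dot f g - L2dot f h.
Proof.
move=> Lf Lg Lh; rewrite dotDr //; last exact: L2N.
congr (_ + _); rewrite (_ : (fun x => - h x) = (fun x => -1 * h x)); last first.
  by apply/funext => x; rewrite mulN1r.
by rewrite dotZr // rmorphN1 mulN1r.
Qed.

(** After multiplication by xi^2 the product of the two transforms is a
    combination of cosines of the four differences of endpoints, so its
    integral is the same combination of absolute values that [dot_ind] finds
    for the overlap of the intervals. *)
Lemma dot_ft_ind_re (a b c d : R) : a <= b -> c <= d ->
  Re (L2dot (ft (ind a b)) (ft (ind c d))) =
  kap * (`|b - c| + `|a - d| - `|b - d| - `|a - c|).
Proof.
move=> ab cd.
pose G xi := Gf (b - c) xi + Gf (a - d) xi - Gf (b - d) xi - Gf (a - c) xi : R.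
have iG : itg G by do 2?apply: itgB; try apply: itgD; exact: itg_Gf.
have [i1 _] := citg_dot (L2_ft_ind ab) (L2_ft_ind cd).
transitivity (rint G).
  change (rint (fun xi => Re (ft (ind a b) xi * (ft (ind c d) xi)^*)) = rint G).
  apply: rint_ae; [exact: itg_meas i1|exact: itg_meas iG|].
  apply: aeS ae_neq0 => x x0 _.
  have x2 : x ^+ 2 != 0 by rewrite sqrf_eq0.
  apply: (mulfI x2).
  have -> : x ^+ 2 * G x = (1 - cos ((b - c) * x)) + (1 - cos ((a - d) * x))
     - (1 - cos ((b - d) * x)) - (1 - cos ((a - c) * x)).
    by rewrite /G !mulrBr mulrDr !GfE.
  have E : forall z w, x ^+ 2 * Re (z * w^*) = Re ((x%:C * z) * (x%:C * w)^*).
    by move=> z w; rewrite !cE; ring.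
  rewrite E !ft_ind // !cE !mulrBl !cosB; clear.
  by move: (cos _) (cos _) (cos _) (cos _) (sin _) (sin _) (sin _) (sin _) => *; ring.
rewrite /G rintB ?rintB ?rintD ?rint_Gf; try exact: itg_Gf; first by ring.
  by apply: itgD; exact: itg_Gf.
by apply: itgB; [apply: itgD|]; exact: itg_Gf.
Qed.

Lemma ft_ind_neg (a b xi : R) : a <= b -> xi != 0 -> ft (ind a b) (- xi) = (ft (ind a b) xi)^*.
Proof.
move=> ab x0; have x0C : (- xi)%:C != 0 by rewrite rmorphN oppr_eq0; apply: contra x0 => /eqP[->].
apply: (mulfI x0C); rewrite ft_ind //.
have -> : (- xi)%:C * (ft (ind a b) xi)^* = - (xi%:C * ft (ind a b) xi)^*.
  by apply: eqcP; rewrite !cE; ring.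
rewrite ft_ind // !mulrN !sinN !cosN; apply: eqcP; rewrite !cE; ring.
Qed.

Lemma rint_odd (u : R -> R) : itg u -> (\forall x \ae mu, u (- x) = - u x) -> rint u = 0.
Proof.
move=> iu hu; have N1 : (-1 : R) != 0 by rewrite oppr_eq0 oner_eq0.
have := rint_affine 0 N1 iu; rewrite normrN1 mul1r.
rewrite [X in _ = X -> _](_ : _ = - rint u).
  by move: (rint u) => r; lra.
rewrite -rintN //; apply: rint_ae.
- exact: (itg_meas (itg_affine 0 N1 iu)).
- by apply: itg_meas; exact: itgN.
- by apply: aeS hu => x hx _; rewrite addr0 mulN1r.
Qed.

(** The imaginary part of the integrand is odd. *)
Lemma dot_ft_ind_im (a b c d : R) : a <= b -> c <= d ->
  Im (L2dot (ft (ind a b)) (ft (ind c d))) = 0.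
Proof.
move=> ab cd; have [_ i1] := citg_dot (L2_ft_ind ab) (L2_ft_ind cd).
apply: (rint_odd i1); apply: aeS ae_neq0 => x x0.
rewrite (ft_ind_neg ab x0) (ft_ind_neg cd x0).
by move: (ft (ind a b) x) (ft (ind c d) x) => z w; rewrite !cE; ring.
Qed.

Lemma dot_ind (a b c d : R) : a <= b -> c <= d ->
  2 * L2dot (ind a b) (ind c d) = (`|b - c| + `|a - d| - `|b - d| - `|a - c|)%:C.
Proof.
move=> ab cd; pose m := Num.max a c; pose M := Num.max m (Num.min b d).
have mM : m <= M by rewrite /M le_max lexx.
have -> : L2dot (ind a b) (ind c d) = (M - m)%:C.
  rewrite -(rint_ind mM) dotE.
  have E : (fun x => ind a b x * (ind c d x)^*) = (fun x => (\1_(`[m, M[) x : R)%:C).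
    apply/funext => x; rewrite /ind -[X in _ * X]/((\1_(`[c, d[) x)%:C^*) conjc_real -rmorphM.
    congr (_%:C); rewrite !indicE !mem_setE !in_itv /= -natrM mulnb; congr ((nat_of_bool _)%:R).
    rewrite /M lt_max /m ge_max lt_max lt_min.
    case: (leP a x) => ax; case: (leP c x) => cx; rewrite ?andbF //= ?(andbT, orbF) //.
  rewrite E /cint; apply: eqcP; rewrite !cE //.
  by rewrite -[RHS]rint0; congr rint; apply/funext => x; rewrite !cE.
rewrite -[2 : R[i]]/(1 *+ 2) -(rmorphMn (real_complex R)) -rmorphM /=; congr (_%:C).
rewrite /M /m; case: (leP a c) => ac; case: (leP b d) => bd; case: leP => h;
 repeat match goal with |- context[`|?x|] => case: (ger0P x) => ? end; lra.
Qed.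

(** Plancherel's constant for [ft]. It stays symbolic: a positive factor does
    not affect orthogonality relations. *)
Definition kappa : R := 2 * kap.

Lemma kappa_gt0 : 0 < kappa.
Proof. by rewrite mulr_gt0 // kap_gt0. Qed.

Lemma dot_ft_ind (a b c d : R) : a <= b -> c <= d ->
  L2dot (ft (ind a b)) (ft (ind c d)) = kappa%:C * L2dot (ind a b) (ind c d).
Proof.
move=> ab cd; rewrite /kappa rmorphM /= mulrAC.
rewrite -[(2 : R)%:C]/((1 *+ 2 : R)%:C) rmorphMn /= dot_ind //.
by apply: eqcP; rewrite ?dot_ft_ind_re ?dot_ft_ind_im // !cE; ring.
Qed.

Definition inds : set (R -> R[i]) := [set f | exists a b, a <= b /\ f = ind a b].

Lemma inds_L2 : inds `<=` L2.
Proof. by move=> f [a [b [_ ->]]]; exact: L2_ind. Qed.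

Lemma ft_lin n (c : 'I_n -> R[i]) (g : 'I_n -> R -> R[i]) : (forall i, inds (g i)) ->
  ft (fun x => \sum_(i < n) c i * g i x) = fun xi => \sum_(i < n) c i * ft (g i) xi.
Proof.
move=> gi; have ci i : citg (g i) by have [a [b [_ ->]]] := gi i; exact: citg_ind.
rewrite ft_sum; last by move=> i; exact: citgZ.
by apply/funext => xi; apply: eq_bigr => i _; rewrite ftZ.
Qed.

Lemma span_L2_ft f : lin_span inds f -> L2 (ft f).
Proof.
move=> [n [c [g [gi ->]]]]; rewrite ft_lin //; apply: L2_sum => i; apply: L2Z.
by have [a [b [ab ->]]] := gi i; exact: L2_ft_ind.
Qed.

Lemma dot_ft_span f g : lin_span inds f -> lin_span inds g ->
  L2dot (ft f) (ft g) = kappa%:C * L2dot f g.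
Proof.
move=> [n [c [u [iu ->]]]] [m [d [v [iv ->]]]]; rewrite !ft_lin //.
have Lu i : L2 (u i) by exact: inds_L2.
have Lv i : L2 (v i) by exact: inds_L2.
have Lfu i : L2 (ft (u i)) by have [a [b [ab ->]]] := iu i; exact: L2_ft_ind.
have Lfv i : L2 (ft (v i)) by have [a [b [ab ->]]] := iv i; exact: L2_ft_ind.
rewrite dot_suml; [|by move=> i; exact: L2Z|by apply: L2_sum => i; exact: L2Z].
rewrite dot_suml; [|by move=> i; exact: L2Z|by apply: L2_sum => i; exact: L2Z].
rewrite mulr_sumr; apply: eq_bigr => i _.
rewrite dot_sumr; [|by move=> j; exact: L2Z|exact: L2Z].
rewrite dot_sumr; [|by move=> j; exact: L2Z|exact: L2Z].
rewrite mulr_sumr; apply: eq_bigr => j _.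
rewrite !dotZl ?dotZr //; try exact: L2Z.
have [a [b [ab ->]]] := iu i; have [a' [b' [ab' ->]]] := iv j.
by rewrite dot_ft_ind //; ring.
Qed.

Lemma citg_cut N f : L2 f -> citg (cut (I_ N) f).
Proof.
move=> Lf; have [mf fi] := (L2P f).1 Lf.
have [m1 m2] : cmeas (cut (I_ N) f) by apply: cmeasM => //; exact: cmeas_ind.
have ii := itgD (itg_cst_ind 1 (- N%:R) N%:R) fi.
have K (a b : R) x : `|\1_(I_ N) x * a| <= 1 * \1_(I_ N) x + (a ^+ 2 + b ^+ 2).
  rewrite normrM ger0_norm; last by rewrite indicE.
  have := sqr_ge0 b; have : `|a| <= 1 + a ^+ 2.
    have := sqr_ge0 (`|a| - 1); rewrite sqrrB1 real_normK ?num_real // => h.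
    have : 0 <= a ^+ 2 by exact: sqr_ge0.
    by rewrite -mulr_natr in h; lra.
  have := sqr_ge0 a; case: (indic01 (I_ N) x) => ->; nra.
split.
  apply: (itg_le _ ii) => // x; rewrite /cut !cE mul0r subr0.
  exact: K.
apply: (itg_le _ ii) => // x; rewrite /cut !cE mul0r addr0 /sqc (addrC (Re _ ^+ 2)).
exact: K.
Qed.

Lemma cut_id (A : set R) f : cut A (cut A f) = cut A f.
Proof.
apply/funext => x; rewrite /cut; case: (indic01 A x) => ->; first by rewrite !mul0r.
by rewrite !mul1r.
Qed.

(** On these functions the Fourier integral converges absolutely, and step
    functions with the same support are dense ([supp_dense]). *)
Definition supp (N : nat) f := L2 f /\ cut (I_ N) f = f.

Lemma supp_citg N f : supp N f -> citg f.
Proof. by move=> [Lf <-]; exact: citg_cut. Qed.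

Lemma suppB N f g : supp N f -> supp N g -> supp N (fun x => f x - g x).
Proof.
move=> [Lf Ef] [Lg Eg]; split; first exact: L2B.
by rewrite -{2}Ef -{2}Eg; apply/funext => x; rewrite /cut mulrBr.
Qed.

(** The Cauchy-Schwarz inequality against the exponential cut off to the
    support. *)
Lemma sqc_ft_le N f xi : supp N f -> sqc (ft f xi) <= N2 f * (2 * N%:R).
Proof.
move=> sf; have [Lf Ef] := sf.
have NN : - N%:R <= N%:R :> R by have := ler0n R N; lra.
pose e := fun x => (\1_(I_ N) x : R)%:C * (ew (x * xi))^*.
have mI : measurable (I_ N) by exact: measurable_itv.
have me : cmeas e by apply: cmeasM; [exact: cmeas_ind|apply: cmeasJ; exact: cmeas_ew].
have se : (fun x => sqc (e x)) = (\1_(I_ N) : R -> R).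
  apply/funext => x; rewrite /e sqcM sqcJ sqc_ew mulr1 sqcC.
  by case: (indic01 (I_ N) x) => ->; rewrite ?expr0n ?expr1n.
have Le : L2 e by apply/L2P; split => //; rewrite se; exact: integrable_indic_itv.
have -> : ft f xi = L2dot f e.
  rewrite dotE /ft; congr cint; apply/funext => x.
  rewrite -Ef /cut /e; case: (indic01 (I_ N) x) => ->; apply: eqcP; rewrite !cE; ring.
have := cauchy_schwarz Lf Le; rewrite {2}/N2 se rint_ind //; congr (_ <= _ * _); ring.
Qed.

Lemma cut_inds N f : inds f -> inds (cut (I_ N) f).
Proof.
move=> [a [b [ab ->]]]; pose m := Num.max a (- N%:R); pose M := Num.max m (Num.min b N%:R).
exists m, M; split; first by rewrite /M le_max lexx.
apply/funext => x; rewrite /cut /ind -rmorphM; congr (_%:C).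
rewrite !indicE !mem_setE !in_itv /= -natrM mulnb; congr ((nat_of_bool _)%:R).
rewrite /M lt_max /m ge_max lt_max lt_min.
case: (leP a x) => ax; case: (leP (- N%:R) x) => cx; rewrite ?andbF //= ?(andbT, orbF) //.
  by rewrite andbC.
Qed.

Lemma cut_span N f : lin_span inds f -> lin_span inds (cut (I_ N) f).
Proof.
move=> [n [c [g [gi ->]]]]; exists n, c, (fun i => cut (I_ N) (g i)); split.
  by move=> i; exact: cut_inds.
by apply/funext => x; rewrite /cut mulr_sumr; apply: eq_bigr => i _; ring.
Qed.

Lemma dyads_inds : dyads `<=` inds.
Proof.
move=> f [J [k ->]]; rewrite dyad_ind; exists (k%:~R / 2 ^+ J), ((k%:~R + 1) / 2 ^+ J).
by split => //; rewrite ler_pM2r ?invr_gt0 ?exprn_gt0 //; lra.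
Qed.

Lemma supp_dense N f (e : R) : supp N f -> 0 < e ->
  exists s, [/\ lin_span inds s, supp N s & N2 (fun x => f x - s x) < e].
Proof.
move=> [Lf Ef] e0.
have /(clP _ (span_L2 dyads_L2))[_ /(_ _ e0)[s ss fs]] := step_dense Lf.
have si : lin_span inds s by apply: spanS ss; exact: dyads_inds.
have Ls := span_L2 inds_L2 si.
have mI : measurable (I_ N) by exact: measurable_itv.
exists (cut (I_ N) s); split.
- exact: cut_span.
- by split; [exact: L2_cut|exact: cut_id].
- apply: le_lt_trans fs; apply: rint_le.
  + by apply: L2_sqc; apply: L2B => //; exact: L2_cut.
  + by apply: L2_sqc; exact: L2B.
  + move=> x; rewrite -{1}Ef /cut -mulrBr sqcM sqcC; case: (indic01 (I_ N) x) => ->.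
      by rewrite expr0n mul0r sqc_ge0.
    by rewrite expr1n mul1r.
Qed.

Lemma sqc_cvg (u : nat -> R[i]) z : sqc (u n - z) @[n --> \oo] --> (0 : R) ->
  sqc (u n) @[n --> \oo] --> sqc z.
Proof.
move=> h.
have K (v : nat -> R) (l : R) : (forall n, (v n - l) ^+ 2 <= sqc (u n - z)) -> v n @[n --> \oo] --> l.
  move=> vl; apply/cvgrPdist_lt => e e0.
  move/cvgrPdist_lt : h => /(_ (e ^+ 2)); rewrite exprn_gt0 // => /(_ isT).
  apply: filterS => n; rewrite sub0r normrN ger0_norm ?sqc_ge0 // => hn.
  rewrite -(@ltr_pXn2r _ 2) ?nnegrE ?(ltW e0) // real_normK ?num_real //.
  by apply: le_lt_trans hn; rewrite -sqrrN opprB; exact: vl.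
apply: cvgD.
  under eq_fun do rewrite expr2; rewrite expr2.
  by apply: cvgM; apply: K => n; rewrite /sqc !cE lerDl sqr_ge0.
under eq_fun do rewrite expr2; rewrite expr2.
by apply: cvgM; apply: K => n; rewrite /sqc !cE lerDr sqr_ge0.
Qed.

Lemma le_eps (a b C : R) : 0 <= C -> (forall e, 0 < e -> a <= b + C * e) -> a <= b.
Proof.
move=> C0 h; apply/ler_addgt0Pl => e e0.
have := h (e / (C + 1)) (divr_gt0 e0 (ltr_wpDl C0 ltr01)).
rewrite addrC => h1; apply: le_trans h1 _; rewrite lerD2r mulrA ler_pdivrMr ?ltr_wpDl //.
by rewrite mulrDr mulr1 mulrC lerDl ltW.
Qed.

(** Step functions with a common support converge to [f] in L2, hence their
    transforms converge pointwise ([sqc_ft_le]) and Fatou's lemma bounds the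
    limit. The factor 2, lost in a squared triangle inequality, disappears in
    [dot_ft_supp]. *)
Lemma supp_ft N f : supp N f -> L2 (ft f) /\ N2 (ft f) <= 2 * kappa * N2 f.
Proof.
move=> sf; have [Lf Ef] := sf.
have cf := supp_citg sf.
have k0 := kappa_gt0.
have K (e : R) : 0 < e -> itg (fun xi => sqc (ft f xi)) /\
   rint (fun xi => sqc (ft f xi)) <= 2 * kappa * (N2 f + e).
  move=> e0.
  have hn (n : nat) : 0 < e / n.+1%:R by rewrite divr_gt0.
  pose s n := projT1 (cid (supp_dense sf (hn n))).
  have Hs n : [/\ lin_span inds (s n), supp N (s n) & N2 (fun x => f x - s n x) < e / n.+1%:R].
    exact: (projT2 (cid (supp_dense sf (hn n)))).
  apply: (@rfatou _ (fun n xi => sqc (ft (s n) xi))).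
  - by move=> n; apply: L2_sqc; apply: span_L2_ft; have [] := Hs n.
  - by move=> n x; exact: sqc_ge0.
  - by apply: cmeas_sqc; exact: cmeas_ft.
  - apply: aeT => xi; apply: sqc_cvg.
    apply/cvgrPdist_lt => d d0.
    pose C := e * (2 * N%:R) + 1; have C0 : 0 < C.
      by rewrite ltr_wpDl // !mulr_ge0 // ltW.
    exists (Num.truncn (C / d)).+1 => // n /= hnn.
    have h1 : C / d < n%:R by apply: lt_le_trans (truncnS_gt _) _; rewrite ler_nat.
    have [si ss fs] := Hs n.
    rewrite sub0r normrN ger0_norm ?sqc_ge0 // -sqcN opprB.
    have -> : ft f xi - ft (s n) xi = ft (fun x => f x - s n x) xi.
      by rewrite ftB //; exact: supp_citg ss.
    apply: le_lt_trans (sqc_ft_le xi (suppB sf ss)) _.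
    apply: (@le_lt_trans _ _ (e / n.+1%:R * (2 * N%:R))).
      by rewrite ler_wpM2r ?mulr_ge0 // ltW.
    rewrite mulrAC ltr_pdivrMr //.
    rewrite ltr_pdivrMr // in h1.
    have : n%:R < n.+1%:R :> R by rewrite ltr_nat.
    rewrite /C in h1; nra.
  - move=> n; have [si ss fs] := Hs n.
    have Ls : L2 (s n) by case: ss.
    have -> : rint (fun xi => sqc (ft (s n) xi)) = kappa * N2 (s n).
      have := dot_ft_span si si; rewrite !dot_self -rmorphM /= => /complexI <-.
      by [].
    have := N2D_le (L2B Ls Lf) Lf; rewrite (_ : (fun x => _) = s n); last first.
      by apply/funext => x; rewrite subrK.
    have -> : N2 (fun x => s n x - f x) = N2 (fun x => f x - s n x).
      by rewrite -N2N; congr N2; apply/funext => x; rewrite opprB.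
    have : e / n.+1%:R <= e by rewrite ler_pdivrMr // ler_peMr ?ler1n // ltW.
    move=> h1 h2; have fe := lt_le_trans fs h1.
    have h3 : N2 (s n) <= 2 * (N2 f + e).
      by clear -h2 fe; move: h2 fe; move: (N2 _) (N2 _) (N2 _) => *; lra.
    by have := ler_wpM2l (ltW k0) h3; lra.
split.
  apply/L2P; split; first exact: cmeas_ft.
  by have [] := K 1 ltr01.
apply: (@le_eps _ _ (2 * kappa)); first by rewrite mulr_ge0 // ltW.
by move=> e e0; have [_] := K e e0; rewrite mulrDr.
Qed.

Lemma eps0 z (C : R) : 0 <= C -> (forall e, 0 < e -> sqc z <= C * e) -> z = 0.
Proof.
move=> C0 h; apply: sqc_eq0; apply/eqP; rewrite eq_le sqc_ge0 andbT.
by apply: (le_eps C0) => e e0; rewrite add0r; exact: h.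
Qed.

(** Step functions replace one argument, then, by conjugate symmetry, the
    other. *)
Lemma dot_ft_supp N f g : supp N f -> supp N g ->
  L2dot (ft f) (ft g) = kappa%:C * L2dot f g.
Proof.
have k0 := kappa_gt0.
have K f1 : supp N f1 -> (forall s, lin_span inds s -> supp N s ->
     L2dot (ft f1) (ft s) = kappa%:C * L2dot f1 s) ->
   forall g1, supp N g1 -> L2dot (ft f1) (ft g1) = kappa%:C * L2dot f1 g1.
  move=> sf Hf g1 sg; have [Lf _] := sf; have [Lg _] := sg.
  have [Lff _] := supp_ft sf; have [Lfg _] := supp_ft sg.
  apply/eqP; rewrite -subr_eq0; apply/eqP.
  apply: (@eps0 _ (4 * N2 (ft f1) * kappa + 2 * kappa ^+ 2 * N2 f1)).
    have := mulr_ge0 (N2_ge0 (ft f1)) (ltW k0); have := mulr_ge0 (sqr_ge0 kappa) (N2_ge0 f1); lra.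
  move=> e e0; have [s [si ss gs]] := supp_dense sg e0; have [Ls _] := ss.
  have [Lfs _] := supp_ft ss; have sgs := suppB sg ss.
  have [Lfgs Bgs] := supp_ft sgs.
  have Lgs := L2B Lg Ls.
  have -> : L2dot (ft f1) (ft g1) - kappa%:C * L2dot f1 g1 =
     L2dot (ft f1) (ft (fun x => g1 x - s x)) + - (kappa%:C * L2dot f1 (fun x => g1 x - s x)).
    rewrite ftB; [|exact: supp_citg sg|exact: supp_citg ss].
    rewrite (dotBr Lff Lfg Lfs) (dotBr Lf Lg Ls) (Hf s) //.
    move: (L2dot (ft f1) _) (L2dot f1 _) (L2dot f1 _) => u v w; ring.
  apply: le_trans (sqcD_le _ _) _; rewrite sqcN sqcM sqcC.
  have h1 := cauchy_schwarz Lff Lfgs; have h2 := cauchy_schwarz Lf Lgs.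
  have n1 := N2_ge0 (ft f1); have n2 := N2_ge0 f1.
  have n3 := N2_ge0 (fun x => g1 x - s x).
  have b1 : N2 (ft f1) * N2 (ft (fun x => g1 x - s x)) <= N2 (ft f1) * (2 * kappa * e).
    by rewrite ler_wpM2l //; apply: le_trans Bgs _; rewrite ler_wpM2l ?(ltW gs) // mulr_ge0 // ltW.
  have b2 : N2 f1 * N2 (fun x => g1 x - s x) <= N2 f1 * e by rewrite ler_wpM2l // ltW.
  have b3 : kappa ^+ 2 * sqc (L2dot f1 (fun x => g1 x - s x)) <= kappa ^+ 2 * (N2 f1 * e).
    by rewrite ler_wpM2l ?sqr_ge0 //; exact: le_trans h2 b2.
  lra.
move=> sf sg; have [Lf _] := sf; have [Lg _] := sg.
have [Lff _] := supp_ft sf; have [Lfg _] := supp_ft sg.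
apply: (K) => // s si ss; have [Ls _] := ss; have [Lfs _] := supp_ft ss.
rewrite (dotC Lfs Lff) (dotC Ls Lf) K //.
  by move: (L2dot s f) => z; apply: eqcP; rewrite !cE; ring.
by move=> s' si' ss'; exact: dot_ft_span.
Qed.

End PlancherelL2.

(** * The Fourier transform on L2 *)

Section FourierL2.
Context {R : realType}.
Local Notation mu := (@lebesgue_measure R).
Local Open Scope complex_scope.
Local Notation Re := complex.Re.
Local Notation Im := complex.Im.
Local Notation I_ N := (`[- (N%:R : R), N%:R[%classic : set R).
Implicit Types (f g h : R -> R[i]) (z w c : R[i]).

Definition L2cvg (u : nat -> R -> R[i]) f : Prop :=
  forall e : R, 0 < e -> exists N, forall n, (N <= n)%N -> N2 (fun x => u n x - f x) < e.

Lemma cvg_congr (u v : nat -> R) (l : R) : (forall n, u n = v n) ->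
  u n @[n --> \oo] --> l -> v n @[n --> \oo] --> l.
Proof. by move=> /funext ->. Qed.

Lemma cvg_fast (a : nat -> R) (M : R) :
  (forall j, `|a j.+1 - a j| <= M * 2^-1 ^+ j) -> exists l : R, a n @[n --> \oo] --> l.
Proof.
move=> aM.
have h2 : `|2^-1| < 1 :> R by rewrite ger0_norm ?invr_ge0 // invf_lt1 // ltr1n.
have c1 : cvgn (series (fun j => M * 2^-1 ^+ j)) by exact: is_cvg_geometric_series.
have c2 : cvgn (series (fun j => `|a j.+1 - a j|)).
  apply: (series_le_cvg _ _ aM c1) => j //.
  exact: le_trans (aM j).
have /cvg_ex[l hl] := normed_cvg c2.
exists (a 0%N + l).
apply: (@cvg_congr (fun n => a 0%N + series (fun j => a j.+1 - a j) n)); last first.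
  by apply: cvgD => //; exact: cvg_cst.
by move=> n; rewrite seriesEnat /= telescope_sumr // addrC subrK.
Qed.

Lemma sqc_cvg0 (u : nat -> R[i]) z : Re (u n) @[n --> \oo] --> Re z ->
  Im (u n) @[n --> \oo] --> Im z -> sqc (u n - z) @[n --> \oo] --> (0 : R).
Proof.
move=> hr hi; rewrite -(addr0 (0 : R)); apply: cvgD.
  under eq_fun do rewrite !cE expr2; rewrite -(mulr0 (0 : R)).
  by apply: cvgM; rewrite -(subrr (Re z)); apply: cvgB => //; exact: cvg_cst.
under eq_fun do rewrite !cE expr2; rewrite -(mulr0 (0 : R)).
by apply: cvgM; rewrite -(subrr (Im z)); apply: cvgB => //; exact: cvg_cst.
Qed.

(** Along a subsequence 4^j |d_j|^2 has an a.e. finite sum, where d_j are the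
    increments; so it converges a.e. at a geometric rate, and Fatou's lemma
    turns this into convergence of the whole sequence in norm. Limits superior
    serve as a measurable choice of the limit. *)
Lemma riesz_fischer (h : nat -> R -> R[i]) : (forall n, L2 (h n)) ->
  (forall e : R, 0 < e -> exists N, forall m n, (N <= m)%N -> (N <= n)%N ->
     N2 (fun x => h m x - h n x) < e) ->
  exists g, L2 g /\ L2cvg h g.
Proof.
move=> Lh Ch.
have e8 (j : nat) : 0 < 8^-1 ^+ j :> R by rewrite exprn_gt0.
pose nu j := projT1 (cid (Ch _ (e8 j))).
have Hnu j : forall m n, (nu j <= m)%N -> (nu j <= n)%N -> N2 (fun x => h m x - h n x) < 8^-1 ^+ j.
  exact: projT2 (cid (Ch _ (e8 j))).
(* indices that increase and exceed the thresholds [nu] *)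
pose k j := (j + \sum_(i < j.+1) nu i)%N.
have kj j : (j <= k j)%N by rewrite leq_addr.
have kn j : (nu j <= k j)%N by rewrite /k big_ord_recr /= addnA leq_addl.
have kn1 j : (nu j <= k j.+1)%N.
  by rewrite /k !big_ord_recr /= -addnA addnCA; lia.
pose d j x := h (k j.+1) x - h (k j) x.
have Ld j : L2 (d j) by exact: L2B.
pose u (j : nat) (x : R) : R := 4 ^+ j * sqc (d j x).
have iu j : itg (u j) by apply: itgZ; exact: L2_sqc.
have u0 j x : 0 <= u j x by rewrite mulr_ge0 ?sqc_ge0 // exprn_ge0.
have su n : \sum_(i < n) rint (u i) <= 2.
  apply: (@le_trans _ _ (\sum_(i < n) 2^-1 ^+ i)).
    apply: ler_sum => i _; rewrite /u rintZ; last exact: L2_sqc.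
    have := ltW (Hnu _ _ _ (kn1 i) (kn i)) => hd.
    have e4 : 0 <= 4 ^+ i :> R by rewrite exprn_ge0.
    apply: le_trans (ler_wpM2l e4 hd) _; rewrite -exprMn.
    by rewrite (_ : 4 * 8^-1 = 2^-1 :> R) //; field.
  have -> : forall m, \sum_(i < m) 2^-1 ^+ i = 2 - 2 * 2^-1 ^+ m :> R.
    elim=> [|m ihm]; first by rewrite big_ord0 expr0; ring.
    by rewrite big_ord_recr /= ihm exprS; field.
  by rewrite gerBl mulr_ge0 // exprn_ge0 // invr_ge0.
have [G [_ _ aG]] := itg_series iu u0 su.
have ae_cvg : \forall x \ae mu, exists l, forall j, `|Re (d j x)| <= l * 2^-1 ^+ j /\ `|Im (d j x)| <= l * 2^-1 ^+ j.
  apply: aeS aG => x hx.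
  have /cvg_seq_bounded[M [_ hM]] : cvgn (fun n => \sum_(i < n) u i x) by apply/cvg_ex; exists (G x).
  pose L := `|M| + 1.
  have uL j : u j x <= L.
    have h1 : `|\sum_(i < j.+1) u i x| <= L.
      by apply: (hM L) => //; rewrite /L; apply: (le_lt_trans (ler_norm M)); rewrite ltrDl.
    apply: le_trans h1; apply: le_trans (ler_norm _); rewrite big_ord_recr /= lerDr.
    by rewrite sumr_ge0.
  have L0 : 0 <= L by rewrite addr_ge0.
  exists (Num.sqrt L) => j.
  have e2 : 0 <= 2^-1 ^+ j :> R by rewrite exprn_ge0 // invr_ge0.
  have K (a : R) : a ^+ 2 <= sqc (d j x) -> `|a| <= Num.sqrt L * 2^-1 ^+ j.
    move=> ha; rewrite -(@ler_pXn2r _ 2) ?nnegrE ?mulr_ge0 ?sqrtr_ge0 //.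
    rewrite real_normK ?num_real // exprMn sqr_sqrtr //; apply: le_trans ha _.
    have := uL j; rewrite /u => h1.
    have e4 : 0 < 4 ^+ j :> R by rewrite exprn_gt0.
    rewrite -(ler_pM2l e4); apply: le_trans h1 _.
    rewrite mulrCA -exprM mulnC exprM -exprMn.
    by rewrite (_ : 4 * 2^-1 ^+ 2 = 1 :> R) ?expr1n ?mulr1 //; field.
  by split; apply: K; rewrite /sqc ?lerDl ?lerDr sqr_ge0.
pose gr x := fine (limn_esup (fun j => (Re (h (k j) x))%:E)).
pose gi x := fine (limn_esup (fun j => (Im (h (k j) x))%:E)).
have mh n : cmeas (h n) by exact: L2_meas.
have mg : cmeas (fun x => gr x +i* gi x).
  split => /=; apply: (measurableT_comp (fine_measurable measurableT)).
    apply: (@measurable_fun_limn_esup _ _ _ setT (fun j x => (Re (h (k j) x))%:E)) => j.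
    by apply: rmeasE; case: (mh (k j)).
  apply: (@measurable_fun_limn_esup _ _ _ setT (fun j x => (Im (h (k j) x))%:E)) => j.
  by apply: rmeasE; case: (mh (k j)).
have hg : \forall x \ae mu, sqc (h (k j) x - (gr x +i* gi x)) @[j --> \oo] --> (0 : R).
  apply: aeS ae_cvg => x [l hl].
  have Kc (a : nat -> R) : (forall j, `|a j.+1 - a j| <= l * 2^-1 ^+ j) ->
      a n @[n --> \oo] --> fine (limn_esup (fun j => (a j)%:E)).
    move=> /cvg_fast[b hb]; have hb' : (a n)%:E @[n --> \oo] --> b%:E by apply: cvg_EFin hb; exact: nearW.
    by rewrite (cvg_limn_einf_sup hb').2.
  apply: sqc_cvg0 => /=; apply: Kc => j; have [h1 h2] := hl j.
    by move: h1; rewrite /d !cE.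
  by move: h2; rewrite /d !cE.
pose g x := gr x +i* gi x.
have main e : 0 < e -> exists N, forall n, (N <= n)%N ->
    itg (fun x => sqc (h n x - g x)) /\ N2 (fun x => h n x - g x) < e.
  move=> e0; have [|N HN] := Ch (e / 2); first by rewrite divr_gt0.
  exists N => n Nn.
  have := @rfatou _ (fun j x => sqc (h n x - h (k (j + N)%N) x)) (fun x => sqc (h n x - g x)) (e / 2).
  case.
  - by move=> j; apply: L2_sqc; exact: L2B.
  - by move=> j x; exact: sqc_ge0.
  - apply: cmeas_sqc; apply: cmeasD => //.
    by under eq_fun do rewrite -mulN1r; exact: cmeasZ.
  - apply: aeS hg => x hx; apply: sqc_cvg.
    apply: (@cvg_congr (fun j => sqc (h (k (j + N)%N) x - g x))); last first.
      by rewrite (cvg_shiftn N (fun j => sqc (h (k j) x - g x))).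
    by move=> j; rewrite -sqcN; congr sqc; ring.
  - move=> j; apply/ltW/HN => //; apply: leq_trans (kj _); exact: leq_addl.
  - move=> ii hi; split => //; apply: le_lt_trans hi _; lra.
exists g; split; last by move=> e /main[N HN]; exists N => n /HN[].
have [N HN] := main 1 ltr01; have [ii _] := HN N (leqnn N).
have : L2 (fun x => h N x - (h N x - g x)).
  apply: L2B => //; apply/L2P; split => //; apply: cmeasD => //.
  by under eq_fun do rewrite -mulN1r; exact: cmeasZ.
by under eq_fun do rewrite subKr.
Qed.

Lemma dot_conv (u v : nat -> R -> R[i]) f g : (forall n, L2 (u n)) -> (forall n, L2 (v n)) ->
  L2 f -> L2 g -> L2cvg u f -> L2cvg v g ->
  forall e : R, 0 < e -> exists N, forall n, (N <= n)%N ->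
    sqc (L2dot (u n) (v n) - L2dot f g) < e.
Proof.
move=> Lu Lv Lf Lg uf vg e e0.
pose C := 4 * N2 g + 4 + 2 * N2 f + 1.
have C0 : 0 < C by have := N2_ge0 g; have := N2_ge0 f; rewrite /C; lra.
have [|N1 H1] := uf (e / C); first by rewrite divr_gt0.
have [|N2' H2] := vg (Num.min 1 (e / C)); first by rewrite lt_min ltr01 divr_gt0.
exists (maxn N1 N2') => n; rewrite geq_max => /andP[/H1 h1 /H2].
rewrite lt_min => /andP[h2 h3].
have Luf := L2B (Lu n) Lf; have Lvg := L2B (Lv n) Lg.
have -> : L2dot (u n) (v n) - L2dot f g =
    L2dot (fun x => u n x - f x) (v n) + L2dot f (fun x => v n x - g x).
  rewrite (dotBl (Lu n) Lf (Lv n)) (dotBr Lf (Lv n) Lg).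
  by move: (L2dot (u n) (v n)) (L2dot f (v n)) (L2dot f g) => x y z; ring.
apply: le_lt_trans (sqcD_le _ _) _.
have k1 := cauchy_schwarz Luf (Lv n); have k2 := cauchy_schwarz Lf Lvg.
have kv : N2 (v n) <= 2 + 2 * N2 g.
  have := N2D_le Lvg Lg; rewrite (_ : (fun x => _) = v n).
    by move: h2; lra.
  by apply/funext => x; rewrite subrK.
have f0 := N2_ge0 f; have g0 := N2_ge0 g; have n0 := N2_ge0 (fun x => u n x - f x).
have b1 : N2 (fun x => u n x - f x) * N2 (v n) <= e / C * (2 + 2 * N2 g).
  by apply: ler_pM => //; [exact: N2_ge0|exact: ltW].
have b2 : N2 f * N2 (fun x => v n x - g x) <= N2 f * (e / C) by rewrite ler_wpM2l // ltW.
apply: (@le_lt_trans _ _ (e / C * (4 + 4 * N2 g + 2 * N2 f))); first by lra.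
rewrite mulrAC ltr_pdivrMr // ltr_pM2l // /C; lra.
Qed.

(** A proportionality of inner products survives L2 limits in all four
    arguments. *)
Lemma dot_conv_eq (u v u' v' : nat -> R -> R[i]) f g f' g' z :
  (forall n, L2 (u n)) -> (forall n, L2 (v n)) ->
  (forall n, L2 (u' n)) -> (forall n, L2 (v' n)) ->
  L2 f -> L2 g -> L2 f' -> L2 g' ->
  L2cvg u f -> L2cvg v g -> L2cvg u' f' -> L2cvg v' g' ->
  (forall n, L2dot (u n) (v n) = z * L2dot (u' n) (v' n)) ->
  L2dot f g = z * L2dot f' g'.
Proof.
move=> Lu Lv Lu' Lv' Lf Lg Lf' Lg' uf vg uf' vg' E.
apply/eqP; rewrite -subr_eq0; apply/eqP.
apply: (@eps0 _ _ (2 + 2 * sqc z)); first by rewrite addr_ge0 // mulr_ge0 // sqc_ge0.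
move=> e e0; have [N1 H1] := dot_conv Lu Lv Lf Lg uf vg e0.
have [N2' H2] := dot_conv Lu' Lv' Lf' Lg' uf' vg' e0.
pose n := maxn N1 N2'.
have h1 := H1 n (leq_maxl _ _); have h2 := H2 n (leq_maxr _ _).
rewrite E in h1.
have -> : L2dot f g - z * L2dot f' g' =
   - (z * L2dot (u' n) (v' n) - L2dot f g) + z * (L2dot (u' n) (v' n) - L2dot f' g').
  by move: (L2dot f g) (L2dot f' g') (L2dot _ _) => *; ring.
apply: le_trans (sqcD_le _ _) _; rewrite sqcN sqcM.
have := ler_wpM2l (sqc_ge0 z) (ltW h2); move: h1.
move: (sqc (_ - _)) (sqc (_ - _)) => *; lra.
Qed.

Lemma conv_cut f : L2 f -> L2cvg (fun n => cut (I_ n) f) f.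
Proof.
move=> Lf e e0; have [mf fi] := (L2P f).1 Lf.
have mI n : measurable (I_ n) by exact: measurable_itv.
have Lc n : L2 (cut (I_ n) f) by exact: L2_cut.
have [_] : itg (fun=> 0 : R) /\ N2 (fun x => cut (I_ n) f x - f x) @[n --> \oo] --> rint (fun=> 0 : R).
  apply: (@rdct R (fun n x => sqc (cut (I_ n) f x - f x)) (fun=> 0) _ _ _ fi).
  - by move=> n; apply: cmeas_sqc; apply: L2_meas; exact: L2B.
  - exact: measurable_cst.
  - move=> n x; rewrite ger0_norm ?sqc_ge0 // /cut; case: (indic01 (I_ n) x) => ->.
      by rewrite mul0r sub0r sqcN.
    by rewrite mul1r subrr sqc0 sqc_ge0.
  - apply: aeT => x; apply/cvgrPdist_lt => d d0.
    exists (Num.truncn `|x|).+1 => //= n /= hn.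
    have h0 := truncnS_gt `|x|.
    have : `|x| < n%:R by apply: (lt_le_trans h0); rewrite ler_nat.
    rewrite ltr_norml => /andP[a b]; rewrite /cut indicE mem_set /=; last first.
      by rewrite in_itv /= ltW.
    by rewrite mul1r subrr sqc0 subrr normr0.
rewrite rint0 => /cvgrPdist_lt /(_ e e0)[N _ HN]; exists N => n /HN.
by rewrite sub0r normrN ger0_norm // N2_ge0.
Qed.

Lemma conv_cauchy (u : nat -> R -> R[i]) f : (forall n, L2 (u n)) -> L2 f -> L2cvg u f ->
  forall e : R, 0 < e -> exists N, forall m n, (N <= m)%N -> (N <= n)%N ->
     N2 (fun x => u m x - u n x) < e.
Proof.
move=> Lu Lf uf e e0; have [|N HN] := uf (e / 4); first by rewrite divr_gt0.
exists N => m n /HN h1 /HN h2.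
have := N2D_le (L2B (Lu m) Lf) (L2N (L2B (Lu n) Lf)); rewrite N2N.
rewrite (_ : (fun x => _) = (fun x => u m x - u n x)).
  by move: h1 h2; lra.
by apply/funext => x; ring.
Qed.

Lemma supp_cut N f : L2 f -> supp N (cut (I_ N) f).
Proof. by move=> Lf; split; [apply: L2_cut => //; exact: measurable_itv|exact: cut_id]. Qed.

Lemma suppS N M f : (N <= M)%N -> supp N f -> supp M f.
Proof.
move=> NM [Lf Ef]; split => //; apply/funext => x; rewrite -{2}Ef -{1}Ef /cut.
rewrite !indicE !mem_setE !in_itv /=; case: (boolP (- N%:R <= x < N%:R)) => [/andP[a b]|_].
  rewrite (_ : (- M%:R <= x < M%:R)) ?mul1r //.
  have : N%:R <= M%:R :> R by rewrite ler_nat.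
  by move=> h; apply/andP; split; lra.
by rewrite !mul0r mulr0.
Qed.

Definition c0 : R := (Num.sqrt (2 * pi))^-1.

Lemma c0_gt0 : 0 < c0.
Proof. by rewrite invr_gt0 sqrtr_gt0 mulr_gt0 // pi_gt0. Qed.

Lemma fourier_truncE n f : L2 f -> fourier_trunc n f = fun xi => c0%:C * ft (cut (I_ n) f) xi.
Proof.
move=> Lf; apply/funext => xi; rewrite /fourier_trunc -/c0; congr (_ * _).
have [i1 i2] := citg_ft xi (citg_cut n Lf).
have K (u : R -> R) : itg (fun x => \1_(I_ n) x * u x) ->
    \int[mu]_(x in `[- n%:R, n%:R]) u x = rint (fun x => \1_(I_ n) x * u x).
  move=> iu; rewrite -Rintegral_itv_bndo_bndc; last first.
    by apply/itg_restrict => //; exact: measurable_itv.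
  by rewrite /rint /Rintegral int_restrict.
rewrite /cintegral /ft /cint; congr (_ +i* _); rewrite K.
- by congr rint; apply/funext => x; rewrite /cut /ew !cE; ring.
- by move: i1; congr itg; apply/funext => x; rewrite /cut /ew !cE; ring.
- by congr rint; apply/funext => x; rewrite /cut /ew !cE; ring.
- by move: i2; congr itg; apply/funext => x; rewrite /cut /ew !cE; ring.
Qed.

Lemma L2_trunc n f : L2 f -> L2 (fourier_trunc n f).
Proof.
by move=> Lf; rewrite fourier_truncE //; apply: L2Z; case: (supp_ft (supp_cut n Lf)).
Qed.

(** The truncations of [f] form a Cauchy sequence, and the bound [supp_ft]
    carries this over to their transforms. *)
Lemma fourier_ex f : L2 f -> exists g, L2 g /\ L2cvg (fun n => fourier_trunc n f) g.
Proof.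
move=> Lf; have k0 := kappa_gt0 (R := R); have c00 := c0_gt0.
apply: riesz_fischer => [n|e e0]; first exact: L2_trunc.
pose D := c0 ^+ 2 * (2 * kappa).
have D0 : 0 < D by rewrite mulr_gt0 ?exprn_gt0 // mulr_gt0.
have Lc n : L2 (cut (I_ n) f) by case: (supp_cut n Lf).
have [|N HN] := conv_cauchy Lc Lf (conv_cut Lf) (e := e / D); first by rewrite divr_gt0.
exists N => m n hm hn; rewrite !fourier_truncE //.
have sm := suppS (leq_maxl m n) (supp_cut m Lf).
have sn := suppS (leq_maxr m n) (supp_cut n Lf).
have smn := suppB sm sn; have [Lft B] := supp_ft smn.
rewrite (_ : (fun x => _) = (fun xi => c0%:C * ft (fun x => cut (I_ m) f x - cut (I_ n) f x) xi)); last first.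
  by rewrite ftB; [apply/funext => xi; rewrite mulrBr|exact: supp_citg sm|exact: supp_citg sn].
rewrite N2Z // sqcC; have := HN _ _ hm hn; rewrite ltr_pdivlMr // => h.
apply: le_lt_trans h; apply: le_trans (ler_wpM2l (sqr_ge0 c0) B) _.
by rewrite /D [leRHS]mulrC !mulrA lexx.
Qed.

Lemma fourierP f : L2 f -> L2 (fourier f) /\ L2cvg (fun n => fourier_trunc n f) (fourier f).
Proof.
move=> Lf; have [g [Lg cg]] := fourier_ex Lf.
have E h : L2 h -> (fun n => L2norm (fun xi => fourier_trunc n f xi - h xi)) =
    (fun n => (Num.sqrt (N2 (fun xi => fourier_trunc n f xi - h xi)))%:E).
  move=> Lh; apply/funext => n; rewrite L2norm_N2 //; apply: L2B => //; exact: L2_trunc.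
have : is_fourier f (fourier f).
  apply: (@xgetPex _ (cst 0) [set g | is_fourier f g]); exists g; split => //=.
  rewrite E //; apply: cvg_EFin; first exact: nearW.
  apply/cvgrPdist_lt => e e0; have [|N HN] := cg (e ^+ 2); first by rewrite exprn_gt0.
  exists N => // n /= /HN h; rewrite sub0r normrN ger0_norm ?sqrtr_ge0 //.
  by rewrite -[X in _ < X](gtr0_norm e0) -sqrtr_sqr ltr_sqrt // exprn_gt0.
move=> [LF]; rewrite E // => /fine_cvgP[_ /= cF]; split => // e e0.
have e1 : 0 < Num.sqrt e by rewrite sqrtr_gt0.
move/cvgrPdist_lt : cF => /(_ _ e1)[N _ HN]; exists N => n /HN.
by rewrite /= sub0r normrN ger0_norm ?sqrtr_ge0 // ltr_sqrt.
Qed.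

Lemma L2_shift f t : L2 f -> L2 (fun x => f (x - t)).
Proof.
by move=> Lf; have := L2_affine (- t) (oner_neq0 R) Lf; under eq_fun do rewrite mul1r.
Qed.

Lemma N2_shift f t : L2 f -> N2 (fun x => f (x - t)) = N2 f.
Proof.
move=> Lf; rewrite (N2_affine (- t) (oner_neq0 R) Lf) normr1 mul1r.
by congr N2; apply/funext => x; rewrite mul1r.
Qed.

Lemma conv_shift u f t : (forall n, L2 (u n)) -> L2 f -> L2cvg u f ->
  L2cvg (fun n x => u n (x - t)) (fun x => f (x - t)).
Proof.
move=> Lu Lf uf e /uf[N HN]; exists N => n /HN.
by rewrite -(N2_shift t (L2B (Lu n) Lf)).
Qed.

Lemma cint_shift f t : citg f -> cint (fun x => f (x - t)) = cint f.
Proof.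
move=> cf; rewrite (cint_affine (- t) (oner_neq0 R) cf) normr1 mul1r.
by congr cint; apply/funext => x; rewrite mul1r.
Qed.

Lemma ft_shift f t xi : citg f -> ft (fun x => f (x - t)) xi = ew (t * xi) * ft f xi.
Proof.
move=> cf; rewrite /ft -cintZ; last exact: citg_ft.
rewrite -[RHS](cint_shift t); last by apply: citgZ; exact: citg_ft.
congr cint; apply/funext => x; rewrite mulrCA -ewD -mulrDl; congr (_ * ew (_ * _)).
by ring.
Qed.

Lemma supp_shift N f t : supp N f -> exists M, supp M (fun x => f (x - t)).
Proof.
move=> [Lf Ef]; exists (N + (Num.truncn `|t|).+1)%N; split; first exact: L2_shift.
apply/funext => x; rewrite /cut -Ef /cut !indicE !mem_setE !in_itv /=.
case: (boolP (- N%:R <= x - t < N%:R)) => [/andP[a b]|_]; last by rewrite !mul0r mulr0.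
rewrite (_ : (_ <= x < _)) ?mul1r // natrD.
have := truncnS_gt `|t|; move: (_.+1) => T; rewrite ltr_norml => /andP[h1 h2].
by move: (N%:R : R) (T%:R : R) a b h1 h2 => p q a b h1 h2; apply/andP; split; lra.
Qed.

Lemma conv_mul u f (e : R -> R[i]) : cmeas e -> (forall x, sqc (e x) = 1) ->
  (forall n, L2 (u n)) -> L2 f -> L2cvg u f ->
  L2cvg (fun n x => e x * u n x) (fun x => e x * f x).
Proof.
move=> me e1 Lu Lf uf d /uf[N HN]; exists N => n /HN; congr (_ < _).
by congr rint; apply/funext => x; rewrite -mulrBr sqcM e1 mul1r.
Qed.

Lemma cmeas_ewl (t : R) : cmeas (fun x => ew (t * x)).
Proof. by have := cmeas_ew t; under eq_fun do rewrite mulrC. Qed.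

Lemma L2_ewM t f : L2 f -> L2 (fun x => ew (t * x) * f x).
Proof. by apply: (@L2_bddM _ 1); [exact: cmeas_ewl|move=> x; rewrite sqc_ew]. Qed.

(** Plancherel's constant for [fourier]. *)
Definition kF : R := c0 ^+ 2 * kappa.

Lemma kF_gt0 : 0 < kF.
Proof. by rewrite mulr_gt0 ?exprn_gt0 ?c0_gt0 ?kappa_gt0. Qed.

(** The translation by [t] is carried along because brackets are tested against
    all integer translates. The identity is passed to the limit from truncated
    functions. *)
Theorem plancherel f g t : L2 f -> L2 g ->
  L2dot (fun xi => ew (t * xi) * fourier f xi) (fourier g) =
  kF%:C * L2dot (fun x => f (x - t)) g.
Proof.
move=> Lf Lg; have [LF cF] := fourierP Lf; have [LG cG] := fourierP Lg.
have Lcf n : L2 (cut (I_ n) f) by case: (supp_cut n Lf).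
have Lcg n : L2 (cut (I_ n) g) by case: (supp_cut n Lg).
have cu := @conv_mul (fun n => fourier_trunc n f) (fourier f) (fun xi => ew (t * xi))
  (cmeas_ewl t) (fun x => sqc_ew (t * x)) (fun n => L2_trunc n Lf) LF cF.
have cu' := conv_shift t Lcf Lf (conv_cut Lf).
have E n : L2dot (fun xi => ew (t * xi) * fourier_trunc n f xi) (fourier_trunc n g) =
    kF%:C * L2dot (fun x => cut (I_ n) f (x - t)) (cut (I_ n) g).
  rewrite !fourier_truncE //.
  have sf := supp_cut n Lf; have [M sM] := supp_shift t sf.
  have s1 := suppS (leq_maxl M n) sM; have s2 := suppS (leq_maxr M n) (supp_cut n Lg).
  have [Lft1 _] := supp_ft s1; have [Lft2 _] := supp_ft s2.
  rewrite (_ : (fun xi => ew (t * xi) * _) = (fun xi => c0%:C * ft (fun x => cut (I_ n) f (x - t)) xi)); last first.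
    by apply/funext => xi; rewrite (ft_shift t xi (supp_citg sf)) mulrCA.
  rewrite dotZl //; last exact: L2Z.
  rewrite dotZr // (dot_ft_supp s1 s2) /kF.
  by move: (L2dot _ _) => z; apply: eqcP; rewrite !cE; ring.
exact: (dot_conv_eq (fun n => L2_ewM t (L2_trunc n Lf)) (fun n => L2_trunc n Lg)
   (fun n => L2_shift t (Lcf n)) Lcg (L2_ewM t LF) LG (L2_shift t Lf) Lg cu cG cu'
   (conv_cut Lg) E).
Qed.

End FourierL2.

(** * Uniqueness for trigonometric integrals *)

Section TrigUniqueness.
Context {R : realType}.
Local Notation mu := (@lebesgue_measure R).
Local Open Scope complex_scope.
Local Notation Re := complex.Re.
Local Notation Im := complex.Im.
Implicit Types (f g h : R -> R[i]).

Lemma bernoulli_sub (s : R) n : 0 <= s <= 1 -> 1 - n%:R * s <= (1 - s) ^+ n.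
Proof.
move=> /andP[s0 s1]; elim: n => [|n ih]; first by rewrite mul0r subr0 expr0.
rewrite exprS; apply: (@le_trans _ _ ((1 - s) * (1 - n%:R * s))).
  have := ler0n R n; rewrite -natr1; move: (n%:R : R) => m; nra.
by rewrite ler_wpM2l // subr_ge0.
Qed.

Lemma bernoulli_add (s : R) n : 0 <= s -> 1 + n%:R * s <= (1 + s) ^+ n.
Proof.
move=> s0; elim: n => [|n ih]; first by rewrite mul0r addr0 expr0.
rewrite exprS; apply: (@le_trans _ _ ((1 + s) * (1 + n%:R * s))).
  have := ler0n R n; rewrite -natr1; move: (n%:R : R) => m; nra.
by rewrite ler_wpM2l // addr_ge0.
Qed.

Lemma pow_sub_le (s : R) n : 0 <= s <= 1 -> (1 - s) ^+ n * (1 + n%:R * s) <= 1.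
Proof.
move=> /andP[s0 s1]; apply: (@le_trans _ _ ((1 - s) ^+ n * (1 + s) ^+ n)).
  by rewrite ler_wpM2l ?bernoulli_add // exprn_ge0 // subr_ge0.
rewrite -exprMn -subr_sqr expr1n exprn_ile1 ?subr_ge0 ?exprn_ile1 //.
by rewrite gerBl sqr_ge0.
Qed.

Lemma cvg_n_geometric (r : R) : 0 <= r < 1 -> n%:R * r ^+ n @[n --> \oo] --> (0 : R).
Proof.
move=> /andP[r0 r1]; have [->|rn0] := eqVneq r 0.
  apply: (@cvg_congr _ (fun=> 0)); last exact: cvg_cst.
  by case=> [|n]; rewrite ?mul0r // exprS mul0r mulr0.
(* n s^n stays bounded for s < 1, and r^n = s^n s^n *)
pose s := Num.sqrt r; have s0 : 0 < s by rewrite sqrtr_gt0 lt_neqAle eq_sym rn0.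
have s1 : s < 1 by rewrite -sqrtr1 ltr_sqrt.
have sr : s ^+ 2 = r by rewrite sqr_sqrtr.
pose C := (s^-1 - 1)^-1.
have h0 : 0 < s^-1 - 1 by rewrite subr_gt0 invf_gt1.
have C0 : 0 < C by rewrite invr_gt0.
have B n : n%:R * s ^+ n <= C.
  have := bernoulli_add n (ltW h0); rewrite addrCA subrr addr0 exprVn => h.
  have sn : 0 < s ^+ n by rewrite exprn_gt0.
  rewrite -(ler_pM2r h0) /C mulVf ?gt_eqF //.
  have : (1 + n%:R * (s^-1 - 1)) * s ^+ n <= 1 by rewrite -ler_pdivlMr // mul1r.
  by move: (n%:R : R) (s ^+ n) sn (s^-1 - 1) => a b b0 c; nra.
have gs : C * s ^+ n @[n --> \oo] --> (0 : R).
  by apply: cvg_geometric; rewrite ger0_norm // ltW.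
apply/cvgrPdist_lt => e e0; move/cvgrPdist_lt : gs => /(_ e e0)[N _ HN].
exists N => // n /= /HN; rewrite !sub0r !normrN => h.
apply: le_lt_trans h; rewrite -sr -exprM mul2n -addnn exprD mulrA normrM [leRHS]normrM.
by apply: ler_wpM2r => //; rewrite !ger0_norm ?mulr_ge0 ?exprn_ge0 ?(ltW C0) ?(ltW s0).
Qed.

(** By Bernoulli's inequalities the behaviour for large n is governed by n 2^n
    t^n = n (2 t)^n: the limit is 1 for t < 1/2 and 0 for t >= 1/2
    ([bump_cvg]). *)
Definition bump (t : R) (n : nat) : R := (1 - t ^+ n) ^+ (n * 2 ^ n).

Lemma bump01 t n : 0 <= t <= 1 -> 0 <= bump t n <= 1.
Proof.
move=> /andP[t0 t1]; have h : 0 <= 1 - t ^+ n by rewrite subr_ge0 exprn_ile1.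
by rewrite exprn_ge0 // exprn_ile1 // gerBl exprn_ge0.
Qed.

Lemma bump_cvg (t : R) : 0 <= t <= 1 ->
  bump t n @[n --> \oo] --> (if t < 2^-1 then 1 else 0 : R).
Proof.
move=> t01; have /andP[t0 t1] := t01.
have tn n : 0 <= t ^+ n <= 1 by rewrite exprn_ge0 // exprn_ile1.
have Ns n : (n * 2 ^ n)%:R * t ^+ n = n%:R * (2 * t) ^+ n :> R.
  by rewrite natrM natrX exprMn mulrA.
case: ltP => ht.
- have r01 : 0 <= 2 * t < 1.
    by rewrite mulr_ge0 //= mulrC -ltr_pdivlMr // mul1r.
  have c1 := cvg_n_geometric r01.
  apply/cvgrPdist_lt => e e0; move/cvgrPdist_lt : c1 => /(_ e e0)[N _ HN].
  exists N => // n /= /HN; rewrite sub0r normrN => h.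
  have /andP[b0 b1] := bump01 n t01.
  rewrite ger0_norm ?subr_ge0 //; apply: le_lt_trans (le_lt_trans (ler_norm _) h).
  have := bernoulli_sub (n * 2 ^ n) (tn n); rewrite Ns -/(bump t n); lra.
- apply/cvgrPdist_lt => e e0; exists (Num.truncn e^-1).+1 => // n /= hn.
  have h1 : e^-1 < n%:R by apply: lt_le_trans (truncnS_gt _) _; rewrite ler_nat.
  have /andP[b0 b1] := bump01 n t01.
  rewrite sub0r normrN ger0_norm //.
  have := pow_sub_le (n * 2 ^ n) (tn n); rewrite Ns -/(bump t n) => h2.
  have h3 : 1 <= (2 * t) ^+ n by rewrite exprn_ege1 // mulrC -ler_pdivrMr // mul1r.
  have h4 : n%:R <= n%:R * (2 * t) ^+ n :> R by rewrite ler_peMr.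
  have h5 : bump t n * n%:R <= 1.
    apply: le_trans h2; rewrite ler_wpM2l //; lra.
  have n0 : 0 < n%:R :> R by apply: lt_trans h1; rewrite invr_gt0.
  rewrite -ler_pdivlMr // mul1r in h5; apply: le_lt_trans h5 _.
  by rewrite invf_plt ?posrE.
Qed.

Section Killing.
Variable u : R -> R[i].
Hypothesis cu : citg u.

(** The Fourier coefficients of [w u], taken over the whole line, all vanish.
    The class of these weights is stable under multiplication by [tcos], hence
    by polynomials in [tcos] with values in [0, 1], and these approximate the
    indicators of arcs. *)
Definition killed (w : R -> R) : Prop := [/\ rmeas w, (forall x, 0 <= w x <= 1) &
  forall k : int, cint (fun x => (w x)%:C * (u x * ew (k%:~R * x))) = 0].

Lemma citg_uew (k : int) : citg (fun x => u x * ew (k%:~R * x)).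
Proof.
by apply: citg_bddM => //; [exact: cmeas_ewl|move=> x; rewrite sqc_ew].
Qed.

Lemma citg_wu (w : R -> R) (k : int) : rmeas w -> (forall x, 0 <= w x <= 1) ->
  citg (fun x => (w x)%:C * (u x * ew (k%:~R * x))).
Proof.
move=> mw w01; under eq_fun do rewrite mulrC; apply: citg_bddM; first exact: citg_uew.
  by split => //=; exact: measurable_cst.
by move=> x; rewrite sqcC; have /andP[a b] := w01 x; rewrite exprn_ile1.
Qed.

Lemma ew_cos (x x0 : R) (k : int) : (cos (x - x0))%:C * ew (k%:~R * x) =
  2^-1%:C * (ew (- x0) * ew ((k + 1)%:~R * x)) + 2^-1%:C * (ew x0 * ew ((k - 1)%:~R * x)).
Proof.
rewrite intrD intrB !mulrDl mul1r mulN1r !ewD ewN ewN /ew cosB.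
by apply: eqcP; rewrite !cE; field.
Qed.

Variables (x0 c : R).
Hypothesis c1 : `|c| <= 1.

(** An affine function of the cosine with values in [0, 1] that is smaller than
    1/2 exactly on the arc cos (x - x0) > c. *)
Definition tcos (x : R) : R := 2^-1 - 4^-1 * (cos (x - x0) - c).

Lemma tcos01 x : 0 <= tcos x <= 1.
Proof.
have := cos_max (x - x0); rewrite /tcos !ler_norml => /andP[a b].
move: c1; rewrite ler_norml => /andP[d e]; apply/andP; split; lra.
Qed.

Lemma tcos_meas : rmeas tcos.
Proof.
apply: continuous_measurable_fun => x; apply: cvgB; first exact: cvg_cst.
apply: cvgM; first exact: cvg_cst.
apply: cvgB; last exact: cvg_cst.
have h : z - x0 @[z --> x] --> x - x0 by apply: cvgB; [exact: cvg_id|exact: cvg_cst].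
by apply: (cvg_comp _ _ h); exact: continuous_cos.
Qed.

(** Multiplication by a cosine shifts the index of the Fourier coefficients by
    one in both directions. *)
Lemma killed_mul w : killed w -> killed (fun x => tcos x * w x).
Proof.
move=> [mw w01 wk]; split.
- by apply: measurable_funM => //; exact: tcos_meas.
- move=> x; have /andP[a b] := w01 x; have /andP[d e] := tcos01 x.
  by rewrite mulr_ge0 //= mulr_ile1.
move=> k.
have ci k' : citg (fun x => (w x)%:C * (u x * ew (k'%:~R * x))) by exact: citg_wu.
pose a : R := 2^-1 + 4^-1 * c.
rewrite (_ : (fun x => _) = (fun x => a%:C * ((w x)%:C * (u x * ew (k%:~R * x))) +
   ((- 8^-1)%:C * ew (- x0) * ((w x)%:C * (u x * ew ((k + 1)%:~R * x))) +
    (- 8^-1)%:C * ew x0 * ((w x)%:C * (u x * ew ((k - 1)%:~R * x)))))).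
  rewrite cintD; [|exact: citgZ|by apply: citgD; exact: citgZ].
  rewrite cintD; try exact: citgZ.
  by rewrite !cintZ // !wk !mulr0 !addr0.
apply/funext => x.
have e0 : (tcos x)%:C = a%:C + (- 4^-1)%:C * (cos (x - x0))%:C.
  by rewrite -rmorphM -rmorphD /=; congr (_%:C); rewrite /tcos /a; field.
have e1 : (- 8^-1)%:C = (- 4^-1)%:C * 2^-1%:C :> R[i].
  by rewrite -rmorphM /=; congr (_%:C); field.
transitivity (a%:C * ((w x)%:C * (u x * ew (k%:~R * x))) +
   (- 4^-1)%:C * ((w x)%:C * (u x * ((cos (x - x0))%:C * ew (k%:~R * x))))).
  rewrite (rmorphM (real_complex R) (tcos x) (w x)) /= e0; move: ((cos _)%:C) (ew _) ((w x)%:C) (u x) (a%:C) ((- 4^-1)%:C) => *; ring.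
rewrite ew_cos e1.
move: (ew _) (ew _) (ew _) (ew _) (ew _) ((w x)%:C) (u x) (a%:C) ((- 4^-1)%:C) (2^-1%:C) => *; ring.
Qed.

Lemma killed_pow w n : killed w -> killed (fun x => tcos x ^+ n * w x).
Proof.
move=> kw; elim: n => [|n ih]; first by under eq_fun do rewrite expr0 mul1r.
by under eq_fun do rewrite exprS -mulrA; exact: killed_mul.
Qed.

Lemma killed_sub w n : killed w -> killed (fun x => (1 - tcos x ^+ n) * w x).
Proof.
move=> kw; have [mn n01 nk] := killed_pow n kw; have [mw w01 wk] := kw.
have E : (fun x => (1 - tcos x ^+ n) * w x) = (fun x => w x - tcos x ^+ n * w x).
  by apply/funext => x; ring.
split.
- by rewrite E; apply: measurable_funB.
- move=> x; have /andP[a b] := w01 x; have /andP[d e] := tcos01 x.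
  have h1 : 0 <= 1 - tcos x ^+ n by rewrite subr_ge0 exprn_ile1.
  rewrite mulr_ge0 //= mulr_ile1 // gerBl exprn_ge0 //.
- move=> k; rewrite (_ : (fun x => _) = (fun x => (w x)%:C * (u x * ew (k%:~R * x)) +
     (-1) * ((tcos x ^+ n * w x)%:C * (u x * ew (k%:~R * x))))); last first.
    apply/funext => x; move: (u x * ew _) (tcos x ^+ n) (w x) => p q r.
    by apply: eqcP; rewrite !cE; ring.
  rewrite cintD ?cintZ ?wk ?nk ?mulr0 ?addr0 //; try exact: citg_wu.
  by apply: citgZ; exact: citg_wu.
Qed.

Lemma killed_bump w n : killed w -> killed (fun x => bump (tcos x) n * w x).
Proof.
move=> kw; rewrite /bump; move: (n * 2 ^ n)%N => m.
elim: m => [|m ih]; first by under eq_fun do rewrite expr0 mul1r.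
by under eq_fun do rewrite exprS -mulrA; exact: killed_sub.
Qed.

Definition arc (x : R) : bool := c < cos (x - x0).

Lemma arcE x : arc x = (tcos x < 2^-1).
Proof. by rewrite /arc /tcos; apply/idP/idP => ?; lra. Qed.

(** Dominated convergence: the bumps of [tcos] tend to the indicator of the
    arc. *)
Lemma cint_arc : killed (fun=> 1) -> cint (fun x => (arc x)%:R%:C * u x) = 0.
Proof.
move=> k1; have k n := killed_bump n k1.
have [ur ui] := cu.
have K (v : R -> R) : itg v -> (forall n, rint (fun x => bump (tcos x) n * v x) = 0) ->
    rint (fun x => (arc x)%:R * v x) = 0.
  move=> iv hv; have mv := itg_meas iv.
  have mb n : rmeas (fun x => bump (tcos x) n).
    by have [m _ _] := k n; move: m; under eq_fun do rewrite mulr1.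
  have ma : rmeas (fun x => (arc x)%:R : R).
    rewrite (_ : (fun x => _) = \1_[set x | arc x]).
      apply: measurable_indic; rewrite -[X in measurable X]setTI.
      rewrite (_ : [set x | _] = tcos @^-1` `]-oo, 2^-1[).
        by apply: tcos_meas => //; exact: measurable_itv.
      by apply/seteqP; split => x /=; rewrite in_itv /= arcE.
    apply/funext => x; rewrite indicE; congr (_%:R); congr nat_of_bool.
    by apply/idP/idP => h; [rewrite inE|rewrite inE in h].
  have [_ h] : itg (fun x => (arc x)%:R * v x) /\
     rint (fun x => bump (tcos x) n * v x) @[n --> \oo] --> rint (fun x => (arc x)%:R * v x).
    apply: (@rdct R (fun n x => bump (tcos x) n * v x) _ _ _ _ (itg_norm iv)).
    - by move=> n; apply: measurable_funM; [exact: mb|exact: mv].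
    - by apply: measurable_funM; [exact: ma|exact: mv].
    - move=> n x; rewrite normrM; have /andP[b0 b1] := bump01 n (tcos01 x).
      by rewrite ger0_norm // ler_piMl.
    - apply: aeT => x; apply: cvgM; last exact: cvg_cst.
      by have := bump_cvg (tcos01 x); rewrite -arcE; case: (arc x).
  have h0 : rint (fun x => bump (tcos x) n * v x) @[n --> \oo] --> (0 : R).
    by under eq_fun do rewrite hv; exact: cvg_cst.
  exact: (cvg_unique _ h h0).
have E n : rint (fun x => bump (tcos x) n * Re (u x)) = 0 /\
     rint (fun x => bump (tcos x) n * Im (u x)) = 0.
  have [_ _ /(_ 0)] := k n.
  rewrite /cint => -[h1 h2]; split; [move: h1|move: h2] => <-; congr rint; apply/funext => x;
    by rewrite mul0r /ew cos0 sin0 !cE; ring.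
apply: eqcP; rewrite !cE.
  rewrite -[RHS](K _ ur) => [|n]; last by case: (E n).
  by congr rint; apply/funext => x; rewrite !cE; ring.
rewrite -[RHS](K _ ui) => [|n]; last by case: (E n).
by congr rint; apply/funext => x; rewrite !cE; ring.
Qed.

End Killing.

(** Within one period the arc around b / 2 with threshold cos (b / 2) is the
    interval from 0 to b, so arcs give access to primitives. *)
Lemma arc_itv (b x : R) : 0 < b <= 2 * pi -> 0 <= x < 2 * pi ->
  arc (b / 2) (cos (b / 2)) x = (0 < x < b).
Proof.
move=> /andP[b0 b2] /andP[x0 x2]; rewrite /arc; have pi0 := pi_gt0 R.
set d := b / 2; have dpi : d \in `[0, pi] by rewrite in_itv /= /d; apply/andP; split; lra.
have bd : b = 2 * d by rewrite /d; lra.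
case: (ltP 0 x) => x0' /=; last first.
  have -> : x = 0 by lra.
  by rewrite sub0r cosN ltxx.
case: (ltP x b) => xb.
- have [yd|yd] := ger0P (x - d).
    rewrite ltr_cos //; first by lra.
    by rewrite in_itv /=; apply/andP; split; move: dpi; rewrite in_itv /= => /andP[]; lra.
  rewrite -(cosN (x - d)) ltr_cos //; first by lra.
  by rewrite in_itv /=; apply/andP; split; move: dpi; rewrite in_itv /= => /andP[]; lra.
- apply/negbTE; have [yp|yp] := leP (x - d) pi.
    rewrite ltr_cos //; first by rewrite -leNgt; lra.
    by rewrite in_itv /=; apply/andP; split; lra.
  have -> : cos (x - d) = cos (2 * pi - (x - d)).
    rewrite -[LHS]cosN -(cosD2pi (- (x - d))); congr cos.
    by rewrite mulr2n mulrDl mul1r addrC.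
  rewrite ltr_cos //; first by rewrite -leNgt; lra.
  by rewrite in_itv /=; apply/andP; split; lra.
Qed.

(** By Lebesgue's differentiation theorem an integrable function is a.e. the
    derivative of its primitive. *)
Lemma primitive0 (U : R -> R) : itg U ->
  (forall y : R, rint (fun x => \1_(`]0, y]) x * U x) = 0) ->
  \forall x \ae mu, 0 < x -> U x = 0.
Proof.
move=> iU U0.
have lU : locally_integrable setT U.
  by apply: open_integrable_locally; [exact: openT|exact: iU].
apply: aeS (lebesgue_differentiation lU) => x hx x0.
have i1 : mu.-integrable [set` Interval (BRight (0 : R)) (BRight (x + 1))] (EFin \o U).
  by apply: (integrableS _ _ _ iU).
have xx : x < x + 1 by rewrite ltrDl.
have [_ <-] := FTC1_lebesgue_pt xx i1 (x0 : (BRight (0:R) < BRight x)%O) hx.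
rewrite (_ : (fun y => _) = cst 0); first by rewrite derive1_cst.
by apply/funext => y; have := U0 y; rewrite /rint /Rintegral -int_restrict.
Qed.

End TrigUniqueness.

(** * Series over the integers *)

Section IntSeries.
Context {R : realType}.
Local Open Scope complex_scope.
Local Notation Re := complex.Re.
Local Notation Im := complex.Im.
Implicit Types (a b : int -> R) (u v w : int -> R[i]).

(** The symmetric partial sums that define [sum_int]. *)
Definition psq a (n : nat) : R := \sum_(i < n.*2.+1) a (i%:Z - n%:Z).

Lemma psqS a n : psq a n.+1 = a (- (n.+1)%:Z) + psq a n + a (n.+1)%:Z.
Proof.
rewrite /psq doubleS big_ord_recl big_ord_recr /= addrA; congr (_ + _ + _).
- by congr a; lia.
- by apply: eq_bigr => i _; congr a; rewrite /fintype.bump leq0n; lia.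
- by congr a; rewrite /fintype.bump /=; lia.
Qed.

Lemma psqD a b n : psq (fun k => a k + b k) n = psq a n + psq b n.
Proof. exact: big_split. Qed.

Lemma psqZ (c : R) a n : psq (fun k => c * a k) n = c * psq a n.
Proof. by rewrite /psq mulr_sumr. Qed.

Lemma psq_le a b n : (forall k, a k <= b k) -> psq a n <= psq b n.
Proof. by move=> h; apply: ler_sum => i _; exact: h. Qed.

Lemma psq_ge0 a n : (forall k, 0 <= a k) -> 0 <= psq a n.
Proof. by move=> h; apply: sumr_ge0 => i _; exact: h. Qed.

Lemma psq_mono a m n : (forall k, 0 <= a k) -> (m <= n)%N -> psq a m <= psq a n.
Proof.
move=> h; elim: n => [|n ih]; first by rewrite leqn0 => /eqP ->.
rewrite leq_eqVlt => /orP[/eqP ->//|/ih le]; apply: le_trans le _; rewrite psqS.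
by have := h (- (n.+1)%:Z); have := h (n.+1)%:Z; lra.
Qed.

Definition bsum a := exists C : R, forall n, psq a n <= C.

Lemma bsum_cvg a : (forall k, 0 <= a k) -> bsum a -> cvg (psq a n @[n --> \oo]).
Proof.
move=> a0 [C aC]; apply: nondecreasing_is_cvgn.
  by move=> m n mn; exact: psq_mono.
by exists C => _ [n _ <-].
Qed.

Lemma bsum_le a b : (forall k, a k <= b k) -> bsum b -> bsum a.
Proof. by move=> h [C bC]; exists C => n; apply: le_trans (bC n); exact: psq_le. Qed.

Lemma bsumD a b : bsum a -> bsum b -> bsum (fun k => a k + b k).
Proof. by move=> [C aC] [D bD]; exists (C + D) => n; rewrite psqD lerD. Qed.

Lemma bsumZ (c : R) a : 0 <= c -> bsum a -> bsum (fun k => c * a k).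
Proof. by move=> c0 [C aC]; exists (c * C) => n; rewrite psqZ ler_wpM2l. Qed.

Definition asum a := bsum (fun k => `|a k|).

Lemma asum_cvg a : asum a -> cvg (psq a n @[n --> \oo]).
Proof.
move=> ha.
have -> : psq a = (fun n => psq (fun k => `|a k|) n - psq (fun k => `|a k| - a k) n).
  by apply/funext => n; rewrite -mulN1r -psqZ -psqD; apply: eq_bigr => i _; ring.
apply: is_cvgB; apply: bsum_cvg => //.
  by move=> k; have := ler_norm (a k); lra.
apply: (@bsum_le _ (fun k => 2 * `|a k|)) (bsumZ _ ha) => // k.
by have := ler_norm (- a k); rewrite normrN; lra.
Qed.

Lemma cvg_shift1 (f : nat -> R) (l : R) : f n @[n --> \oo] --> l -> f n.+1 @[n --> \oo] --> l.
Proof. by rewrite -(cvg_shiftS f). Qed.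

Lemma asum_tail a : asum a -> a n%:Z @[n --> \oo] --> (0 : R) /\ a (- n%:Z) @[n --> \oo] --> (0 : R).
Proof.
move=> ha; have c := bsum_cvg (fun k => normr_ge0 (a k)) ha.
have d : psq (fun k => `|a k|) n.+1 - psq (fun k => `|a k|) n @[n --> \oo] --> (0 : R).
  by rewrite -(subrr (limn (psq (fun k => `|a k|)))); apply: cvgB => //; apply: cvg_shift1.
suff S (s : nat -> R) : (forall n, `|s n.+1| <= psq (fun k => `|a k|) n.+1 - psq (fun k => `|a k|) n) ->
    s n @[n --> \oo] --> (0 : R).
  by split; apply: S => n; rewrite psqS; have := normr_ge0 (a (- (n.+1)%:Z)); have := normr_ge0 (a (n.+1)%:Z); lra.
move=> hs; rewrite -(cvg_shiftS s); apply/cvgrPdist_lt => e e0.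
move/cvgrPdist_lt : d => /(_ e e0)[N _ HN]; exists N => // n /= /HN; rewrite !sub0r !normrN => h.
by apply: le_lt_trans (hs n) (le_lt_trans (ler_norm _) h).
Qed.

Lemma asum_shift1 a : asum a -> asum (fun k => a (k + 1)).
Proof.
move=> [C aC]; exists C => n; apply: le_trans (aC n.+1); rewrite psqS.
rewrite {1}/psq big_ord_recr /= [X in _ <= _ + X + _]big_ord_recl /=.
rewrite (_ : (n.*2%:Z - n%:Z + 1) = (n.+1)%:Z); last lia.
have -> : \sum_(i < n.*2) `|a (i%:Z - n%:Z + 1)| = \sum_(i < n.*2) `|a ((fintype.bump 0 i)%:Z - n%:Z)|.
  by apply: eq_bigr => i _; congr (`|a _|); rewrite /fintype.bump; lia.
by have := normr_ge0 (a (- (n.+1)%:Z)); have := normr_ge0 (a (0%:Z - n%:Z)); lra.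
Qed.

Lemma asum_shiftN1 a : asum a -> asum (fun k => a (k - 1)).
Proof.
move=> [C aC]; exists C => n; apply: le_trans (aC n.+1); rewrite psqS.
rewrite {1}/psq big_ord_recl /= [X in _ <= _ + X + _]big_ord_recr /=.
rewrite (_ : (0%:Z - n%:Z - 1) = - (n.+1)%:Z); last lia.
have -> : \sum_(i < n.*2) `|a ((fintype.bump 0 i)%:Z - n%:Z - 1)| = \sum_(i < n.*2) `|a (i%:Z - n%:Z)|.
  by apply: eq_bigr => i _; congr (`|a _|); rewrite /fintype.bump; lia.
by have := normr_ge0 (a ((n.*2)%:Z - n%:Z)); have := normr_ge0 (a (n.+1)%:Z); lra.
Qed.

(** A shift of the index changes a symmetric partial sum by two terms of the
    tails. *)
Lemma lim_shift1 a : asum a -> limn (psq (fun k => a (k + 1))) = limn (psq a).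
Proof.
move=> ha; have [t1 t2] := asum_tail ha.
apply/cvg_lim => //.
have E n : psq (fun k => a (k + 1)) n = psq a n + (a (n.+1)%:Z - a (- n%:Z)).
  rewrite /psq big_ord_recr /= [X in _ = X + _]big_ord_recl /=.
  rewrite (_ : (n.*2%:Z - n%:Z + 1) = (n.+1)%:Z); last lia.
  rewrite (_ : 0%:Z - n%:Z = - n%:Z); last lia.
  have -> : \sum_(i < n.*2) a (i%:Z - n%:Z + 1) = \sum_(i < n.*2) a ((fintype.bump 0 i)%:Z - n%:Z).
    by apply: eq_bigr => i _; congr (a _); rewrite /fintype.bump; lia.
  ring.
apply: cvg_congr (fun n => esym (E n)) _; rewrite -[X in _ --> X]addr0; apply: cvgD; first exact: asum_cvg.
by rewrite -(subrr (0 : R)); apply: cvgB => //; exact: (cvg_shift1 (f := fun n : nat => a n%:Z)).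
Qed.

Lemma asum_shift a (m : int) : asum a ->
  asum (fun k => a (k + m)) /\ limn (psq (fun k => a (k + m))) = limn (psq a).
Proof.
move=> ha; case: m => m.
  elim: m => [|m [h1 h2]].
    have -> : (fun k => a (k + 0%:Z)) = a by apply/funext => k; rewrite addr0.
    by split.
  have E : (fun k => a (k + m.+1%:Z)) = (fun k => a ((k + 1) + m%:Z)).
    by apply/funext => k; congr a; lia.
  by rewrite E; split; [exact: (asum_shift1 h1)|rewrite (lim_shift1 h1)].
elim: m => [|m [h1 h2]].
  have h := asum_shiftN1 ha; split; first exact: h.
  by rewrite -(lim_shift1 h); congr (limn (psq _)); apply/funext => k; congr a; lia.
have E : (fun k => a (k + Negz m.+1)) = (fun k => a ((k - 1) + Negz m)).
  by apply/funext => k; congr a; lia.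
have h := asum_shiftN1 h1; rewrite E; split; first exact: h.
by rewrite -h2 -(lim_shift1 h); congr (limn (psq _)); apply/funext => k; congr a; lia.
Qed.

Lemma bsum_shift a (m : int) : (forall k, 0 <= a k) -> bsum a -> bsum (fun k => a (k + m)).
Proof.
move=> a0 ha; have e b : (forall k, 0 <= b k) -> (fun k => `|b k|) = b.
  by move=> b0; apply/funext => k; rewrite ger0_norm.
have : asum a by rewrite /asum e.
by move=> /(asum_shift m)[]; rewrite /asum e.
Qed.

Definition csummable u := asum (fun k => Re (u k)) /\ asum (fun k => Im (u k)).

Lemma sum_intE u : sum_int u = limn (psq (fun k => Re (u k))) +i* limn (psq (fun k => Im (u k))).
Proof. by []. Qed.

Lemma sum_int_cvg u : csummable u -> psq (fun k => Re (u k)) n @[n --> \oo] --> Re (sum_int u) /\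
  psq (fun k => Im (u k)) n @[n --> \oo] --> Im (sum_int u).
Proof. by move=> [h1 h2]; split; exact: asum_cvg. Qed.

Lemma sum_int_lim u (l : R[i]) : psq (fun k => Re (u k)) n @[n --> \oo] --> Re l ->
  psq (fun k => Im (u k)) n @[n --> \oo] --> Im l -> sum_int u = l.
Proof.
by move=> h1 h2; rewrite sum_intE; case: l h1 h2 => x y /= h1 h2; congr (_ +i* _); exact/cvg_lim.
Qed.

Lemma asumD a b : asum a -> asum b -> asum (fun k => a k + b k).
Proof. by move=> ha hb; apply: bsum_le (bsumD ha hb) => k; exact: ler_normD. Qed.

Lemma asumZ (c : R) a : asum a -> asum (fun k => c * a k).
Proof.
by move=> ha; apply: bsum_le (bsumZ (normr_ge0 c) ha) => k; rewrite normrM.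
Qed.

Lemma csummableD u v : csummable u -> csummable v -> csummable (fun k => u k + v k).
Proof.
move=> [a b] [c d]; split; [have := asumD a c|have := asumD b d]; congr asum;
  by apply/funext => k; rewrite !cE.
Qed.

Lemma csummableZ (c : R[i]) u : csummable u -> csummable (fun k => c * u k).
Proof.
move=> [a b]; split.
  have := asumD (asumZ (Re c) a) (asumZ (- Im c) b); congr asum.
  by apply/funext => k; rewrite !cE; ring.
have := asumD (asumZ (Re c) b) (asumZ (Im c) a); congr asum.
by apply/funext => k; rewrite !cE; ring.
Qed.

Lemma sum_intD u v : csummable u -> csummable v ->
  sum_int (fun k => u k + v k) = sum_int u + sum_int v.
Proof.
move=> /sum_int_cvg[a b] /sum_int_cvg[c d]; apply: sum_int_lim; rewrite !cE.
  by apply: cvg_congr (cvgD a c) => n; rewrite -psqD; apply: eq_bigr => i _; rewrite !cE.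
by apply: cvg_congr (cvgD b d) => n; rewrite -psqD; apply: eq_bigr => i _; rewrite !cE.
Qed.

Lemma sum_intZ (c : R[i]) u : csummable u -> sum_int (fun k => c * u k) = c * sum_int u.
Proof.
move=> /sum_int_cvg[a b]; apply: sum_int_lim; rewrite !cE.
  apply: cvg_congr (cvgB (cvgM (cvg_cst (Re c)) a) (cvgM (cvg_cst (Im c)) b)) => n.
  transitivity (Re c * psq (fun k => Re (u k)) n - Im c * psq (fun k => Im (u k)) n) => //.
  by rewrite -!psqZ -mulN1r -psqZ -psqD; apply: eq_bigr => i _; rewrite !cE; ring.
apply: cvg_congr (cvgD (cvgM (cvg_cst (Re c)) b) (cvgM (cvg_cst (Im c)) a)) => n.
transitivity (Re c * psq (fun k => Im (u k)) n + Im c * psq (fun k => Re (u k)) n) => //.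
by rewrite -!psqZ -psqD; apply: eq_bigr => i _; rewrite !cE; ring.
Qed.

Lemma sum_int_shift u (m : int) : csummable u ->
  sum_int (fun k => u (k + m)) = sum_int u.
Proof.
by move=> [/(asum_shift m)[_ a] /(asum_shift m)[_ b]]; rewrite !sum_intE a b.
Qed.

Lemma psq0 n : psq (fun=> 0) n = 0.
Proof. by rewrite /psq big1. Qed.

Lemma sum_int0 : sum_int (fun=> 0) = 0 :> R[i].
Proof.
apply: sum_int_lim; rewrite !cE; apply: (@cvg_congr _ (fun=> 0)); try exact: cvg_cst.
  by move=> n; rewrite psq0.
by move=> n; rewrite psq0.
Qed.

Lemma csummable0 : csummable (fun=> 0).
Proof. by split; exists 0 => n; rewrite (_ : (fun _ => _) = (fun=> 0)) ?psq0 //; apply/funext => k; rewrite !cE normr0. Qed.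

Lemma sum_int_sum (J : Type) (s : seq J) (u : J -> int -> R[i]) :
  (forall j, csummable (u j)) -> csummable (fun k => \sum_(j <- s) u j k) /\
  sum_int (fun k => \sum_(j <- s) u j k) = \sum_(j <- s) sum_int (u j).
Proof.
move=> hu; elim: s => [|j s [ih1 ih2]].
  by under eq_fun do rewrite big_nil; rewrite big_nil sum_int0; split => //; exact: csummable0.
under eq_fun do rewrite big_cons; rewrite big_cons -ih2 sum_intD //; split => //.
exact: csummableD.
Qed.

Definition ell2 u := bsum (fun k => sqc (u k)).

Lemma ell2_dot u v : ell2 u -> ell2 v -> csummable (fun k => u k * (v k)^*).
Proof.
move=> hu hv; split; apply: bsum_le (bsumD hu hv) => k;
  case: (u k) => x1 x2; case: (v k) => y1 y2; rewrite /sqc !cE ler_norml;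
  move: (sqr_ge0 (x1 + y1)) (sqr_ge0 (x1 - y1)) (sqr_ge0 (x2 + y2)) (sqr_ge0 (x2 - y2));
  move: (sqr_ge0 (x1 + y2)) (sqr_ge0 (x1 - y2)) (sqr_ge0 (x2 + y1)) (sqr_ge0 (x2 - y1)) => *;
  apply/andP; split; lra.
Qed.

Lemma ell2_shift u (m : int) : ell2 u -> ell2 (fun k => u (k + m)).
Proof. by apply: (bsum_shift (a := fun k => sqc (u k))) => k; rewrite /sqc addr_ge0 // sqr_ge0. Qed.

Lemma ell2_eq0 u : ell2 u -> sum_int (fun k => u k * (u k)^*) = 0 -> forall k, u k = 0.
Proof.
move=> hu h0 k; have [c _] := sum_int_cvg (ell2_dot hu hu).
have E : (fun k => Re (u k * (u k)^*)) = (fun k => sqc (u k)).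
  by apply/funext => j; rewrite /sqc !cE; ring.
have s0 j : 0 <= sqc (u j) by rewrite /sqc addr_ge0 // sqr_ge0.
rewrite h0 E /= in c; apply: sqc_eq0; apply/eqP; rewrite eq_le s0 andbT.
have le n : psq (fun k => sqc (u k)) n <= 0.
  rewrite -(cvg_lim _ c) //; apply: nondecreasing_cvgn_le; last by apply/cvg_ex; exists 0.
  by move=> i j ij; exact: psq_mono.
apply: le_trans (le `|k|%N); rewrite /psq.
have ik : (absz (k + Posz (absz k))%R < (absz k).*2.+1)%N by lia.
rewrite (bigD1 (Ordinal ik)) //= (_ : Posz (absz (k + Posz (absz k))) - Posz (absz k) = k); last lia.
by rewrite lerDl; apply: sumr_ge0.
Qed.

End IntSeries.

(** * Periodization *)

Section Periodization.
Context {R : realType}.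
Local Notation mu := (@lebesgue_measure R).
Local Open Scope complex_scope.
Local Notation tau := (2 * pi : R).
Implicit Types (f g h : R -> R[i]) (u v w : R -> R).

Lemma tau_gt0 : 0 < tau.
Proof. by rewrite mulr_gt0 // pi_gt0. Qed.

(** The values of [u] along the fibre of [x] modulo 2 pi. *)
Definition fib (T : Type) (u : R -> T) (x : R) : int -> T := fun k => u (x + tau * k%:~R).

Definition cell : R -> R := \1_(`[0, tau[).

Lemma cellE x : cell x = ((0 <= x) && (x < tau))%:R.
Proof.
rewrite /cell indicE; congr (nat_of_bool _)%:R; apply/idP/idP => h.
  by rewrite inE /= in_itv in h.
by rewrite inE /= in_itv.
Qed.

Lemma cell_meas : rmeas cell.
Proof. by apply: measurable_indic; exact: measurable_itv. Qed.

Lemma cell01 x : 0 <= cell x <= 1.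
Proof. by rewrite cellE ler0n lern1 leq_b1. Qed.

Lemma itg_bM u w : rmeas w -> (forall x, `|w x| <= 1) -> itg u -> itg (fun x => w x * u x).
Proof.
move=> mw w1 iu; have mu_ := itg_meas iu; apply: (itg_le _ (itg_norm iu)).
  by apply: measurable_funM; [exact: mw|exact: mu_].
by move=> x; rewrite normrM ler_piMl.
Qed.

Lemma cell_itg u (c : R) : itg u -> itg (fun x => cell (x + c) * u x).
Proof.
apply: itg_bM => [|x]; last by have /andP[a b] := cell01 (x + c); rewrite ger0_norm.
have := measurableT_comp cell_meas (meas_affine 1 c).
by under [X in measurable_fun _ X]eq_fun do rewrite /= mul1r.
Qed.

Definition tile (n : nat) (x : R) : R := psq (fun k => cell (x - tau * k%:~R)) n.

Lemma cellP x : exists m : int, forall k : int, cell (x - tau * k%:~R) = (k == m)%:R.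
Proof.
have t0 := tau_gt0; exists (Num.floor (x / tau)) => k; rewrite cellE; congr (nat_of_bool _)%:R.
rewrite subr_ge0 ltrBlDr.
have -> : (tau * k%:~R <= x) = (k <= Num.floor (x / tau)).
  by rewrite floor_ge_int ler_pdivlMr // mulrC.
have -> : (x < tau + tau * k%:~R) = (Num.floor (x / tau) < k + 1).
  by rewrite floor_lt_int ltr_pdivrMr //; congr (x < _); rewrite intrD; ring.
by rewrite eq_le; congr (_ && _); lia.
Qed.

Lemma tileE x : exists m : int, forall n, tile n x = (absz m <= n)%N%:R.
Proof.
have [m hm] := cellP x; exists m => n; rewrite /tile /psq.
under eq_bigr do rewrite hm.
case: leqP => mn.
  have im : (absz (m + n%:Z)%R < n.*2.+1)%N by lia.
  rewrite (bigD1 (Ordinal im)) //= big1 ?addr0.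
    by rewrite (_ : (_ == _) = true) //; apply/eqP; lia.
  move=> i /eqP ni; rewrite (_ : (_ == _) = false) //; apply/eqP => h; apply: ni.
  by apply: val_inj => /=; lia.
rewrite big1 // => i _; rewrite (_ : (_ == _) = false) //; apply/eqP => h.
by have := ltn_ord i; lia.
Qed.

Lemma tile01 n x : `|tile n x| <= 1.
Proof. by have [m ->] := tileE x; case: leqP; rewrite ?normr1 ?normr0. Qed.

Lemma tile_cvg x : tile n x @[n --> \oo] --> (1 : R).
Proof.
have [m hm] := tileE x; apply/cvgrPdist_lt => e e0; exists (absz m) => // n /= mn.
by rewrite hm mn subrr normr0.
Qed.

Lemma itg_fib u (k : int) : itg u -> itg (fun x => fib u x k).
Proof.
move=> iu; have := itg_affine (tau * k%:~R) (oner_neq0 R) iu.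
by under eq_fun do rewrite mul1r.
Qed.

Lemma rint_cell_fib u n : itg u -> itg (fun x => cell x * psq (fib u x) n) /\
  rint (fun x => cell x * psq (fib u x) n) = rint (fun x => tile n x * u x).
Proof.
move=> iu.
have E1 : (fun x => cell x * psq (fib u x) n) =
   fun x => \sum_(i < n.*2.+1) cell x * fib u x (i%:Z - n%:Z).
  by apply/funext => x; rewrite /psq mulr_sumr.
have E2 : (fun x => tile n x * u x) =
   fun x => \sum_(i < n.*2.+1) cell (x - tau * (i%:Z - n%:Z)%:~R) * u x.
  by apply/funext => x; rewrite /tile /psq mulr_suml.
have i1 (k : int) : itg (fun x => cell x * fib u x k).
  by have := cell_itg 0 (itg_fib k iu); under eq_fun do rewrite addr0.
split; first by rewrite E1; apply: itg_sum => i; exact: i1.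
rewrite E1 E2 !rint_sum; [|by move=> i; apply: cell_itg|by move=> i; exact: i1].
apply: eq_bigr => i _; move: (i%:Z - n%:Z) => k.
rewrite [RHS](rint_affine (tau * k%:~R) (oner_neq0 R)); last exact: cell_itg.
rewrite normr1 mul1r; congr rint; apply/funext => x; rewrite mul1r /fib.
by rewrite addrK.
Qed.

Lemma tile_meas n : rmeas (tile n).
Proof.
rewrite /tile /psq; apply: measurable_sum => i.
have := measurableT_comp cell_meas (meas_affine 1 (- (tau * (i%:Z - n%:Z)%:~R))).
by under [X in measurable_fun _ X]eq_fun do rewrite /= mul1r.
Qed.

Lemma rint_cell_fib_cvg u : itg u ->
  rint (fun x => cell x * psq (fib u x) n) @[n --> \oo] --> rint u.
Proof.
move=> iu; apply: cvg_congr (fun n => esym (rint_cell_fib n iu).2) _.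
have mu_ := itg_meas iu.
have [] // := @rdct R (fun n x => tile n x * u x) u _ _ mu_ (itg_norm iu).
- by move=> n; apply: measurable_funM; [exact: tile_meas|exact: mu_].
- by move=> n x; rewrite normrM ler_piMl // tile01.
- apply: aeT => x; rewrite -[X in _ --> X]mul1r.
  by apply: cvgM; [exact: tile_cvg|exact: cvg_cst].
Qed.

(** Each translate of the period cell is moved to the cell itself. Monotone
    convergence gives the sum over the fibres, and dominated convergence along
    the tiles identifies its integral. *)
Lemma periodize_ge0 u : itg u -> (forall x, 0 <= u x) -> exists U, [/\ itg U,
  rint U = rint u & \forall x \ae mu, cell x * psq (fib u x) n @[n --> \oo] --> U x].
Proof.
move=> iu u0.
have f0 x k : 0 <= fib u x k by exact: u0.
have c0 x : 0 <= cell x by have /andP[] := cell01 x.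
pose F n x := cell x * psq (fib u x) n.
have iF n : itg (F n) := (rint_cell_fib n iu).1.
have mono n x : F n x <= F n.+1 x by rewrite ler_wpM2l // psq_mono.
pose s n x := if n is n'.+1 then F n'.+1 x - F n' x else F 0%N x.
have sE n x : \sum_(i < n.+1) s i x = F n x.
  elim: n => [|n ih]; first by rewrite big_ord_recr big_ord0 /= add0r.
  by rewrite big_ord_recr /= ih addrC subrK.
have is_ n : itg (s n) by case: n => [|n]; [exact: iF|apply: itgB; exact: iF].
have s0 n x : 0 <= s n x.
  by case: n => [|n] /=; [rewrite mulr_ge0 ?psq_ge0|rewrite subr_ge0].
have cle n x : tile n x <= 1 by apply: le_trans (ler_norm _) (tile01 n x).
have Fle n : rint (F n) <= rint u.
  rewrite (rint_cell_fib n iu).2; apply: rint_le => //.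
    by apply: itg_bM iu => //; [exact: tile_meas|exact: tile01].
  by move=> x; rewrite ler_piMl.
have sums n : \sum_(i < n) rint (s i) <= rint u.
  case: n => [|n]; first by rewrite big_ord0 rint_ge0.
  by rewrite -rint_sum // (_ : (fun x => _) = F n) //; apply/funext => x; rewrite sE.
have [U [iU leU aeU]] := itg_series is_ s0 sums.
have aeF : \forall x \ae mu, F n x @[n --> \oo] --> U x.
  apply: aeS aeU => x h; have := cvg_shift1 h.
  by apply: cvg_congr => n; exact: sE.
exists U; split=> //; apply/eqP; rewrite eq_le leU /=.
have FU n : rint (F n) <= rint U.
  have h : (fun x => Num.max (F n x) (U x)) = U %[ae mu].
    apply: aeS aeF => x h _; apply/max_idPr.
    rewrite -(cvg_lim _ h) //; apply: nondecreasing_cvgn_le; last by apply/cvg_ex; exists (U x).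
    by apply/nondecreasing_seqP => m; exact: mono.
  have mU := itg_meas iU; have mF := itg_meas (iF n).
  have mM : rmeas (fun x => Num.max (F n x) (U x)) by exact: measurable_maxr.
  rewrite -(rint_ae mM mU h); apply: rint_le => //.
    by apply: itg_ae mM _ iU; apply: aeS h => x hx Dx; rewrite hx.
  by move=> x; rewrite le_max lexx.
rewrite -(cvg_lim _ (rint_cell_fib_cvg iu)) //; apply: limr_le.
  by apply/cvg_ex; exists (rint u); exact: rint_cell_fib_cvg.
by apply: nearW => n; exact: FU.
Qed.

(** The difference of the periodizations of |u| and of |u| - u, both
    nonnegative. *)
Lemma periodize u : itg u -> exists U, [/\ itg U,
  rint U = rint u & \forall x \ae mu, cell x * psq (fib u x) n @[n --> \oo] --> U x].
Proof.
move=> iu; have in_ := itg_norm iu.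
have ib : itg (fun x => `|u x| - u x) by exact: itgB.
have [|U1 [i1 r1 a1]] := periodize_ge0 in_; first by move=> x.
have [|U2 [i2 r2 a2]] := periodize_ge0 ib; first by move=> x; have := ler_norm (u x); lra.
exists (fun x => U1 x - U2 x); split; first exact: itgB.
  by rewrite rintB // r1 r2 rintB //; ring.
apply: aeS (aeI a1 a2) => x [h1 h2]; apply: cvg_congr (cvgB h1 h2) => n.
transitivity (cell x * psq (fib (fun y => `|u y|) x) n -
  cell x * psq (fib (fun y => `|u y| - u y) x) n) => //.
rewrite -mulrBr /psq -sumrB; congr (_ * _); apply: eq_bigr => i _.
by rewrite /fib; ring.
Qed.

(** Every point is moved into the period cell by one of countably many
    translations. *)
Lemma ae_periodic (P : R -> Prop) : (forall x (k : int), P x -> P (x + tau * k%:~R)) ->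
  (\forall x \ae mu, 0 < x < tau -> P x) -> \forall x \ae mu, P x.
Proof.
move=> hP hae.
have h0 : \forall x \ae mu, 0 <= x < tau -> P x.
  apply: aeS (aeI hae (ae_neq0 (R := R))) => x [h x0] /andP[a b]; apply: h.
  by rewrite lt_neqAle eq_sym x0 a b.
have h (k : int) : \forall x \ae mu, 0 <= x + tau * k%:~R < tau -> P (x + tau * k%:~R).
  have := ae_affine (tau * k%:~R) (oner_neq0 R) h0.
  by apply: aeS => x; rewrite mul1r.
apply: aeS (aeI (aeA (fun n => h n%:Z)) (aeA (fun n => h (- n%:Z)))) => x [hp hn].
have [m hm] := cellP x.
have cm : 0 <= x - tau * m%:~R < tau.
  by have := hm m; rewrite cellE eqxx => /eqP; rewrite eqr_nat; case: (_ && _).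
have -> : x = x + tau * (- m)%:~R + tau * m%:~R by rewrite intrN; ring.
apply: hP; move: cm; rewrite -mulrN -intrN; case: m {hm} => m.
  by move=> /hn.
by rewrite NegzE opprK => /hp.
Qed.

End Periodization.

(** * Brackets *)

Section Bracket.
Context {R : realType}.
Local Notation mu := (@lebesgue_measure R).
Local Open Scope complex_scope.
Local Notation Re := complex.Re.
Local Notation Im := complex.Im.
Local Notation tau := (2 * pi : R).
Implicit Types (f g h : R -> R[i]) (u v w : R -> R).

Lemma fib_shift (T : Type) (u : R -> T) x (m : int) : fib u (x + tau * m%:~R) = (fun k => fib u x (k + m)).
Proof. by apply/funext => k; rewrite /fib; congr u; rewrite intrD; ring. Qed.

Lemma ae_fib (P : R -> Prop) : (\forall x \ae mu, P x) ->
  \forall x \ae mu, forall k : int, P (x + tau * k%:~R).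
Proof.
move=> h.
have hk (k : int) : \forall x \ae mu, P (x + tau * k%:~R).
  by have := ae_affine (tau * k%:~R) (oner_neq0 R) h; apply: aeS => x; rewrite mul1r.
apply: aeS (aeI (aeA (fun n => hk n%:Z)) (aeA (fun n => hk (- n.+1%:Z)))) => x [a b] [] n //.
by rewrite NegzE.
Qed.

Lemma ell2_fib f : L2 f -> \forall x \ae mu, ell2 (fib f x).
Proof.
move=> lf; have i2 := L2_sqc lf.
have [U [_ _ hU]] := periodize i2.
apply: ae_periodic => [x k|]; first by rewrite fib_shift; exact: ell2_shift.
apply: aeS hU => x h /andP[x0 x1].
have s0 z : 0 <= sqc z :> R by rewrite /sqc addr_ge0 // sqr_ge0.
exists (U x) => n; rewrite -(cvg_lim _ h) //.
have c1 : cell x = 1 by rewrite cellE (ltW x0) x1.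
have -> : psq (fun k => sqc (fib f x k)) n = cell x * psq (fib (fun y => sqc (f y)) x) n.
  by rewrite c1 mul1r.
apply: (nondecreasing_cvgn_le (u_ := fun n => cell x * psq (fib (fun y => sqc (f y)) x) n)).
  by move=> i j ij; rewrite c1 !mul1r; apply: psq_mono => // k; exact: s0.
by apply/cvg_ex; exists (U x).
Qed.

Lemma bracketE f g x : bracket f g x = sum_int (fun k => fib f x k * (fib g x k)^*).
Proof. by []. Qed.

Lemma bracket_per f g x (m : int) : ell2 (fib f x) -> ell2 (fib g x) ->
  bracket f g (x + tau * m%:~R) = bracket f g x.
Proof.
move=> hf hg; rewrite !bracketE !fib_shift.
exact: (sum_int_shift m (ell2_dot hf hg)).
Qed.

Lemma ewD2pi (x : R) (k m : int) : ew (k%:~R * (x + tau * m%:~R)) = ew (k%:~R * x) :> R[i].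
Proof.
have e1 (n : nat) : ew (tau * n%:R) = 1 :> R[i].
  elim: n => [|n ih]; first by rewrite mulr0 /ew cos0 sin0; apply: eqcP; rewrite !cE; ring.
  rewrite -[n.+1%:R]natr1 mulrDr mulr1 ewD ih mul1r /ew.
  have -> : tau = 0 + pi *+ 2 by rewrite add0r mulr2n mulrDl mul1r.
  by rewrite cosD2pi sinD2pi cos0 sin0; apply: eqcP; rewrite !cE; ring.
have e2 (n : int) : ew (tau * n%:~R) = 1 :> R[i].
  case: n => n; first exact: e1.
  by rewrite NegzE intrN mulrN ewN e1; apply: eqcP; rewrite !cE; ring.
have -> : k%:~R * (x + tau * m%:~R) = k%:~R * x + tau * (k * m)%:~R by rewrite intrM; ring.
by rewrite ewD e2 mulr1.
Qed.

(** The exponential is constant along fibres ([ewD2pi]), so periodizing the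
    integrand of the inner product leaves a multiple of the bracket. *)
Lemma dot_bracket0 f g : L2 f -> L2 g -> (\forall x \ae mu, bracket f g x = 0) ->
  forall k : int, L2dot (fun x => ew (k%:~R * x) * f x) g = 0.
Proof.
move=> lf lg h0 k; have le := L2_ewM k%:~R lf.
rewrite dotE; have [cr ci] := citg_dot le lg; rewrite /cint.
have [U [iU rU aU]] := periodize cr; have [V [iV rV aV]] := periodize ci.
have good := aeI h0 (aeI (ell2_fib lf) (ell2_fib lg)).
have lim x : bracket f g x = 0 -> ell2 (fib f x) -> ell2 (fib g x) ->
   psq (fib (fun y => Re (ew (k%:~R * y) * f y * (g y)^*)) x) n @[n --> \oo] --> (0 : R) /\
   psq (fib (fun y => Im (ew (k%:~R * y) * f y * (g y)^*)) x) n @[n --> \oo] --> (0 : R).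
  move=> b0 ef eg; have cs := ell2_dot ef eg.
  have := sum_int_cvg (csummableZ (ew (k%:~R * x)) cs).
  rewrite sum_intZ // -bracketE b0 mulr0 /= => -[a b].
  split; [apply: cvg_congr a => n|apply: cvg_congr b => n]; apply: eq_bigr => i _;
    by rewrite /fib ewD2pi mulrA.
have cl (a : R) (s : nat -> R) l : s n @[n --> \oo] --> (0 : R) -> a * s n @[n --> \oo] --> l -> l = 0.
  by move=> s0 h; apply: (cvg_unique _ h) => //; rewrite -(mulr0 a); apply: cvgM => //; exact: cvg_cst.
have z0 : rint (fun=> 0) = 0 :> R by exact: rint0.
have U0 : rint U = 0.
  rewrite -z0; apply: rint_ae; [exact: itg_meas|exact: measurable_cst|].
  by apply: aeS (aeI aU good) => x [h [b0 [ef eg]]] _; have [s0 _] := lim x b0 ef eg; exact: cl s0 h.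
have V0 : rint V = 0.
  rewrite -z0; apply: rint_ae; [exact: itg_meas|exact: measurable_cst|].
  by apply: aeS (aeI aV good) => x [h [b0 [ef eg]]] _; have [_ s0] := lim x b0 ef eg; exact: cl s0 h.
by rewrite -rU -rV U0 V0.
Qed.

Lemma arc_per (x0 c x : R) (k : int) : arc x0 c (x + tau * k%:~R) = arc x0 c x.
Proof.
rewrite /arc; congr (_ < _).
have := ewD2pi (x - x0) 1 k; rewrite !mul1r /ew => -[].
by rewrite addrAC.
Qed.

Lemma arc_meas (x0 c : R) : rmeas (fun x => (arc x0 c x)%:R : R).
Proof.
rewrite (_ : (fun x => _) = \1_[set x | arc x0 c x]).
  apply: measurable_indic; rewrite -[X in measurable X]setTI.
  rewrite (_ : [set x | _] = (fun x => cos (x - x0)) @^-1` `]c, +oo[).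
    have h : rmeas (fun x => cos (x - x0)).
      apply: continuous_measurable_fun => x.
      have h : z - x0 @[z --> x] --> x - x0 by apply: cvgB; [exact: cvg_id|exact: cvg_cst].
      by apply: (cvg_comp _ _ h); exact: continuous_cos.
    by apply: h => //; exact: measurable_itv.
  by apply/seteqP; split => x /=; rewrite in_itv /= andbT.
apply/funext => x; rewrite indicE; congr (_%:R); congr nat_of_bool.
by apply/idP/idP => h; [rewrite inE|rewrite inE in h].
Qed.

(** A periodic weight passes through the periodization, so the integral of [U]
    over an interval of the period cell is an integral of [v] over a periodic
    arc. *)
Lemma arcs_periodize0 v U : itg v -> itg U ->
  (\forall x \ae mu, cell x * psq (fib v x) n @[n --> \oo] --> U x) ->
  (forall x0 c : R, `|c| <= 1 -> rint (fun x => (arc x0 c x)%:R * v x) = 0) ->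
  \forall x \ae mu, 0 < x -> U x = 0.
Proof.
move=> iv iU aU hv; apply: primitive0 => // y.
have tau0 : 0 < tau by exact: tau_gt0.
have outU : \forall x \ae mu, ~~ ((0 <= x) && (x < tau)) -> U x = 0.
  apply: aeS aU => x h /negbTE hx; apply: (cvg_unique _ h) => //.
  rewrite cellE hx; apply: (@cvg_congr _ (fun=> 0)); last exact: cvg_cst.
  by move=> n; rewrite mul0r.
have mU := itg_meas iU.
have mind z : rmeas (\1_(`]0, z]) : R -> R) by apply: measurable_indic; exact: measurable_itv.
have miU z : rmeas (fun x => \1_(`]0, z]) x * U x).
  by apply: measurable_funM; [exact: mind|exact: mU].
have key b : 0 < b <= tau -> rint (fun x => \1_(`]0, b]) x * U x) = 0.
  move=> b0; pose a x : R := (arc (b / 2) (cos (b / 2)) x)%:R.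
  have ma : rmeas a by exact: arc_meas.
  have a1 x : `|a x| <= 1 by rewrite /a; case: arc; rewrite ?normr1 ?normr0.
  have iav := itg_bM ma a1 iv.
  have [U' [iU' rU' aU']] := periodize iav.
  transitivity (rint U'); last first.
    by rewrite rU'; apply: hv; rewrite ler_norml cos_geN1 cos_le1.
  apply: rint_ae; [exact: miU|exact: itg_meas|].
  (* the arc and the half-open interval differ at the endpoint [b] *)
  have bne : \forall x \ae mu, x != b.
    have := ae_affine (- b) (oner_neq0 R) (ae_neq0 (R := R)).
    by apply: aeS => x; rewrite mul1r subr_eq0.
  apply: aeS (aeI bne (aeI aU (aeI aU' outU))) => x [xb [h [h' ho]]] _.
  have -> : U' x = a x * U x.
    have h2 : a x * (cell x * psq (fib v x) n) @[n --> \oo] --> a x * U x.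
      by apply: cvgM => //; exact: cvg_cst.
    apply: (cvg_unique _ h') => //; apply: cvg_congr h2 => n.
    rewrite mulrCA; congr (_ * _); rewrite -psqZ; apply: eq_bigr => i _.
    by rewrite /fib /a arc_per.
  have [hx|/ho ->] := boolP ((0 <= x) && (x < tau)); last by rewrite !mulr0.
  congr (_ * _); rewrite /a arc_itv // indicE; congr (nat_of_bool _)%:R.
  apply/idP/idP; first by rewrite inE /= in_itv /= => /andP[-> le]; rewrite lt_neqAle xb le.
  by move=> /andP[p q]; rewrite inE /= in_itv /= p (ltW q).
have [y0|y0] := leP y 0.
  rewrite (_ : (fun x => _) = (fun=> 0)) ?rint0 //; apply/funext => x.
  rewrite indicE; case: (boolP (x \in _)); last by rewrite mul0r.
  by rewrite inE /= in_itv /= => /andP[p q]; have := lt_le_trans p q; rewrite ltNge y0.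
have [yt|yt] := leP y tau; first by apply: key; rewrite y0.
rewrite -[RHS](key tau); last by rewrite tau0 lexx.
apply: (rint_ae (miU y) (miU tau)).
apply: aeS outU => x ho _; have [hx|/ho ->] := boolP ((0 <= x) && (x < tau)); last by rewrite !mulr0.
have /andP[p q] := hx; congr (_ * _); rewrite !indicE; congr (nat_of_bool _)%:R.
by apply/idP/idP; rewrite !inE /= !in_itv /= => /andP[-> _] /=; [exact: ltW|exact: ltW (lt_trans q yt)].
Qed.

(** The inner products are the Fourier coefficients of the bracket. If they
    vanish, so do its integrals over arcs ([cint_arc]). *)
Lemma bracket_dot0 f g : L2 f -> L2 g ->
  (forall k : int, L2dot (fun x => ew (k%:~R * x) * f x) g = 0) ->
  \forall x \ae mu, bracket f g x = 0.
Proof.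
move=> lf lg h0; have cu := citg_dot lf lg; have [cr ci] := cu.
have kil : killed (fun x => f x * (g x)^*) (fun=> 1).
  split; [exact: measurable_cst|by move=> x; rewrite ler01 lexx|move=> k].
  rewrite -[RHS](h0 k) dotE; congr cint; apply/funext => x.
  by rewrite mul1r; move: (ew _) (f x) ((g x)^*) => *; ring.
have hr (x0 c : R) : `|c| <= 1 -> rint (fun x => (arc x0 c x)%:R * Re (f x * (g x)^*)) = 0 /\
    rint (fun x => (arc x0 c x)%:R * Im (f x * (g x)^*)) = 0.
  move=> c1; have := cint_arc cu x0 c1 kil; rewrite /cint => -[h1 h2].
  split; [move: h1|move: h2] => <-; congr rint; apply/funext => x;
    by move: (f x * _) => z; rewrite !cE; ring.
have [U [iU rU aU]] := periodize cr; have [V [iV rV aV]] := periodize ci.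
have U0 := arcs_periodize0 cr iU aU (fun x0 c c1 => (hr x0 c c1).1).
have V0 := arcs_periodize0 ci iV aV (fun x0 c c1 => (hr x0 c c1).2).
pose good x := ell2 (fib f x) /\ ell2 (fib g x).
have ag : \forall x \ae mu, good x by apply: aeI; exact: ell2_fib.
suff : \forall x \ae mu, good x /\ bracket f g x = 0 by apply: aeS => x [].
apply: ae_periodic => [x k [[ef eg] b0]|].
  by split; [split; rewrite fib_shift; exact: ell2_shift|rewrite bracket_per].
apply: aeS (aeI ag (aeI (aeI aU aV) (aeI U0 V0))) => x [gx [[h1 h2] [u0 v0]]] /andP[x0 x1].
split=> //; rewrite bracketE.
have c1 : cell x = 1 by rewrite cellE (ltW x0) x1.
rewrite (u0 x0) c1 in h1; rewrite (v0 x0) c1 in h2.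
apply: sum_int_lim; rewrite !cE.
  by apply: cvg_congr h1 => n; rewrite mul1r.
by apply: cvg_congr h2 => n; rewrite mul1r.
Qed.

End Bracket.

(** * Gram-Schmidt along the fibres *)

Section AbstractGramSchmidt.
Variables (K : fieldType) (conj : {rmorphism K -> K}) (V : Type) (ip : V -> V -> K).
Variables (p : nat) (a s : nat -> V).
(** The vectors on which the form behaves; along a fibre these are the square
    summable ones. *)
Variable ok : V -> Prop.
Hypothesis ip_rec : forall (g : V) q, ok g -> (1 <= q <= p)%N ->
  ip (s q) g = ip (a q) g - \sum_(l < q) ip (a q) (s l) / ip (s l) (s l) * ip (s l) g.

(** By the recursion each orthogonalized vector is a combination of [s 0] and
    of the original ones. *)
Lemma gs_kill (g : V) : ok g -> ip (s 0%N) g = 0 -> (forall q, (q <= p)%N -> ip (a q) g = 0) ->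
  forall q, (q <= p)%N -> ip (s q) g = 0.
Proof.
move=> og s0 ha q; elim/ltn_ind: q => -[//|q] ih qp.
rewrite ip_rec ?qp // ha // big1 ?subr0 // => l _.
by rewrite ih ?mulr0 // (leq_trans (ltnW (ltn_ord l)) qp).
Qed.

Hypothesis ok_s : forall q, (q <= p)%N -> ok (s q).
Hypothesis ipC : forall q m, (q <= p)%N -> (m <= p)%N -> ip (s m) (s q) = conj (ip (s q) (s m)).
Hypothesis ip_def : forall q m, (q <= p)%N -> (m <= p)%N -> ip (s m) (s m) = 0 -> ip (a q) (s m) = 0.

(** Subtracting the projection on [s m] removes the component along [s m], and
    by induction the other projections do not contribute. If [s m] has norm
    zero the quotient is 0, which is correct by [ip_def]. *)
Lemma gs_orth q m : (m < q <= p)%N -> ip (s q) (s m) = 0.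
Proof.
elim/ltn_ind: q m => q ih m /andP[mq qp].
have mp : (m <= p)%N by apply: leq_trans (ltnW mq) qp.
rewrite ip_rec ?(leq_ltn_trans _ mq) //; last exact: ok_s.
rewrite (bigD1 (Ordinal mq)) //= big1 => [|l /eqP nl]; last first.
  have lp : (l <= p)%N by apply: leq_trans (ltnW (ltn_ord l)) qp.
  case: (ltngtP l m) => lm; last by case: nl; apply: val_inj.
    by rewrite (ipC (q:=m)) // (ih m mq) ?lm ?mp // rmorph0 mulr0.
  by rewrite (ih l (ltn_ord l) m) ?lm ?lp ?mulr0.
rewrite addr0; have [z|nz] := eqVneq (ip (s m) (s m)) 0.
  by rewrite z mulr0 subr0 ip_def.
by rewrite divfK ?subrr.
Qed.

End AbstractGramSchmidt.

Section GramSchmidt.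
Context {R : realType}.
Local Notation mu := (@lebesgue_measure R).
Local Open Scope complex_scope.
Local Notation Re := complex.Re.
Local Notation Im := complex.Im.
Local Notation tau := (2 * pi : R).
Implicit Types (f g h : R -> R[i]).

(** By Plancherel the inner products of [g] with the translates of [f] are, up
    to the factor [kF], the Fourier coefficients of the bracket. *)
Lemma bracket_trans f g : L2 f -> L2 g ->
  (forall k : int, L2dot (fun x => f (x - k%:~R)) g = 0) <->
  (\forall x \ae mu, bracket (fourier f) (fourier g) x = 0).
Proof.
move=> lf lg; have [lF _] := fourierP lf; have [lG _] := fourierP lg.
split=> [h|h k].
  by apply: bracket_dot0 => // k; rewrite plancherel // h mulr0.
have := dot_bracket0 lF lG h k; rewrite plancherel // => /eqP.
rewrite mulf_eq0 => /orP[/eqP[] k0|/eqP //].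
by have := @kF_gt0 R; rewrite k0 ltxx.
Qed.

Lemma bracketC f g x : ell2 (fib f x) -> ell2 (fib g x) ->
  bracket g f x = (bracket f g x)^*.
Proof.
move=> ef eg; have [a b] := sum_int_cvg (ell2_dot ef eg).
rewrite !bracketE; apply: sum_int_lim; rewrite !cE.
  by apply: cvg_congr a => n; apply: eq_bigr => i _; rewrite !cE; ring.
apply: cvg_congr (cvgN b) => n.
by rewrite /= -mulN1r -psqZ; apply: eq_bigr => i _; rewrite !cE; ring.
Qed.

Section Fibrewise.
Variables (p : nat) (A B : nat -> R -> R[i]).
Hypothesis LA : forall q, (q <= p)%N -> L2 (A q).
Hypothesis LB : forall q, (q <= p)%N -> L2 (B q).
Hypothesis Brec : forall q, (1 <= q <= p)%N -> B q =
  (fun xi => A q xi - \sum_(l < q)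
     bracket (A q) (B l) xi / bracket (B l) (B l) xi * B l xi) %[ae mu].

Local Notation coef q l x := (bracket (A q) (B l) x / bracket (B l) (B l) x).

(** Brackets are periodic, so along almost every fibre the recursion holds with
    constant coefficients. *)
Lemma ae_fibres : \forall x \ae mu, forall q, (q <= p)%N ->
  [/\ ell2 (fib (A q) x), ell2 (fib (B q) x) & (0 < q)%N -> forall k : int,
      fib (B q) x k = fib (A q) x k - \sum_(l < q) coef q l x * fib (B l) x k].
Proof.
have h0 q : \forall x \ae mu, (q <= p)%N -> ell2 (fib (A q) x) /\ ell2 (fib (B q) x).
  have [qp|qp] := boolP (q <= p)%N; last by apply: aeT.
  by apply: aeS (aeI (ell2_fib (LA qp)) (ell2_fib (LB qp))).
have h1 q : \forall x \ae mu, (1 <= q <= p)%N -> forall k : int, fib (B q) x k =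
    fib (A q) x k - \sum_(l < q) coef q l (x + tau * k%:~R) * fib (B l) x k.
  have [qp|qp] := boolP (1 <= q <= p)%N; last by apply: aeT.
  have := ae_fib (Brec qp); apply: aeS => x h _ k; rewrite /fib h //.
apply: aeS (aeI (aeA h0) (aeA h1)) => x [g0 g1] q qp.
have [a b] := g0 q qp; split=> // q0 k; rewrite (g1 q) ?q0 //.
apply: (f_equal (fun z => fib (A q) x k - z)); apply: eq_bigr => l _.
have lp : (l <= p)%N by apply: leq_trans (ltnW (ltn_ord l)) qp.
have [_ c] := g0 l lp; apply: (f_equal (fun z => z * fib (B l) x k)).
by rewrite (bracket_per k a c) (bracket_per k c c).
Qed.

Lemma sum_int_comb (J : finType) (c : J -> R[i]) (u v : int -> R[i]) (w : J -> int -> R[i])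
    (g : int -> R[i]) : ell2 g -> ell2 v -> (forall l, ell2 (w l)) ->
  (forall k, u k = v k - \sum_l c l * w l k) ->
  sum_int (fun k => u k * (g k)^*) = sum_int (fun k => v k * (g k)^*) -
    \sum_l c l * sum_int (fun k => w l k * (g k)^*).
Proof.
move=> eg ev ew E.
have cl l : csummable (fun k => w l k * (g k)^*) by exact: ell2_dot.
have [cs ss] := sum_int_sum (index_enum J) (fun l => csummableZ (- c l) (cl l)).
transitivity (sum_int (fun k => v k * (g k)^* + \sum_l (- c l) * (w l k * (g k)^*))).
  congr sum_int; apply/funext => k; rewrite E mulrBl mulr_suml -sumrN; congr (_ + _).
  by apply: eq_bigr => l _; move: (c l) (w l k) ((g k)^*) => *; ring.
rewrite sum_intD //; last exact: ell2_dot.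
rewrite ss -sumrN; congr (_ + _); apply: eq_bigr => l _.
by rewrite (sum_intZ (- c l) (cl l)) mulNr.
Qed.

Lemma bracket_rec g x : ell2 (fib g x) ->
  (forall q, (q <= p)%N ->
  [/\ ell2 (fib (A q) x), ell2 (fib (B q) x) & (0 < q)%N -> forall k : int,
      fib (B q) x k = fib (A q) x k - \sum_(l < q) coef q l x * fib (B l) x k]) ->
  forall q, (1 <= q <= p)%N -> bracket (B q) g x =
    bracket (A q) g x - \sum_(l < q) coef q l x * bracket (B l) g x.
Proof.
move=> eg good q /andP[q0 qp]; have [eQ eS rec] := good q qp.
apply: (@sum_int_comb _ (fun l : 'I_q => coef q l x) _ _
  (fun l : 'I_q => fib (B l) x)) (rec q0) => // l.
have lp : (l <= p)%N by apply: leq_trans (ltnW (ltn_ord l)) qp.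
by have [_ e _] := good l lp.
Qed.

Lemma bracket_kill g : L2 g -> (\forall x \ae mu, bracket (B 0%N) g x = 0) ->
  (forall q, (q <= p)%N -> \forall x \ae mu, bracket (A q) g x = 0) ->
  forall q, (q <= p)%N -> \forall x \ae mu, bracket (B q) g x = 0.
Proof.
move=> lg b0 hA q qp.
have bA : \forall x \ae mu, forall q, (q <= p)%N -> bracket (A q) g x = 0.
  apply: aeA => j; have [jp|jp] := boolP (j <= p)%N; last by apply: aeT.
  by apply: aeS (hA j jp).
apply: aeS (aeI (aeI b0 bA) (aeI ae_fibres (ell2_fib lg))) => x [[z0 zA] [good eg]].
apply: (@gs_kill _ _ (fun f g => bracket f g x) p A B (fun g => ell2 (fib g x)) _ g) => //.
by move=> h j eh; exact: bracket_rec.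
Qed.

Lemma bracket_orth : \forall x \ae mu, forall q m, (m < q <= p)%N ->
  bracket (B q) (B m) x = 0.
Proof.
apply: aeS ae_fibres => x good q m mqp.
apply: (@gs_orth _ (@Num.conj R[i]) _ (fun f g => bracket f g x) p A B
  (fun g => ell2 (fib g x))) => // [g j eg|j jp|j l jp lp|j l jp lp /= z].
- exact: bracket_rec.
- by have [] := good j jp.
- by have [_ ? _] := good j jp; have [_ ? _] := good l lp; exact: bracketC.
- have [_ em _] := good l lp; have fm := ell2_eq0 em z; rewrite bracketE.
  have -> : (fun k => fib (A j) x k * (fib (B l) x k)^*) = (fun=> 0).
    by apply/funext => k; rewrite fm rmorph0 mulr0.
  exact: sum_int0.
Qed.

End Fibrewise.

Variables (p : nat) (Q S : nat -> R -> R[i]).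
Hypothesis LQ : forall q, (q <= p)%N -> L2 (Q q).
Hypothesis LS : forall q, (q <= p)%N -> L2 (S q).
Hypothesis S0 : S 0%N = Q 0%N %[ae mu].
Hypothesis Srec : forall q, (1 <= q <= p)%N -> fourier (S q) =
  (fun xi => fourier (Q q) xi - \sum_(l < q)
     bracket (fourier (Q q)) (fourier (S l)) xi /
     bracket (fourier (S l)) (fourier (S l)) xi * fourier (S l) xi) %[ae mu].

Local Notation F := fourier.
(** The recursion between the transforms, stated for abstract families as in
    the argument along the fibres. *)
Lemma transforms : exists A B : nat -> R -> R[i],
  [/\ forall q, A q = F (Q q), forall q, B q = F (S q) &
   forall q, (1 <= q <= p)%N -> B q =
  (fun xi => A q xi - \sum_(l < q)
     bracket (A q) (B l) xi / bracket (B l) (B l) xi * B l xi) %[ae mu]].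
Proof.
exists (fun q => F (Q q)), (fun q => F (S q)); split => //; exact: Srec.
Qed.

(** The quotients of brackets may be unbounded, so a modified function need not
    be given by a series of translates of the original ones; orthogonality
    passes over nevertheless, since it can be checked on each fibre separately.
    *)
Lemma trans_orth_star rho : L2 rho ->
  (forall q (k : int), (q <= p)%N -> L2dot (fun x => Q q (x - k%:~R)) rho = 0) ->
  forall q (k : int), (q <= p)%N -> L2dot (fun x => S q (x - k%:~R)) rho = 0.
Proof.
move=> lr hQ q k qp; apply: (bracket_trans (LS qp) lr).2.
have b0 : \forall x \ae mu, bracket (F (S 0%N)) (F rho) x = 0.
  apply/(bracket_trans (LS (leq0n p)) lr) => m.
  rewrite -[RHS](hQ 0%N m) // !dotE; apply: cint_ae.
  - apply: cmeasM; last by apply: cmeasJ; exact: L2_meas.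
    by apply: L2_meas; exact: L2_shift (LS (leq0n p)).
  - apply: cmeasM; last by apply: cmeasJ; exact: L2_meas.
    by apply: L2_meas; exact: L2_shift (LQ (leq0n p)).
  - have := ae_affine (- m%:~R) (oner_neq0 R) S0; apply: aeS => x; rewrite mul1r => h _.
    by rewrite h.
have bQ j (jp : (j <= p)%N) := (bracket_trans (LQ jp) lr).1 (fun k => hQ j k jp).
have LF j (jp : (j <= p)%N) := (fourierP (LQ jp)).1.
have LG j (jp : (j <= p)%N) := (fourierP (LS jp)).1.
have lFr := (fourierP lr).1.
have [A [B [hA hB rec]]] := transforms.
rewrite -hB in b0; rewrite -hB; move: (F rho) lFr b0 bQ => r lFr b0 bQ.
have LA j : (j <= p)%N -> L2 (A j) by move=> jp; rewrite hA; exact: LF.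
have LB j : (j <= p)%N -> L2 (B j) by move=> jp; rewrite hB; exact: LG.
apply: (bracket_kill LA LB rec lFr b0 _ qp) => j jp.
by rewrite hA; exact: bQ.
Qed.

Lemma star_orth q m (k : int) : (q <= p)%N -> (m <= p)%N -> q != m ->
  L2dot (fun x => S q (x - k%:~R)) (S m) = 0.
Proof.
move=> qp mp qm; apply: (bracket_trans (LS qp) (LS mp)).2.
have LF j (jp : (j <= p)%N) := (fourierP (LQ jp)).1.
have LG j (jp : (j <= p)%N) := (fourierP (LS jp)).1.
have [A [B [hA hB rec]]] := transforms.
have LA j : (j <= p)%N -> L2 (A j) by move=> jp; rewrite hA; exact: LF.
have LB j : (j <= p)%N -> L2 (B j) by move=> jp; rewrite hB; exact: LG.
rewrite -!hB; move: LA LB rec => {hA hB} LA LB rec.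
apply: aeS (aeI (bracket_orth LA LB rec) (aeI (ell2_fib (LB q qp)) (ell2_fib (LB m mp)))).
move=> x [h [eq em]].
case: (ltngtP q m) qm => // lt _; last by rewrite (h q m) // lt.
by rewrite (bracketC em eq) (h m q) ?lt // rmorph0.
Qed.

End GramSchmidt.

(** * The algebra of the mask *)

Section EvenOdd.
Variable F : comNzRingType.
Implicit Types p q : {poly F}.

Lemma even_odd_polyM p q :
  even_poly (p * q) = even_poly p * even_poly q + 'X * (odd_poly p * odd_poly q) /\
  odd_poly (p * q) = even_poly p * odd_poly q + odd_poly p * even_poly q.
Proof.
elim/poly_ind: p => [|p c [ihe iho]].
  by rewrite mul0r -!['X]/('X) !even_polyC !odd_polyC !mul0r mulr0 addr0.
have -> : (p * 'X + c%:P) * q = p * q * 'X + c *: q by rewrite mulrDl mul_polyC mulrAC.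
rewrite !even_polyD !odd_polyD !even_polyMX !odd_polyMX even_polyC odd_polyC.
rewrite even_polyZ odd_polyZ ihe iho -!mul_polyC; split; ring.
Qed.

(** For s^2 = X the left side is the product of the values at s and - s of the
    polynomial with even part and odd part as displayed, that is, of (1 - s)^n
    and (1 + s)^n. *)
Lemma even_odd_pow n (c := (1 - 'X) ^+ n : {poly F}) :
  even_poly c ^+ 2 - 'X * odd_poly c ^+ 2 = (1 - 'X) ^+ n.
Proof.
rewrite {}/c; elim: n => [|n ih].
  by rewrite expr0 -polyC1 even_polyC odd_polyC; ring.
have -> : (1 - 'X) ^+ n.+1 = (1 - 'X) ^+ n + (-1) *: ((1 - 'X) ^+ n * 'X) :> {poly F}.
  by rewrite exprSr -mul_polyC polyCN polyC1; ring.
rewrite [RHS](_ : _ = (1 - 'X) ^+ n * (1 - 'X)); last by rewrite -mul_polyC polyCN polyC1; ring.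
rewrite even_polyD odd_polyD even_polyZ odd_polyZ even_polyMX odd_polyMX.
rewrite -[in RHS]ih -!mul_polyC polyCN polyC1.
by move: (even_poly _) (odd_poly _) => *; ring.
Qed.

Lemma coef_compNX p i : (p \Po (- 'X))`_i = (-1) ^+ i * p`_i.
Proof.
elim/poly_ind: p i => [|p c ih] i; first by rewrite comp_poly0 coef0 mulr0.
rewrite comp_polyD comp_polyM comp_polyX comp_polyC mulrN !coefD coefN !coefMX !coefC.
case: i => [|i] /=; first by rewrite oppr0 expr0 mul1r.
by rewrite ih exprS; ring.
Qed.

End EvenOdd.

Section Bezout.
Variable A : comNzRingType.

(** The series of (1 - y)^(-k-1) truncated after y^k, at y = b / s, cleared of
    denominators. *)
Definition bsum_hom (k : nat) (b s : A) : A := \sum_(n < k.+1) ('C(k + n, n))%:R * b ^+ n * s ^+ (k - n).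

(** Pascal's rule. The two boundary terms cancel in [bezout_hom], as C(2k+2,
    k+1) = 2 C(2k+1, k+1). *)
Lemma bsum_homS k (b s : A) :
  (s - b) * bsum_hom k.+1 b s = s ^+ 2 * bsum_hom k b s +
    s * ('C(k.*2.+1, k.+1))%:R * b ^+ k.+1 - ('C(k.*2.+2, k.+1))%:R * b ^+ k.+2.
Proof.
have E1 : s * bsum_hom k.+1 b s = \sum_(n < k.+2) ('C(k.+1 + n, n))%:R * b ^+ n * s ^+ (k.+2 - n).
  rewrite /bsum_hom mulr_sumr; apply: eq_bigr => n _.
  rewrite (_ : (k.+2 - n = (k.+1 - n).+1)%N) ?exprS; first by ring.
  by rewrite subSn ?leq_ord.
have E2 : \sum_(n < k.+2) ('C(k.+1 + n, n))%:R * b ^+ n * s ^+ (k.+2 - n) =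
    \sum_(n < k.+2) ('C(k + n, n))%:R * b ^+ n * s ^+ (k.+2 - n) +
    \sum_(m < k.+1) ('C(k.+1 + m, m))%:R * b ^+ m.+1 * s ^+ (k.+1 - m).
  rewrite big_ord_recl [X in _ = X + _]big_ord_recl /= !bin0 -addrA; congr (_ + _).
  rewrite -big_split /=; apply: eq_bigr => m _.
  by rewrite !addnS /= subSS binS addSn natrD; ring.
rewrite mulrBl E1 E2 big_ord_recr /=.
have -> : \sum_(n < k.+1) ('C(k + n, n))%:R * b ^+ n * s ^+ (k.+2 - n) = s ^+ 2 * bsum_hom k b s.
  rewrite /bsum_hom mulr_sumr; apply: eq_bigr => n _.
  by rewrite -addn2 -addnBAC ?leq_ord // addnC exprD; ring.
have -> : \sum_(m < k.+1) ('C(k.+1 + m, m))%:R * b ^+ m.+1 * s ^+ (k.+1 - m) =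
    b * bsum_hom k.+1 b s - ('C(k.*2.+2, k.+1))%:R * b ^+ k.+2.
  rewrite /bsum_hom [in RHS]big_ord_recr /= subnn expr0 mulr1 mulrDr mulr_sumr.
  rewrite addnn doubleS !exprS -addrA [X in _ + X](_ : _ = 0) ?addr0; last by ring.
  by apply: eq_bigr => m _; rewrite exprS; ring.
rewrite subSn // subnn expr1 addnS addnn; ring.
Qed.

(** The Bezout identity behind Daubechies' filters, in homogeneous form so that
    it can be applied to polynomials. *)
Lemma bezout_hom k (a b s : A) : a + b = s ->
  a ^+ k.+1 * bsum_hom k b s + b ^+ k.+1 * bsum_hom k a s = s ^+ k.*2.+1.
Proof.
move=> abs; elim: k => [|k ih].
  by rewrite /bsum_hom !big_ord1 /= bin0 !expr0 !mulr1 !expr1 abs.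
have hb := bsum_homS k b s; have ha := bsum_homS k a s.
have sa : s - b = a by rewrite -abs addrK.
have sb : s - a = b by rewrite -abs addrC addKr.
rewrite sa in hb; rewrite sb in ha.
have -> : a ^+ k.+2 * bsum_hom k.+1 b s = a ^+ k.+1 * (a * bsum_hom k.+1 b s) by rewrite exprSr mulrA.
have -> : b ^+ k.+2 * bsum_hom k.+1 a s = b ^+ k.+1 * (b * bsum_hom k.+1 a s) by rewrite exprSr mulrA.
rewrite ha hb doubleS.
have -> : s ^+ k.*2.+3 = s ^+ 2 * s ^+ k.*2.+1 by rewrite -exprD.
rewrite -ih.
have C2 : ('C(k.*2.+2, k.+1))%:R = 2 * ('C(k.*2.+1, k.+1))%:R :> A.
  rewrite binS -[X in (_ + X)%N]bin_sub; last by lia.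
  by rewrite (_ : k.*2.+1 - k = k.+1)%N; [rewrite addnn -mul2n natrM|lia].
by rewrite C2 !exprSr -abs; ring.
Qed.

End Bezout.

Section MaskPoly.
Variable F : realFieldType.

(** With a = - (1 - X)^2, b = (1 + X)^2 and s = 4 X one has a + b = s. Up to a
    power of 4 z this is the binomial sum of the dual symbol at - z. *)
Definition lowpass k : {poly F} := bsum_hom k ((1 + 'X) ^+ 2) (4%:R *: 'X).

(** The quarklet mask shifted by 2k, which makes it a polynomial
    ([mask_coefE]). *)
Definition mask_poly k : {poly F} :=
  ((-1) ^+ k / 16 ^+ k) *: ((1 - 'X) ^+ k.*2.+1 * lowpass k).

Lemma lowpassN k : lowpass k \Po (- 'X) = (-1) ^+ k * bsum_hom k (- (1 - 'X) ^+ 2) (4%:R *: 'X).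
Proof.
rewrite /lowpass /bsum_hom rmorph_sum /= mulr_sumr; apply: eq_bigr => n _.
rewrite !rmorphM !rmorphXn /= rmorphD /= comp_polyX comp_polyZ comp_polyX !comp_polyC rmorph_nat.
rewrite scalerN -[- (4 *: _)]mulN1r -[- (1 - 'X) ^+ 2]mulN1r !exprMn.
have -> : (-1) ^+ k = (-1) ^+ n * (-1) ^+ (k - n) :> {poly F}.
  by rewrite -exprD subnKC // leq_ord.
have s1 : (-1) ^+ n * (-1) ^+ n = 1 :> {poly F} by rewrite -exprMn mulrNN mulr1 expr1n.
rewrite -[LHS]mul1r -[X in X * _ = _]s1 polyC1; ring.
Qed.

Lemma mask_bezout k : (1 + 'X) * (mask_poly k \Po (- 'X)) - (1 - 'X) * mask_poly k =
  4%:R *: 'X^(k.*2.+1).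
Proof.
have ab : (1 + 'X) ^+ 2 + - (1 - 'X) ^+ 2 = 4%:R *: 'X :> {poly F}.
  by rewrite -mul_polyC; ring.
have hz := bezout_hom k ab.
rewrite /mask_poly comp_polyZ rmorphM rmorphXn /= rmorphB /= comp_polyX comp_polyC lowpassN opprK.
rewrite -/(lowpass k) in hz.
have -> : (1 + 'X) * (((-1) ^+ k / 16 ^+ k) *: ((1%:P + 'X) ^+ k.*2.+1 *
    ((-1) ^+ k * bsum_hom k (- (1 - 'X) ^+ 2) (4%:R *: 'X)))) =
    (16 ^- k) *: ((1 + 'X) ^+ 2 ^+ k.+1 * bsum_hom k (- (1 - 'X) ^+ 2) (4%:R *: 'X)) :> {poly F}.
  rewrite -exprM mul2n doubleS [in RHS]exprS -!mul_polyC polyCM polyC_exp polyCN.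
  have s1 : (-1) ^+ k * (-1) ^+ k = 1 :> {poly F} by rewrite -exprMn mulrNN mulr1 expr1n.
  rewrite -[RHS]mul1r -[X in _ = X * _]s1 polyC1; ring.
have -> : (1 - 'X) * (((-1) ^+ k / 16 ^+ k) *: ((1 - 'X) ^+ k.*2.+1 * lowpass k)) =
    - (16 ^- k *: ((- (1 - 'X) ^+ 2) ^+ k.+1 * lowpass k)) :> {poly F}.
  rewrite -[- (1 - 'X) ^+ 2]mulN1r exprMn -exprM mul2n doubleS ![_ ^+ _.+1]exprS.
  by rewrite -!mul_polyC polyCM polyC_exp polyCN; ring.
rewrite opprK -scalerDr hz exprZn scalerA; congr (_ *: _).
have -> : 16 = 4 ^+ 2 :> F by rewrite expr2 -natrM.
by rewrite -exprM -mul2n exprS mulrCA mulVf ?mulr1 // expf_neq0 // pnatr_eq0.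
Qed.

(** The coefficients of odd index in [mask_bezout]. *)
Lemma mask_even_odd k : even_poly (mask_poly k) - odd_poly (mask_poly k) = 2%:R *: 'X^k.
Proof.
apply/polyP => i; have := congr1 (fun p : {poly F} => p`_(i.*2.+1)) (mask_bezout k).
move: (mask_poly k) => B; rewrite coefB coefZ coefXn mulrDl mulrBl !mul1r coefB !coefD !coefXM /= !coef_compNX.
have s1 : (-1) ^+ i.*2 = 1 :> F by rewrite -mul2n exprM sqrrN !expr1n.
rewrite exprS s1 !coefZ !coefXn coefN coef_even_poly coef_odd_poly.
rewrite (_ : (i.*2.+1 == k.*2.+1) = (i == k)); last by rewrite eqSS; apply/eqP/eqP; lia.
by rewrite !mulr1 !mul1r; lra.
Qed.

Lemma lowpass_ge0 k i : 0 <= (lowpass k)`_i.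
Proof.
have P1 (p q : {poly F}) : (forall i, 0 <= p`_i) -> (forall i, 0 <= q`_i) -> forall i, 0 <= (p * q)`_i.
  by move=> hp hq j; rewrite coefM; apply: sumr_ge0 => l _; rewrite mulr_ge0.
have P2 (p : {poly F}) n : (forall i, 0 <= p`_i) -> forall i, 0 <= (p ^+ n)`_i.
  move=> hp; elim: n => [|n ih]; first by move=> j; rewrite expr0 coef1 ler0n.
  by rewrite exprS; exact: P1.
rewrite /lowpass /bsum_hom coef_sum; apply: sumr_ge0 => n _; move: i; apply: (P1).
  apply: (P1); first by move=> j; rewrite -polyC_natr coefC; case: ifP => // _; rewrite ler0n.
  by apply: (P2); apply: (P2) => j; rewrite coefD coef1 coefX addr_ge0 ?ler0n.
by apply: (P2) => j; rewrite coefZ coefX mulr_ge0 ?ler0n.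
Qed.

(** The identity [bezout_hom] at a = b = 1 evaluates a sum that dominates this
    one term by term. *)
Lemma lowpass_at1 k : (lowpass k).[1] <= 16 ^+ k.
Proof.
have e : (lowpass k).[1] = 4 ^+ k * \sum_(n < k.+1) ('C(k + n, n))%:R.
  rewrite /lowpass /bsum_hom horner_sum mulr_sumr; apply: eq_bigr => n _.
  rewrite !hornerE -polyC_natr !hornerE /=.
  have -> : (1 + 1) ^+ 2 = 4 :> F by ring.
  have -> : 4 ^+ k = 4 ^+ n * 4 ^+ (k - n) :> F by rewrite -exprD subnKC // leq_ord.
  ring.
have h : \sum_(n < k.+1) ('C(k + n, n))%:R * 2 ^+ (k - n) = 4 ^+ k :> F.
  have := @bezout_hom F k 1 1 2 erefl; rewrite /bsum_hom !expr1n !mul1r exprS => h.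
  apply: (@mulfI _ 2); first by rewrite pnatr_eq0.
  rewrite -mul2n exprM (_ : 2 ^+ 2 = 4 :> F) in h; last by ring.
  rewrite -h mulr_natl mulr2n; congr (_ + _); apply: eq_bigr => n _; rewrite expr1n; ring.
rewrite e (_ : 16 = 4 * 4 :> F); last by rewrite -natrM.
rewrite exprMn ler_wpM2l ?exprn_ge0 //; rewrite -[leRHS]h; apply: ler_sum => n _.
by rewrite ler_peMr ?ler0n // exprn_ege1 // ler1n.
Qed.

Definition l1norm (p : {poly F}) : F := \sum_(i < size p) `|p`_i|.

(** By [mask_even_odd] the determinant formed from the even and odd parts of 1
    + X and of B is a monomial, so the linear system for the coefficients u and
    v is solved by Cramer's rule. *)
Lemma mask_split k (c : {poly F}) (B := mask_poly k)
   (u := 2%:R *: (odd_poly c * even_poly B - even_poly c * odd_poly B))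
   (v := 2%:R *: (even_poly c - odd_poly c)) :
  4%:R *: ('X^(k.*2) * c) = (1 + 'X) * (u \Po 'X^2) + B * (v \Po 'X^2).
Proof.
rewrite {}/u {}/v; have h := congr1 (fun p => p \Po 'X^2) (mask_even_odd k); rewrite -/B /= in h.
rewrite rmorphB /= comp_polyZ rmorphXn /= comp_polyX -exprM mul2n in h.
rewrite !comp_polyZ !rmorphB !rmorphM /=.
have -> : 'X^(k.*2) = 2^-1 *: ((even_poly B \Po 'X^2) - (odd_poly B \Po 'X^2)) :> {poly F}.
  by rewrite h scalerA mulVf ?scale1r // pnatr_eq0.
have hc := poly_even_odd c; have hB := poly_even_odd B.
rewrite -[X in _ *: (_ *: _ * X)]hc -[X in _ + X * _]hB.
move: (even_poly c \Po _) (odd_poly c \Po _) (even_poly B \Po _) (odd_poly B \Po _) => x1 x2 x3 x4.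
rewrite -scalerAl scalerA (_ : 4 * 2^-1 = 2 :> F) -?mul_polyC; last by field.
by ring.
Qed.

(** Here c and B share the factor (1 - X)^(2k+1). In the determinant formed
    from their even and odd parts, [even_odd_pow] restores this factor, and
    what remains is one half of the coefficients of [lowpass]. As these are
    nonnegative, the value at 1 bounds their sum. *)
Lemma mask_split_pow k i : (i < 2)%N -> exists e : {poly F}, l1norm e <= 2 /\
  let c := 'X^i * (1 - 'X) ^+ k.*2.+1 in let B := mask_poly k in
  2%:R *: (odd_poly c * even_poly B - even_poly c * odd_poly B) = e * (1 - 'X) ^+ k.*2.+1.
Proof.
have n1 (p : {poly F}) (j : nat -> nat) (s : F) : injective j -> `|s| = 16 ^- k ->
    (forall i, p`_i = 2 * s * (lowpass k)`_(j i)) -> l1norm p <= 2.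
  move=> ji s1 hp; rewrite /l1norm; under eq_bigr do rewrite hp normrM.
  rewrite -mulr_sumr normrM s1 ger0_norm // -mulrA -[leRHS]mulr1 ler_wpM2l //.
  rewrite ler_pdivrMl ?exprn_gt0 // mulr1; apply: le_trans (lowpass_at1 k).
  rewrite horner_coef; under [leRHS]eq_bigr do rewrite expr1n mulr1.
  rewrite (eq_bigr (fun i : 'I_(size p) => (lowpass k)`_(j i))); last first.
    by move=> l _; rewrite ger0_norm ?lowpass_ge0.
  (* one range of indices for both sums *)
  pose m := (maxn (size (lowpass k)) (\max_(i < size p) (j i).+1))%N.
  have -> : \sum_(l < size (lowpass k)) (lowpass k)`_l = \sum_(l < m) (lowpass k)`_l.
    rewrite (big_ord_widen m (fun l => (lowpass k)`_l)) ?leq_maxl // [RHS](bigID (fun l : 'I_m => (l < size (lowpass k))%N)) /=.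
    rewrite [X in _ + X]big1 ?addr0 // => l; rewrite -leqNgt => hl; exact: nth_default.
  have jm (l : 'I_(size p)) : (j l < m)%N.
    by apply: leq_trans (leq_maxr _ _); apply: (leq_bigmax_cond (F := fun l : 'I_(size p) => (j l).+1)).
  pose J l := Ordinal (jm l).
  have Ji : injective J by move=> x y /(congr1 val) /= /ji /val_inj.
  have uJ : uniq (codom J) by rewrite map_inj_uniq // enum_uniq.
  have -> : \sum_(l < size p) (lowpass k)`_(j l) = \sum_(l in codom J) (lowpass k)`_l.
    by rewrite -(big_uniq _ uJ) big_image.
  rewrite [leRHS](bigID (mem (codom J))) /= lerDl; apply: sumr_ge0 => *; exact: lowpass_ge0.
set c0 := (1 - 'X) ^+ _ : {poly F}; set s := (-1) ^+ k / 16 ^+ k : F.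
have sn : `|s| = 16 ^- k by rewrite normrM normrX normrN1 expr1n mul1r ger0_norm // invr_ge0 exprn_ge0.
have [Be Bo] := even_odd_polyM c0 (lowpass k).
have nid := even_odd_pow F k.*2.+1; rewrite -/c0 /= in nid.
rewrite /mask_poly -/c0 -/s even_polyZ odd_polyZ Be Bo; clearbody s.
case: i => [|[|//]] _.
  exists ((- (2 * s)) *: odd_poly (lowpass k)); split.
    apply: (n1 _ (fun i => i.*2.+1) (- s)); rewrite ?normrN //.
      by move=> x y [] /double_inj.
    by move=> i; rewrite coefZ coef_odd_poly mulrN.
  rewrite expr0 mul1r /= -[in RHS]nid -!mul_polyC polyCN !polyCM.
  by move: (even_poly _) (odd_poly _) (even_poly _) (odd_poly _) => *; ring.
exists ((2 * s) *: even_poly (lowpass k)); split.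
  by apply: (n1 _ double s) => // [x y /double_inj //|i]; rewrite coefZ coef_even_poly.
rewrite expr1 ['X * c0]mulrC even_polyMX odd_polyMX /= -[in RHS]nid -!mul_polyC !polyCM.
by move: (even_poly _) (odd_poly _) (even_poly _) (odd_poly _) => *; ring.
Qed.

End MaskPoly.

(** * The mask of the quarklets *)

Section MaskCoefs.
Context {R : realType}.
Local Open Scope complex_scope.

Lemma fsum_int (F : int -> R[i]) (N : nat) (c : int) :
  (forall j : int, F j != 0 -> exists2 i : nat, (i < N)%N & j = i%:Z - c) ->
  \sum_(j \in [set: int]) F j = \sum_(i < N) F (i%:Z - c).
Proof.
move=> hF; pose r := [seq i%:Z - c | i <- iota 0 N].
have ur : uniq r by rewrite map_inj_uniq ?iota_uniq // => i j; lia.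
rewrite -(fsbig_widen [set` r] setT) //; last first.
  move=> j [_ /= jr]; apply/eqP; apply: contrapT => /negP /hF [i iN ji]; apply: jr.
  by rewrite ji; apply/mapP; exists i; rewrite ?mem_iota.
rewrite -fsbig_seq // big_map (_ : iota 0 N = index_iota 0 N) ?big_mkord //.
by rewrite /index_iota subn0.
Qed.

(** Infinitely many points of the circle, enough to determine polynomials. *)
Definition circ (n : nat) : R[i] :=
  (2 / (1 + n%:R ^+ 2) - 1) +i* (2 * n%:R / (1 + n%:R ^+ 2)).

Lemma circ_den (n : nat) : 0 < 1 + n%:R ^+ 2 :> R.
Proof. by rewrite ltr_pwDl // sqr_ge0. Qed.

Lemma circ_norm n : `|circ n| = 1.
Proof.
have d0 := circ_den n.
rewrite normc_def /= (_ : _ + _ = 1) ?sqrtr1 //.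
by move: (n%:R : R) d0 => t d0; field; rewrite gt_eqF.
Qed.

Lemma circ_inj : injective circ.
Proof.
move=> m n [] /(congr1 (fun x => x + 1)); rewrite !subrK => h _.
have : (1 + m%:R ^+ 2 : R) = 1 + n%:R ^+ 2.
  by apply: invr_inj; apply: (mulfI _ h); rewrite pnatr_eq0.
by move=> /addrI /eqP; rewrite eqrXn2 ?ler0n // eqr_nat => /eqP.
Qed.

Lemma poly_circ (p q : {poly R[i]}) : (forall z : R[i], `|z| = 1 -> p.[z] = q.[z]) -> p = q.
Proof.
move=> h; apply/eqP; rewrite -subr_eq0; apply/eqP.
apply: (@roots_geq_poly_eq0 _ _ [seq circ i | i <- iota 0 (size (p - q))]).
- apply/allP => _ /mapP[i _ ->]; rewrite rootE !hornerE h ?subrr //; exact: circ_norm.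
- by rewrite map_inj_uniq ?iota_uniq //; exact: circ_inj.
- by rewrite size_map size_iota.
Qed.

Local Notation cpoly p := (map_poly (real_complex R) p).

(** On the circle conjugation is inversion, which turns the conjugate of the
    symbol into a Laurent polynomial in z. *)
Lemma symbol_mask k (z : R[i]) : `|z| = 1 ->
  2 * z ^+ k.*2 * (- z * (cdf_dual_symbol k.*2.+1 (- z))^*) = (cpoly (mask_poly R k)).[z].
Proof.
move=> z1; have zw : z * z^* = 1 by rewrite -normCK z1 expr1n.
have z0 : z != 0 by rewrite -normr_eq0 z1 oner_eq0.
have wz : z^* = z^-1 by apply: (mulfI z0); rewrite zw mulfV.
rewrite /cdf_dual_symbol (_ : (1 + k.*2.+1) %/ 2 = k.+1)%N; last by rewrite add1n divn2 /= doubleK.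
rewrite (_ : k.*2.+1 %/ 2 = k)%N; last by rewrite divn2 /= uphalf_double.
have -> : (cpoly (mask_poly R k)).[z] = (-1) ^+ k / 16 ^+ k * ((1 - z) ^+ k.*2.+1 *
    \sum_(n < k.+1) ('C(k + n, n))%:R * ((1 + z) ^+ 2) ^+ n * (4 * z) ^+ (k - n)).
  rewrite /mask_poly map_polyZ hornerZ; congr (_ * _).
    by rewrite rmorphM fmorphV !rmorphXn rmorphN rmorph1 rmorph_nat.
  rewrite [map_poly _ _]rmorphM hornerM; congr (_ * _).
    by rewrite rmorphXn rmorphB rmorph1 /= map_polyX horner_exp !hornerE.
  rewrite /lowpass /bsum_hom rmorph_sum /= horner_sum; apply: eq_bigr => n _.
  rewrite !rmorphM !rmorphXn /= rmorphD /= rmorph1 map_polyZ map_polyX rmorph_nat /=.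
  by rewrite !hornerE /= ?rmorph_nat -polyC_natr hornerC.
have e1 : ((1 - z) / 2)^* = (1 - z^-1) / 2.
  by rewrite rmorphM fmorphV rmorph_nat rmorphB rmorph1 /= wz.
have e0 : ((- z) ^- k)^* = (- z^-1) ^- k by rewrite fmorphV rmorphXn rmorphN /= wz.
have e2 : (((1 - z) / 2) ^+ k.*2.+1)^* = ((1 - z^-1) / 2) ^+ k.*2.+1 by rewrite rmorphXn /= e1.
rewrite 2!rmorphM rmorph_sum /= big_mkord.
rewrite [X in - z * (X * _ * _)]e0 [X in - z * (_ * X * _)]e2.
have e3 : ((2 - - z - (- z)^-1) / 4)^* = (2 + z^-1 + z) / 4.
  rewrite opprK invrN opprK rmorphM fmorphV rmorph_nat; congr (_ / _).
  have cD (x y : R[i]) : (x + y)^* = x^* + y^* := rmorphD _ x y.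
  have cV : (z^-1)^* = z by rewrite -wz; move: (z) => -[x y]; congr (_ +i* _); exact: opprK.
  have c2 : (2 : R[i])^* = 2 := rmorph_nat _ 2.
  exact: (etrans (cD (2 + z) z^-1) (f_equal2 +%R (etrans (cD 2 z) (f_equal2 +%R c2 wz)) cV)).
under [X in _ * (_ * X)]eq_bigr => n _ do
  rewrite rmorphM rmorphXn [X in _ * X ^+ n]e3 [X in X * _]rmorph_nat subn1 /=.
have -> : \sum_(n < k.+1) ('C(k + n, n))%:R * (1 + z) ^+ 2 ^+ n * (4 * z) ^+ (k - n) =
   (4 * z) ^+ k * \sum_(n < k.+1) ('C(k + n, n))%:R * ((2 + z^-1 + z) / 4) ^+ n.
  rewrite mulr_sumr; apply: eq_bigr => n _.
  have -> : (4 * z) ^+ k = (4 * z) ^+ n * (4 * z) ^+ (k - n) by rewrite -exprD subnKC // leq_ord.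
  have -> : (1 + z) ^+ 2 = 4 * z * ((2 + z^-1 + z) / 4) by field; rewrite z0.
  by rewrite exprMn; ring.
set S := \sum_(n < _) _.
have -> : (- z^-1) ^- k = (-1) ^+ k * z ^+ k.
  by rewrite -exprVn invrN invrK [LHS]exprNn.
have -> : ((1 + - z^-1) / 2) ^+ k.*2.+1 = - (1 - z) ^+ k.*2.+1 / (z * z ^+ k.*2 * 2 * 4 ^+ k).
  have -> : (1 + - z^-1) / 2 = (-1) * ((1 - z) / (z * 2)) by field; rewrite z0.
  rewrite !exprMn exprVn exprS -mul2n exprM sqrrN !expr1n exprMn !exprS.
  rewrite (_ : 2 ^+ (2 * k) = 4 ^+ k); last by rewrite exprM -natrX.
  by field; rewrite !expf_neq0 ?pnatr_eq0 // z0.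
have -> : 16 ^+ k = 4 ^+ k * 4 ^+ k :> R[i] by rewrite -exprMn -natrM.
rewrite exprMn; field.
by rewrite !expf_neq0 ?pnatr_eq0 // z0.
Qed.

Variables (k : nat) (b : int -> R).
Hypothesis hb : is_quarklet_mask k.*2.+1 b.
Local Notation B := (mask_poly R k).

(** Two Laurent polynomials that agree on the circle have the same
    coefficients. *)
Lemma mask_coefE (j : int) : b j = if (0 <= j + k.*2%:Z) then B`_(absz (j + k.*2%:Z)) else 0.
Proof.
have [fb hz] := hb; have /finite_seqP[s hs] := fb.
pose M := (\max_(i <- s) absz i + k.*2)%N.
have bM (i : int) : b i != 0 -> (absz i <= M)%N.
  move=> bi; have is_ : i \in s by have : [set i | b i != 0] i by []; rewrite hs.
  by apply: leq_trans (leq_addr _ _); exact: (leq_bigmax_seq _ is_).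
pose P : {poly R} := \poly_(i < M.*2.+1) b (i%:Z - M%:Z).
have E : 'X^(k.*2) * P = 'X^M * B.
  apply: (map_poly_inj (real_complex R)); apply: poly_circ => z z1.
  have z0 : z != 0 by rewrite -normr_eq0 z1 oner_eq0.
  (* multiplication by powers of [z] makes both sides polynomial *)
  rewrite !rmorphM /= !map_polyXn !hornerM !hornerXn -symbol_mask // -hz //.
  rewrite (fsum_int (N := M.*2.+1) (c := M%:Z)); last first.
    move=> i; rewrite mulf_eq0 negb_or => /andP[bi _].
    have {}bi : b i != 0 by apply: contra_neq bi => ->.
    by have := bM i bi => iM; exists (absz (i + M%:Z)); lia.
  have -> : (cpoly P).[z] = \sum_(i < M.*2.+1) (b (i%:Z - M%:Z))%:C * z ^+ i.
    rewrite -(horner_poly _ (fun i => (b (i%:Z - M%:Z))%:C)); congr horner; apply/polyP => i.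
    by rewrite coef_map !coef_poly; case: ifP => // _; rewrite rmorph0.
  set S := \sum_(i < _) _ * z ^ _.
  rewrite (_ : 2 * z ^+ k.*2 * (2^-1 * S) = z ^+ k.*2 * S); last by field.
  rewrite mulrCA; congr (_ * _); rewrite mulr_sumr; apply: eq_bigr => i _.
  rewrite mulrCA; congr (_ * _); rewrite expfzDr // -exprnN mulrCA mulfV ?mulr1 //.
  by rewrite expf_neq0.
have kM : (k.*2 <= M)%N by exact: leq_addl.
have [jM|jM] := boolP (0 <= j + M%:Z); last first.
  rewrite (_ : (0 <= j + k.*2%:Z) = false); last by lia.
  by apply/eqP/negP => /negP /bM; lia.
have := congr1 (fun p : {poly R} => p`_(absz (j + M%:Z)%R + k.*2)%N) E.
rewrite !coefXnM ltnNge leq_addl /= addnK coef_poly => h.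
have -> : b j = (if (absz (j + M%:Z)%R < M.*2.+1)%N then b ((absz (j + M%:Z))%:Z - M%:Z) else 0).
  case: ltnP => jm; first by congr b; lia.
  by apply/eqP/negP => /negP /bM; lia.
rewrite h; case: ltnP => hm; first by rewrite (_ : (0 <= j + k.*2%:Z) = false) //; lia.
by rewrite (_ : (0 <= j + k.*2%:Z) = true); [congr (_`_ _); lia|lia].
Qed.

Lemma mask_sum (G : int -> R[i]) : \sum_(j \in [set: int]) (b j)%:C * G j =
  \sum_(i < size B) (B`_i)%:C * G (i%:Z - k.*2%:Z).
Proof.
rewrite (fsum_int (N := size B) (c := k.*2%:Z)); last first.
  move=> j; rewrite mulf_eq0 negb_or => /andP[bj _].
  have {}bj : b j != 0 by apply: contra_neq bj => ->.
  move: bj; rewrite mask_coefE; case: ifP => [h bj|]; last by rewrite eqxx.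
  exists (absz (j + k.*2%:Z)); last by lia.
  by rewrite ltnNge; apply: contra_neqN bj => /(nth_default 0).
apply: eq_bigr => i _; congr (_%:C * _); rewrite mask_coefE subrK.
by rewrite (_ : (0 <= i%:Z) = true).
Qed.

Lemma quarkletE q x : quarklet b q x =
  \sum_(i < size B) (B`_i)%:C * quark q (2 * x - (i%:Z - k.*2%:Z)%:~R).
Proof. exact: mask_sum. Qed.

End MaskCoefs.

(** * Polynomials acting by translation *)

Section TransPoly.
Context {R : realType}.
Local Open Scope complex_scope.
Implicit Types (f g : R -> R[i]) (p q : {poly R}).

(** The variable acts as the translation by 1, so that products of polynomials
    act by composition ([tsumM]). *)
Definition tsum p f : R -> R[i] := fun x => \sum_(i < size p) (p`_i)%:C * f (x - i%:R).

Lemma tsum_wide N p f x : (size p <= N)%N ->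
  tsum p f x = \sum_(i < N) (p`_i)%:C * f (x - i%:R).
Proof.
move=> pN; rewrite /tsum (big_ord_widen N (fun i => (p`_i)%:C * f (x - i%:R))) //.
rewrite big_mkcond; apply: eq_bigr => i _; case: ltnP => // h.
by rewrite nth_default // rmorph0 mul0r.
Qed.

Lemma tsumD p q f x : tsum (p + q) f x = tsum p f x + tsum q f x.
Proof.
pose N := maxn (size p) (size q).
rewrite !(@tsum_wide N) ?leq_maxl ?leq_maxr ?size_polyD // -big_split /=.
by apply: eq_bigr => i _; rewrite coefD rmorphD /= mulrDl.
Qed.

Lemma tsumZ c p f x : tsum (c *: p) f x = c%:C * tsum p f x.
Proof.
rewrite (@tsum_wide (size p)) ?size_scale_leq // /tsum mulr_sumr.
by apply: eq_bigr => i _; rewrite coefZ rmorphM /= mulrA.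
Qed.

Lemma tsumC c f x : tsum c%:P f x = c%:C * f x.
Proof.
rewrite (@tsum_wide 1) ?size_polyC_leq1 // big_ord1 coefC /= subr0 //.
Qed.

Lemma tsumMX p f x : tsum (p * 'X) f x = tsum p f (x - 1).
Proof.
rewrite (@tsum_wide (size p).+1); last by rewrite (leq_trans (size_polyMleq _ _)) // size_polyX addn2.
rewrite big_ord_recl coefMX /= rmorph0 mul0r add0r; apply: eq_bigr => i _.
by rewrite coefMX /= -natr1; congr (_ * f _); ring.
Qed.

Lemma tsumM p q f x : tsum (p * q) f x = tsum p (tsum q f) x.
Proof.
elim/poly_ind: p x => [|p c ih] x.
  by rewrite mul0r -polyC0 !tsumC rmorph0 !mul0r.
have -> : (p * 'X + c%:P) * q = p * q * 'X + c *: q by rewrite mulrDl mul_polyC mulrAC.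
by rewrite !tsumD !tsumMX ih tsumZ tsumC.
Qed.

Lemma tsumXn n f x : tsum 'X^n f x = f (x - n%:R).
Proof.
elim: n x => [|n ih] x; first by rewrite expr0 -polyC1 tsumC rmorph1 mul1r subr0.
by rewrite exprSr tsumMX ih; congr f; rewrite -natr1; ring.
Qed.

Lemma tsum1X f x : tsum (1 - 'X) f x = f x - f (x - 1).
Proof.
rewrite tsumD -[1]polyC1 tsumC rmorph1 mul1r -scaleN1r tsumZ -['X]expr1 tsumXn.
by rewrite rmorphN rmorph1 mulN1r.
Qed.

Lemma tsum_sum (I : Type) (s : seq I) (P : I -> {poly R}) f x :
  tsum (\sum_(i <- s) P i) f x = \sum_(i <- s) tsum (P i) f x.
Proof.
elim: s => [|i s ih]; first by rewrite !big_nil -polyC0 tsumC rmorph0 mul0r.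
by rewrite !big_cons tsumD ih.
Qed.

Lemma tsum_comp2 p f x : tsum (p \Po 'X^2) f x = \sum_(i < size p) (p`_i)%:C * f (x - (i.*2)%:R).
Proof.
rewrite comp_polyE tsum_sum; apply: eq_bigr => i _.
by rewrite -exprM mul2n tsumZ tsumXn.
Qed.

Lemma eq_tsum p f g x : (forall y, f y = g y) -> tsum p f x = tsum p g x.
Proof. by move=> h; apply: eq_bigr => i _; rewrite h. Qed.

Lemma tsum_shift p f (t : R) x : tsum p (fun y => f (y - t)) x = tsum p f (x - t).
Proof. by apply: eq_bigr => i _; congr (_ * f _); ring. Qed.

Lemma L2_tsum p f : L2 f -> L2 (tsum p f).
Proof. by move=> lf; apply: L2_sum => i; apply: L2Z; exact: L2_shift. Qed.

Lemma nrm_shift f (t : R) : L2 f -> nrm (fun x => f (x - t)) = nrm f.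
Proof. by move=> lf; rewrite /nrm N2_shift. Qed.

Lemma sqrt_sqcC (c : R) : Num.sqrt (sqc c%:C) = `|c|.
Proof. by rewrite /sqc /= expr0n addr0 sqrtr_sqr. Qed.

Lemma nrm_tsum p f : L2 f -> nrm (tsum p f) <= l1norm p * nrm f.
Proof.
move=> lf; apply: (le_trans (nrm_sum _ _)) => [i|]; first by apply: L2Z; exact: L2_shift.
rewrite /l1norm mulr_suml; apply: ler_sum => i _.
by rewrite nrmZ ?sqrt_sqcC ?nrm_shift //; exact: L2_shift.
Qed.

Lemma quark_L2 (n : nat) : L2 (quark n : R -> R[i]).
Proof.
pose m (x : R) : R := x ^+ n * \1_(`[0, 1[) x.
have mm : rmeas m.
  apply: measurable_funM; first by apply: measurable_funX; exact: measurable_id.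
  by apply: measurable_indic; exact: measurable_itv.
have -> : (quark n : R -> R[i]) = fun x => (m x)%:C * (\1_(`[0, 1[) x)%:C.
  apply/funext => x; rewrite -rmorphM /= /quark /m -mulrA; congr (_%:C); congr (_ * _).
  by rewrite indicE; case: (_ \in _); rewrite ?mulr1 ?mulr0.
apply: (L2_bddM (M := 1)); last exact: L2_ind.
  by split => //=; exact: measurable_cst.
move=> x.
rewrite /sqc /= expr0n addr0 /m indicE; case: (boolP (x \in _)); last by rewrite mulr0 expr0n.
rewrite inE /= in_itv /= => /andP[x0 x1]; rewrite mulr1 -exprM.
by rewrite exprn_ile1 // ltW.
Qed.

Lemma scale_neq0 (j : int) : (2 ^ j : R) != 0.
Proof. by rewrite expfz_neq0 // pnatr_eq0. Qed.

Lemma L2_scale (a : R) f : a != 0 -> L2 f -> L2 (fun x => f (a * x)).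
Proof. by move=> a0 /(L2_affine 0 a0); under eq_fun do rewrite addr0. Qed.

Lemma L2_dilate j k f : L2 f -> L2 (dilate j k f).
Proof. by move=> lf; apply: L2Z; exact: (L2_affine (- k%:~R) (scale_neq0 j) lf). Qed.

Lemma dilate_scale (j k m : int) f x :
  dilate j k f (2 ^ m * x) = (2 `^ (- m%:~R / 2))%:C * dilate (j + m) k f x.
Proof.
rewrite /dilate [RHS]mulrA -rmorphM /= -powRD; last by apply/implyP; rewrite pnatr_eq0.
by congr ((_ `^ _)%:C * f _); [rewrite intrD; field|rewrite expfzDr ?pnatr_eq0 // mulrA].
Qed.

Lemma dilate0 (k : int) f x : dilate 0 k f x = f (x - k%:~R).
Proof. by rewrite /dilate mul0r powRr0 rmorph1 mul1r expr0z mul1r. Qed.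

Lemma shift_dilate (j k : int) f x :
  f (2 ^ j * x - k%:~R) = (2 `^ (- j%:~R / 2))%:C * dilate j k f x.
Proof. by rewrite -dilate0 dilate_scale add0r. Qed.

Definition dilates (f : R -> R[i]) : set (R -> R[i]) := [set g | exists j k : int, g = dilate j k f].

Lemma dilates_L2 f : L2 f -> dilates f `<=` L2.
Proof. by move=> lf _ [j [k ->]]; exact: L2_dilate. Qed.

Lemma span_comp (A B : set (R -> R[i])) (s : R -> R) f :
  (forall g, A g -> lin_span B (fun x => g (s x))) -> lin_span A f -> lin_span B (fun x => f (s x)).
Proof. by move=> h [n [c [g [Ag ->]]]]; apply: span_sum => i; apply: spanZ; exact: h. Qed.

Lemma span_dilates_scale (m : int) f g : lin_span (dilates f) g ->
  lin_span (dilates f) (fun x => g (2 ^ m * x)).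
Proof.
apply: span_comp => _ [j [k ->]]; under eq_fun do rewrite dilate_scale.
by apply: spanZ; apply: sub_span; exists (j + m), k.
Qed.

Lemma span_shift_dilates (j k : int) f : lin_span (dilates f) (fun x => f (2 ^ j * x - k%:~R)).
Proof.
by under eq_fun do rewrite shift_dilate; apply: spanZ; apply: sub_span; exists j, k.
Qed.

Lemma clspan_nrm (A : set (R -> R[i])) f : A `<=` L2 -> L2 f ->
  (forall e : R, 0 < e -> exists2 g, lin_span A g & nrm (fun x => f x - g x) < e) -> closed_span A f.
Proof.
move=> AL lf h; apply/clP; first exact: span_L2.
split=> // e e0; have [|g Ag hg] := h (Num.sqrt e); first by rewrite sqrtr_gt0.
by exists g => //; move: hg; rewrite /nrm ltr_sqrt.
Qed.

(** Closed spans can be compared after a dilation, because dilations multiply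
    all norms by the same factor. *)
Lemma clspan_comp (A B : set (R -> R[i])) (a : R) f : A `<=` L2 -> B `<=` L2 -> a != 0 ->
  (forall g, A g -> lin_span B (fun x => g (a * x))) -> closed_span A f ->
  closed_span B (fun x => f (a * x)).
Proof.
move=> AL BL a0 h; have sL := span_L2 AL.
move=> /(clP _ sL)[lf hf]; apply/clP; first exact: span_L2.
split; first exact: L2_scale.
move=> e e0; have [|g Ag hg] := hf (`|a| * e); first by rewrite mulr_gt0 // normr_gt0.
exists (fun x => g (a * x)); first exact: span_comp h Ag.
have ld : L2 (fun x => f x - g x) by apply: L2B => //; exact: sL.
move: hg; rewrite (N2_affine 0 a0 ld) ltr_pM2l ?normr_gt0 //.
by under eq_fun do rewrite !addr0.
Qed.

End TransPoly.

(** * Totality of the dilated quarklets *)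

Section Density.
Context {R : realType}.
Local Open Scope complex_scope.
Implicit Types (f g : R -> R[i]) (p q : {poly R}).
Variables (k : nat) (b : int -> R).
Hypothesis hb : is_quarklet_mask k.*2.+1 b.
Local Notation B := (mask_poly R k).
Local Notation phi := (quark 0 : R -> R[i]).
Local Notation psi := (quarklet b 0).

Lemma quarklet_tsum n (x : R) : quarklet b n (x - k%:R) = tsum B (quark n) (2 * x).
Proof.
rewrite (quarkletE hb) /tsum; apply: eq_bigr => i _; congr (_ * quark n _).
by rewrite intrB -!pmulrn -mul2n natrM; ring.
Qed.

Lemma quarklet_L2 n : L2 (quarklet b n).
Proof.
have -> : quarklet b n = fun x => tsum B (quark n) (2 * x + 2 * k%:R).
  by apply/funext => x; rewrite -mulrDr -quarklet_tsum addrK.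
by apply: L2_affine; rewrite ?pnatr_eq0 //; apply: L2_tsum; exact: quark_L2.
Qed.

Lemma phi_refine (x : R) : phi x = tsum (1 + 'X) phi (2 * x).
Proof.
rewrite tsumD -polyC1 tsumC -['X]expr1 tsumXn rmorph1 mul1r /quark !expr0 !mul1r -rmorphD /=.
congr (_%:C); rewrite !indicE.
have E y : (y \in `[0, 1[%classic) = (0 <= y < 1) :> bool.
  by apply/idP/idP; rewrite inE /= in_itv.
rewrite !E; case: (leP 0 x) => h1; case: (ltP x 1) => h2; case: (leP 0 (2 * x)) => h3;
  case: (ltP (2 * x) 1) => h4; case: (leP 0 (2 * x - 1)) => h5; case: (ltP (2 * x - 1) 1) => h6;
  rewrite /= ?addr0 ?add0r //; exfalso; lra.
Qed.

(** The identity [mask_split] read on functions: 1 + X refines phi, and B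
    refines the quarklet. *)
Lemma tsum_split (c : {poly R}) (x : R)
   (u := 2%:R *: (odd_poly c * even_poly B - even_poly c * odd_poly B))
   (v := 2%:R *: (even_poly c - odd_poly c)) :
  4%:R%:C * tsum c phi (2 * x - (k.*2)%:R) = tsum u phi x + tsum v (fun y => psi (y - k%:R)) x.
Proof.
have coarse p q f g : (forall y, f y = tsum p g (2 * y)) ->
    forall y, tsum (p * (q \Po 'X^2)) g (2 * y) = tsum q f y.
  move=> h y; rewrite mulrC tsumM tsum_comp2; apply: eq_bigr => i _; congr (_ * _).
  by rewrite h; congr (tsum p g); rewrite -mul2n natrM; ring.
have := congr1 (fun p => tsum p phi (2 * x)) (mask_split k c); rewrite -/u -/v.
rewrite tsumZ ['X^_ * c]mulrC tsumM tsumD => h; rewrite -tsum_shift.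
rewrite (eq_tsum c (g := tsum 'X^(k.*2) phi)); last by move=> y; rewrite tsumXn.
rewrite h; congr (_ + _); first by apply: coarse => y; exact: phi_refine.
by apply: coarse => y; exact: quarklet_tsum.
Qed.

Let delta := tsum ((1 - 'X) ^+ k.*2.+1) phi.
Let lphi : L2 phi := @quark_L2 R 0.
Let ldelta : L2 delta := L2_tsum _ lphi.
Let lpsi : L2 psi := quarklet_L2 0.

(** The coarse part of a fine translate of [delta] is a combination of
    translates of [delta] whose coefficients sum to at most 2, against the
    factor 4 on the left. *)
Lemma delta_scale (m : int) : exists (i : nat) (m' : int) (e v : {poly R}),
  l1norm e <= 2 /\ forall x : R, 4%:R%:C * delta (2 * x - m%:~R) =
    tsum e delta (x - m'%:~R) + tsum v (fun y => psi (y - k%:R)) (x - m'%:~R).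
Proof.
pose i := absz (m %% 2)%Z; pose m' := ((m %/ 2)%Z - k%:Z).
have i2 : (i < 2)%N by rewrite /i; lia.
have em : m = k.*2%:Z + i%:Z + 2 * m' by rewrite /m' /i; lia.
clearbody i m'; have [e [e2 he]] := mask_split_pow R k i2.
move: he; cbv zeta => he.
exists i, m', e; exists (2%:R *: (even_poly ('X^i * (1 - 'X) ^+ k.*2.+1) - odd_poly ('X^i * (1 - 'X) ^+ k.*2.+1))).
split=> // x; have := tsum_split ('X^i * (1 - 'X) ^+ k.*2.+1) (x - m'%:~R).
cbv zeta; rewrite he tsumM tsumXn tsumM => <-; congr (_ * delta _).
by rewrite em !intrD intrM -!pmulrn; ring.
Qed.

Let r : R := Num.sqrt 2 / 2.

Lemma half_sqrt2_lt1 : 0 <= r < 1.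
Proof.
rewrite /r divr_ge0 //= ltr_pdivrMr // mul1r.
rewrite -(@ltr_pXn2r _ 2) ?nnegrE // sqr_sqrtr //; lra.
Qed.

(** Per scale, the coefficients contribute a factor 2 / 4 and the dilation a
    factor sqrt 2. *)
Lemma delta_near (n : nat) (m : int) : exists2 g, lin_span (dilates psi) g &
  nrm (fun x => delta (x - m%:~R) - g x) <= r ^+ n * nrm delta.
Proof.
have DL := dilates_L2 lpsi.
have sL := span_L2 DL.
elim: n m => [|n ih] m.
  exists (fun=> 0); first exact: span0.
  rewrite expr0 mul1r; under eq_fun do rewrite subr0.
  by rewrite nrm_shift.
have [i [m' [e [v [e2 he]]]]] := delta_scale m.
have [g hg] : exists g : nat -> R -> R[i], forall l, lin_span (dilates psi) (g l) /\
    nrm (fun x => delta (x - (m' + l%:Z)%:~R) - g l x) <= r ^+ n * nrm delta.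
  have h (l : nat) : exists g, lin_span (dilates psi) g /\
    nrm (fun x => delta (x - (m' + l%:Z)%:~R) - g x) <= r ^+ n * nrm delta.
    by have [g h1 h2] := ih (m' + l%:Z); exists g.
  by have [g hg] := choice h; exists g.
pose w (l : nat) x := delta (x - (m' + l%:Z)%:~R) - g l x.
have lw l : L2 (w l) by apply: L2B; [exact: L2_shift|apply: sL; case: (hg l)].
pose G (x : R) := \sum_(l < size e) (e`_l)%:C * g l x + tsum v (fun y => psi (y - k%:R)) (x - m'%:~R).
have sG : lin_span (dilates psi) G.
  apply: spanD; first by apply: span_sum => l; apply: spanZ; case: (hg l).
  apply: span_sum => l; apply: spanZ.
  have := span_shift_dilates 0 (m' + l%:Z + k%:Z) psi; congr lin_span.
  by apply/funext => x; rewrite expr0z mul1r !intrD -!pmulrn; congr psi; ring.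
exists (fun x => 4^-1%:C * G (2^-1 * x)).
  by apply: spanZ; have := span_dilates_scale (-1) sG; rewrite exprN1.
pose W x := \sum_(l < size e) (e`_l)%:C * w l x.
have lW : L2 W by apply: L2_sum => l; apply: L2Z.
have -> : (fun x => delta (x - m%:~R) - 4^-1%:C * G (2^-1 * x)) = fun x => 4^-1%:C * W (2^-1 * x).
  apply/funext => x; have := he (2^-1 * x).
  rewrite mulrA mulfV ?pnatr_eq0 // mul1r => h.
  have -> : delta (x - m%:~R) = 4^-1%:C * (4%:R%:C * delta (x - m%:~R)).
    by rewrite mulrA -rmorphM /= mulVf ?pnatr_eq0 // rmorph1 mul1r.
  rewrite h -mulrBr /G opprD addrACA subrr addr0; congr (_ * _).
  rewrite /tsum -sumrB; apply: eq_bigr => l _; rewrite -mulrBr /w; congr (_ * (delta _ - _)).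
  by rewrite intrD -pmulrn; ring.
have lW2 : L2 (fun x => W (2^-1 * x)) by apply: L2_scale => //; rewrite invr_eq0 pnatr_eq0.
rewrite nrmZ // sqrt_sqcC.
have -> : nrm (fun x => W (2^-1 * x)) = Num.sqrt 2 * nrm W.
  have h2 : (2 : R) != 0 by rewrite pnatr_eq0.
  rewrite (nrm_affine 0 h2 lW2) ger0_norm //; congr (_ * nrm _).
  by apply/funext => x; rewrite addr0 mulrA mulVf ?mul1r.
have nW : nrm W <= 2 * (r ^+ n * nrm delta).
  apply: (@le_trans _ _ (\sum_(l < size e) `|e`_l| * (r ^+ n * nrm delta))).
    apply: le_trans (nrm_sum _ _) _ => [l|]; first exact: L2Z.
    apply: ler_sum => l _; rewrite nrmZ // sqrt_sqcC ler_wpM2l //.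
    by have [_ h] := hg l; exact: h.
  rewrite -mulr_suml ler_wpM2r // mulr_ge0 ?nrm_ge0 ?exprn_ge0 //.
  by have /andP[] := half_sqrt2_lt1.
rewrite ger0_norm ?invr_ge0 // exprS -mulrA {1}/r.
move: nW (sqrtr_ge0 (2 : R)); move: (nrm W) (r ^+ n * nrm delta) (Num.sqrt 2) => A D s hA s0.
have : s * A <= s * (2 * D) by rewrite ler_wpM2l.
lra.
Qed.

Lemma delta_cl (m : int) : closed_span (dilates psi) (fun x => delta (x - m%:~R)).
Proof.
apply: clspan_nrm; [exact: dilates_L2|exact: L2_shift|] => e e0.
have /andP[r0 r1] := half_sqrt2_lt1.
have c : r ^+ n * nrm delta @[n --> \oo] --> (0 : R).
  rewrite -(mul0r (nrm delta)); apply: cvgM; last exact: cvg_cst.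
  by apply: cvg_expr; rewrite ger0_norm.
move/cvgrPdist_lt : c => /(_ e e0)[N _ HN].
have [g sg hg] := delta_near N m; exists g => //; apply: le_lt_trans hg _.
have := HN N (leqnn N); rewrite sub0r normrN; exact: le_lt_trans (ler_norm _).
Qed.

Lemma sum_phi (N : nat) (x : R) :
  \sum_(i < N) phi (x - i%:R) = (\1_(`[0, N%:R[) x : R)%:C.
Proof.
have E (a c y : R) : \1_(`[a, c[) y = (a <= y < c)%R%:R :> R.
  by rewrite indicE; congr (nat_of_bool _)%:R; apply/idP/idP; rewrite inE /= in_itv.
elim: N => [|N ih].
  by rewrite big_ord0 E; case: (leP 0 x) => h1; case: (ltP x 0) => h2 //=; rewrite ?rmorph0 //; exfalso; lra.
rewrite big_ord_recr ih /= /quark expr0 mul1r -rmorphD /= !E -natr1; congr (_%:C).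
have := ler0n R N; clear ih; move: (N%:R : R) => n n0.
case: (leP 0 x) => h1; case: (ltP x n) => h2; case: (leP 0 (x - n)) => h3;
  case: (ltP (x - n) 1) => h4; case: (ltP x (n + 1)) => h5; rewrite /= ?addr0 ?add0r //; exfalso; lra.
Qed.

Lemma nrm_sum_phi (N : nat) : nrm (fun x => \sum_(i < N) phi (x - i%:R)) = Num.sqrt N%:R.
Proof.
rewrite /nrm /N2; congr Num.sqrt.
have -> : (fun x : R => sqc (\sum_(i < N) phi (x - i%:R))) = \1_(`[0, N%:R[).
  apply/funext => x; rewrite sum_phi /sqc /= expr0n addr0 indicE.
  by case: (_ \in _); rewrite ?expr1n ?expr0n.
by rewrite rint_ind ?subr0 // ler0n.
Qed.

(** A translate of the difference of order s differs from the average of N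
    translates by combinations of differences of order s + 1, which lie in the
    closed span; and the average has norm of order N^(-1/2), since the
    translates of phi have disjoint supports. *)
Lemma average_step (s : nat) :
  (forall m : int, closed_span (dilates psi) (fun x => tsum ((1 - 'X) ^+ s.+1) phi (x - m%:~R))) ->
  forall m : int, closed_span (dilates psi) (fun x => tsum ((1 - 'X) ^+ s) phi (x - m%:~R)).
Proof.
move=> h m; have DL := dilates_L2 lpsi; have sL := span_L2 DL.
set u := tsum ((1 - 'X) ^+ s) phi; have lu : L2 u by exact: L2_tsum.
have tel (i : nat) : closed_span (dilates psi) (fun x => u (x - m%:~R) - u (x - m%:~R - i%:R)).
  elim: i => [|i ih].
    apply: spanI => //; rewrite (_ : (fun x => _) = (fun=> 0)); first exact: span0.
    by apply/funext => x; rewrite subr0 subrr.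
  have := clspanD DL ih (h (m + i%:Z)); congr closed_span; apply/funext => x.
  rewrite exprS tsumM tsum1X -/u intrD -pmulrn opprD addrA addrA subrK.
  by congr (_ - u _); rewrite -natr1; ring.
apply: (cl_idem sL); apply/clP => [f [] //|]; split; first exact: L2_shift.
move=> e e0; pose C := l1norm ((1 - 'X) ^+ s : {poly R}).
have C0 : 0 <= C by apply: sumr_ge0.
(* the squared norm of the average is at most C^2 / N *)
pose n := (Num.truncn (C ^+ 2 / e)).+1; pose N := (n)%N.
have N0 : N%:R != 0 :> R by rewrite pnatr_eq0.
have Np : 0 < N%:R :> R by rewrite ltr0n.
exists (fun x => (N%:R^-1)%:C * \sum_(i < N) (u (x - m%:~R) - u (x - m%:~R - i%:R))).
  apply: clspanZ => //; elim: (N) => [|N' ih].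
    apply: spanI => //; rewrite (_ : (fun x => _) = (fun=> 0)); first exact: span0.
    by apply/funext => x; rewrite big_ord0.
  by under eq_fun do rewrite big_ord_recr /=; apply: clspanD.
pose Phi x := \sum_(i < N) phi (x - i%:R).
have lPhi : L2 Phi by apply: L2_sum => i; exact: L2_shift.
have E x : \sum_(i < N) u (x - i%:R) = tsum ((1 - 'X) ^+ s) Phi x.
  transitivity (tsum (\sum_(i < N) 'X^i) u x).
    by rewrite tsum_sum; apply: eq_bigr => i _; rewrite tsumXn.
  rewrite -tsumM mulrC tsumM; apply: eq_tsum => y; rewrite tsum_sum.
  by apply: eq_bigr => i _; rewrite tsumXn.
rewrite (_ : (fun x => _) = fun x => (N%:R^-1)%:C * tsum ((1 - 'X) ^+ s) Phi (x - m%:~R)); last first.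
  apply/funext => x; rewrite -E sumrB mulrBr sumr_const card_ord.
  rewrite (_ : (N%:R^-1)%:C * (u (x - m%:~R) *+ N) = u (x - m%:~R)); first by rewrite opprB addrC subrK.
  by rewrite mulrnAr -mulrnAl -rmorphMn /= -[_ *+ N]mulr_natr mulVf // rmorph1 mul1r.
have lT : L2 (fun x => tsum ((1 - 'X) ^+ s) Phi (x - m%:~R)) by apply: L2_shift; exact: L2_tsum.
rewrite N2Z //.
have hT : nrm (fun x => tsum ((1 - 'X) ^+ s) Phi (x - m%:~R)) <= C * Num.sqrt N%:R.
  rewrite (@nrm_shift _ (tsum ((1 - 'X) ^+ s) Phi)); last exact: L2_tsum.
  by apply: le_trans (nrm_tsum _ lPhi) _; rewrite /Phi nrm_sum_phi.
have hT2 : N2 (fun x => tsum ((1 - 'X) ^+ s) Phi (x - m%:~R)) <= C ^+ 2 * N%:R.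
  rewrite -nrm_sqr -[N%:R in leRHS]sqr_sqrtr ?ler0n // -exprMn.
  by rewrite ler_pXn2r ?nnegrE ?nrm_ge0 // mulr_ge0.
rewrite {1}/sqc /= expr0n addr0.
apply: (@le_lt_trans _ _ (N%:R^-1 ^+ 2 * (C ^+ 2 * N%:R))); first by rewrite ler_wpM2l // sqr_ge0.
have fe (c d : R) : d != 0 -> d^-1 ^+ 2 * (c ^+ 2 * d) = c ^+ 2 / d by move=> d0; field.
rewrite fe //.
rewrite ltr_pdivrMr // mulrC -ltr_pdivrMr //; exact: truncnS_gt.
Qed.

(** All differences in [delta] are removed in turn. *)
Lemma phi_cl (m : int) : closed_span (dilates psi) (fun x => phi (x - m%:~R)).
Proof.
have h (s : nat) : (s <= k.*2.+1)%N ->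
    forall m : int, closed_span (dilates psi) (fun x => tsum ((1 - 'X) ^+ (k.*2.+1 - s)) phi (x - m%:~R)).
  elim: s => [|s ih] sk j; first by rewrite subn0; exact: delta_cl.
  apply: average_step => j'; rewrite -subSn // subSS; apply: ih; exact: ltnW.
have := h k.*2.+1 (leqnn _) m; rewrite subnn; congr closed_span; apply/funext => x.
by rewrite expr0 -polyC1 tsumC rmorph1 mul1r.
Qed.

(** The closed span is invariant under dyadic dilations, so it contains all
    dyadic step functions. *)
Lemma quarklet_total f : L2 f -> closed_span (dilates psi) f.
Proof.
move=> /step_dense; have DL := dilates_L2 lpsi; have sL := span_L2 DL.
have h g : dyads g -> closed_span (dilates psi) g.
  move=> [J [m ->]]; have a0 : (2 ^+ J : R) != 0 by rewrite expf_neq0 // pnatr_eq0.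
  apply: (clspan_comp (a := 2 ^+ J) DL DL a0 _ (phi_cl m)) => g' [j [l ->]].
  exact: (span_dilates_scale J%:Z (sub_span (ex_intro _ j (ex_intro _ l erefl)))).
move=> hf; apply: (cl_idem sL); apply: clS hf => g [n [c [w [hw ->]]]].
elim: n c w hw => [|n ih] c w hw.
  apply: spanI => //; rewrite (_ : (fun x => _) = (fun=> 0)); first exact: span0.
  by apply/funext => x; rewrite big_ord0.
under eq_fun do rewrite big_ord_recr /=; apply: clspanD => //.
  by apply: ih => i; exact: hw.
by apply: clspanZ => //; exact: h.
Qed.

Definition base_set : set (R -> R[i]) :=
  [set f | (exists m : int, f = fun x => phi (x - m%:~R)) \/
           (exists (j : nat) (m : int), f = dilate j%:Z m psi)].

Lemma phi_fine (m : int) : lin_span base_set (fun x => phi (2 * x - m%:~R)).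
Proof.
pose i := absz (m %% 2)%Z; pose m' := ((m %/ 2)%Z - k%:Z).
have em : m = k.*2%:Z + i%:Z + 2 * m' by rewrite /m' /i; lia.
clearbody i m'; have hs := tsum_split ('X^i); move: hs; cbv zeta => hs.
rewrite (_ : (fun x => _) = (fun x => 4^-1%:C * (4%:R%:C * tsum 'X^i phi (2 * (x - m'%:~R) - (k.*2)%:R)))); last first.
  apply/funext => x; rewrite mulrA -rmorphM /= mulVf ?pnatr_eq0 // rmorph1 mul1r tsumXn.
  by congr phi; rewrite em !intrD intrM -!pmulrn; ring.
apply: spanZ; under eq_fun do rewrite hs; apply: spanD.
  apply: span_sum => l; apply: spanZ; apply: sub_span; left; exists (m' + l%:Z).
  by apply/funext => x; rewrite intrD -pmulrn; congr phi; ring.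
apply: span_sum => l; apply: spanZ; apply: sub_span; right; exists 0%N, (m' + l%:Z + k%:Z).
by apply/funext => x; rewrite dilate0 !intrD -!pmulrn; congr psi; ring.
Qed.

(** From fine to coarse scales, each step splits off wavelets. *)
Lemma base_total f : L2 f -> closed_span base_set f.
Proof.
move=> /step_dense; apply: clS => g; rewrite -[X in lin_span X g]/(dyads).
have h (J : nat) (m : int) : lin_span base_set (fun x => phi (2 ^+ J * x - m%:~R)).
  elim: J m => [|J ih] m.
    by apply: sub_span; left; exists m; apply/funext => x; rewrite expr0 mul1r.
  have := phi_fine m => /(span_comp (s := fun x => 2 ^+ J * x) (B := base_set)).
  have -> : (fun x => phi (2 * (2 ^+ J * x) - m%:~R)) = (fun x => phi (2 ^+ J.+1 * x - m%:~R)).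
    by apply/funext => x; rewrite exprS mulrA.
  apply=> _ [[l ->]|[j [l ->]]]; first exact: ih.
  under eq_fun do rewrite (dilate_scale j l J%:Z); apply: spanZ; apply: sub_span; right.
  by exists (j + J)%N, l.
by move=> hg; apply: (span_comp (s := id) _ hg) => _ [J [m ->]]; exact: h.
Qed.

End Density.

(** * Quarks against quarklets at one scale *)

Section Projection.
Context {R : realType}.
Local Open Scope complex_scope.
Implicit Types (f g h : R -> R[i]).

Lemma dot_affine (a c : R) f g : a != 0 -> L2 f -> L2 g ->
  L2dot f g = `|a|%:C * L2dot (fun x => f (a * x + c)) (fun x => g (a * x + c)).
Proof. by move=> a0 lf lg; rewrite !dotE (cint_affine c a0) //; exact: citg_dot. Qed.

Lemma dot_shift (t : R) f g : L2 f -> L2 g ->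
  L2dot (fun x => f (x + t)) (fun x => g (x + t)) = L2dot f g.
Proof.
move=> lf lg; rewrite (dot_affine t (oner_neq0 R) lf lg) normr1 rmorph1 mul1r.
by congr L2dot; apply/funext => x; rewrite mul1r.
Qed.

Lemma dot_disjoint f g : (forall x, f x = 0 \/ g x = 0) -> L2dot f g = 0.
Proof.
move=> h; rewrite dotE (_ : (fun x => _) = (fun=> 0)) ?cint0 //; apply/funext => x.
by case: (h x) => ->; rewrite ?rmorph0 ?mul0r ?mulr0.
Qed.

Lemma dotZr_real (c : R) f h : L2 f -> L2 h -> L2dot h (fun x => c%:C * f x) = c%:C * L2dot h f.
Proof. by move=> lf lh; rewrite dotZr //; congr (_ * _); apply: eqcP => //=; rewrite oppr0. Qed.

(** Gram-Schmidt, also for linearly dependent families: a remainder [e] of norm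
    zero needs no correction. *)
Lemma finite_projection (n : nat) (g : nat -> R -> R[i]) h : (forall q, L2 (g q)) -> L2 h ->
  exists c : nat -> R[i], forall q, (q < n)%N ->
    L2dot (fun x => h x - \sum_(i < n) c i * g i x) (g q) = 0.
Proof.
move=> lg; elim: n h => [|n ih] h lh; first by exists (fun=> 0).
have lS (c : nat -> R[i]) m : L2 (fun x => \sum_(i < m) c i * g i x).
  by apply: L2_sum => i; exact: L2Z.
have [c hc] := ih h lh; have [d hd] := ih (g n) (lg n).
pose r x := h x - \sum_(i < n) c i * g i x.
pose e x := g n x - \sum_(i < n) d i * g i x.
have lr : L2 r by exact: L2B. have le : L2 e by exact: L2B.
have rS : L2dot r (fun x => \sum_(i < n) d i * g i x) = 0.
  rewrite dot_sumr //; last by move=> i; exact: L2Z.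
  by rewrite big1 // => i _; rewrite dotZr // hc ?mulr0.
have eS : L2dot e (fun x => \sum_(i < n) d i * g i x) = 0.
  rewrite dot_sumr //; last by move=> i; exact: L2Z.
  by rewrite big1 // => i _; rewrite dotZr // hd ?mulr0.
have gE : g n = fun x => e x + \sum_(i < n) d i * g i x by apply/funext => x; rewrite subrK.
have rg : L2dot r (g n) = L2dot r e by rewrite [in LHS]gE dotDr // rS addr0.
have eg : L2dot e (g n) = L2dot e e by rewrite [in LHS]gE dotDr // eS addr0.
pose a := L2dot r e / L2dot e e.
exists (fun i => if i == n then a else c i - a * d i) => q qn.
have -> : (fun x => h x - \sum_(i < n.+1) (if i == n :> nat then a else c i - a * d i) * g i x) =
    fun x => r x - a * e x.
  apply/funext => x; rewrite big_ord_recr /= eqxx /r /e.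
  have -> : \sum_(i < n) (if i == n :> nat then a else c i - a * d i) * g i x =
      \sum_(i < n) c i * g i x - a * \sum_(i < n) d i * g i x.
    rewrite mulr_sumr -sumrB; apply: eq_bigr => i _.
    by rewrite (ltn_eqF (ltn_ord i)) mulrBl mulrA.
  by move: (\sum_(i < n) _) (\sum_(i < n) _) => u v; ring.
rewrite dotBl //; last exact: L2Z.
rewrite dotZl //; case: (ltngtP q n) => [q1|q1|->].
- by rewrite hc // hd // mulr0 subrr.
- by have := leq_trans q1 (qn : (q <= n)%N); rewrite ltnn.
rewrite rg eg /a; have [z|nz] := eqVneq (L2dot e e) 0; last by rewrite divfK // subrr.
rewrite z mulr0 subr0; apply: sqc_eq0; apply/eqP; rewrite eq_le; apply/andP; split.
  apply: le_trans (cauchy_schwarz lr le) _; move: z; rewrite dot_self => -[->].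
  by rewrite mulr0.
by rewrite /sqc addr_ge0 // sqr_ge0.
Qed.

End Projection.

Section PolyDiff.
Variable F : fieldType.
Implicit Types q : {poly F}.

Lemma size_poly_diff q : (size (q \Po ('X + 1) - q)%R <= (size q).-1)%N.
Proof.
elim/poly_ind: q => [|q c ih]; first by rewrite comp_poly0 subr0 size_poly0.
have [->|q0] := eqVneq q 0.
  by rewrite mul0r add0r comp_polyC subrr size_poly0.
have -> : (q * 'X + c%:P) \Po ('X + 1) - (q * 'X + c%:P) =
    (q \Po ('X + 1) - q) * 'X + (q \Po ('X + 1)).
  by rewrite comp_polyD comp_polyM comp_polyX comp_polyC; ring.
rewrite size_MXaddC (negPf q0) /=.
have s1 : (size q > 0)%N by rewrite size_poly_gt0.
apply: (leq_trans (size_polyD _ _)); rewrite geq_max; apply/andP; split.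
  by apply: leq_trans (size_polyMleq _ _) _; rewrite size_polyX addn2 /=; apply: leq_ltn_trans (ih) _; rewrite prednK.
rewrite size_comp_poly2 //; exact: size_XaddC.
Qed.

End PolyDiff.

Section Perp.
Context {R : realType}.
Local Notation mu := (@lebesgue_measure R).
Local Open Scope complex_scope.
Implicit Types (f g h : R -> R[i]).
Variables (k : nat) (b : int -> R).
Hypothesis hb : is_quarklet_mask k.*2.+1 b.
Local Notation B := (mask_poly R k).
Local Notation phi := (quark 0 : R -> R[i]).
Variable p : nat.

(** The double orthogonal complement of the dilated translates at scale [j]. It
    contains their closed span, and inner products alone decide membership. *)
Definition perp2 (j : int) (g : nat -> R -> R[i]) : set (R -> R[i]) :=
  [set f | L2 f /\ forall rho, L2 rho ->
    (forall q (m : int), (q <= p)%N -> L2dot (dilate j m (g q)) rho = 0) -> L2dot f rho = 0].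

Lemma phiE (x : R) : phi x = ((0 <= x < 1)%R%:R : R)%:C.
Proof.
rewrite /quark expr0 mul1r indicE; congr (_%:C); congr (nat_of_bool _)%:R.
by apply/idP/idP; rewrite inE /= in_itv.
Qed.

Lemma phi01 (x : R) : phi x = 0 \/ phi x = 1.
Proof. by rewrite phiE; case: (_ && _); [right|left]. Qed.

Lemma phi2 (x : R) : phi x * phi x = phi x.
Proof. by rewrite phiE -rmorphM /=; case: (_ && _); rewrite ?mulr1 ?mulr0. Qed.

Lemma quarkE q (x : R) : quark q x = (x ^+ q)%:C * phi x.
Proof. by rewrite /quark -rmorphM /= expr0 mul1r. Qed.

Lemma phi_shift0 (x : R) (m : int) : m != 0 -> phi x = 0 \/ phi (x - m%:~R) = 0.
Proof.
move=> m0; rewrite !phiE.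
have [/andP[x0 x1]|] := boolP (0 <= x < 1); last by left.
have [/andP[y0 y1]|] := boolP (0 <= x - m%:~R < 1); last by right.
have h1 : m%:~R < (1 : R) by lra.
have h2 : (-1)%:~R < (m%:~R : R) by rewrite intrN; lra.
by rewrite ltrz1 in h1; rewrite ltr_int in h2; move: m0; lia.
Qed.

Let lq q : L2 (quark q : R -> R[i]) := @quark_L2 R q.

Lemma ae_exists (P : R -> Prop) : (\forall x \ae mu, 0 <= x < 1 -> P x) -> exists x, 0 <= x < 1 /\ P x.
Proof.
move=> h; apply: contrapT => hn.
have : N2 phi = 0.
  have c0 : cmeas (fun _ : R => 0 : R[i]) by exact: cmeas_cst.
  transitivity (N2 (fun _ : R => 0 : R[i])); last first.
    by rewrite /N2 (_ : (fun x => _) = (fun=> 0)) ?rint0 //; apply/funext => x; rewrite sqc0.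
  apply: (N2_ae (L2_meas (lq 0)) c0).
  apply: aeS h => x hx _; rewrite phiE; case: (boolP (0 <= x < 1)) => // /[dup] x01 /hx Px.
  by case: hn; exists x.
have := @nrm_sum_phi R 1; rewrite /nrm (_ : (fun x => _) = phi); last first.
  by apply/funext => x; rewrite big_ord1 subr0.
by move=> e e0; move: e; rewrite e0 sqrtr0 sqrtr1 => /esym/eqP; rewrite oner_eq0.
Qed.

Lemma poly_ae0 (P : {poly R[i]}) : (\forall x \ae mu, 0 <= x < 1 -> P.[x%:C] = 0) -> P = 0.
Proof.
move=> h.
have hs n : exists s : seq R, [/\ uniq s, size s = n & forall x, x \in s -> P.[x%:C] = 0].
  elim: n => [|n [s [us ss hs]]]; first by exists [::].
  have hx : \forall x \ae mu, forall y, y \in s -> x != y.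
    elim: (s) => [|y s' ih]; first by apply: aeT.
    have hy : \forall x \ae mu, x != y.
      by have := ae_affine (- y) (oner_neq0 R) (ae_neq0 (R := R)); apply: aeS => x; rewrite mul1r subr_eq0.
    by apply: aeS (aeI ih hy) => x [h1 h2] z; rewrite inE => /orP[/eqP ->//|/h1].
  have [x [x01 [Px xs]]] : exists x, 0 <= x < 1 /\ (P.[x%:C] = 0 /\ forall y, y \in s -> x != y).
    by apply: ae_exists; apply: aeS (aeI h hx) => x [h1 h2] /h1.
  exists (x :: s); split; rewrite /= ?ss ?us ?andbT //.
    by apply/negP => /xs; rewrite eqxx.
  by move=> y; rewrite inE => /orP[/eqP -> //|/hs].
have [s [us ss zs]] := hs (size P).
apply: (@roots_geq_poly_eq0 _ P [seq x%:C | x <- s]).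
- by apply/allP => _ /mapP[x xs ->]; rewrite rootE zs.
- by rewrite map_inj_uniq // => x y [].
- by rewrite size_map ss.
Qed.

(** The remainder of the best approximation by quarks on one unit interval is
    orthogonal to all quarks, hence to [f], hence to itself. The argument 2 x
    makes a half step of [f] the substitution of X + 1 in [Q]. *)
Lemma perp2_quark_poly f (n : int) : perp2 0 quark f -> exists Q : {poly R[i]},
  (size Q <= p.+1)%N /\ \forall x \ae mu, 0 <= x < 1 -> f (x + n%:~R) = Q.[(2 * x)%:C].
Proof.
move=> [lf hf].
have lfn : L2 (fun x => f (x + n%:~R)).
  by have := L2_shift (- n%:~R) lf; under eq_fun do rewrite opprK.
pose h x := phi x * f (x + n%:~R).
have lh : L2 h.
  apply: (L2_bddM (M := 1)) lfn; first exact: L2_meas (lq 0).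
  by move=> x; rewrite phiE /sqc /= expr0n addr0; case: (_ && _); rewrite ?expr1n ?expr0n.
have [c hc] := finite_projection p.+1 lq lh.
pose S x := \sum_(i < p.+1) c i * quark i x.
have lS : L2 S by apply: L2_sum => i; exact: L2Z.
pose r x := h x - S x; have lr : L2 r by exact: L2B.
have rphi x : r x = r x * phi x.
  rewrite /r /h /S mulrBl mulrAC phi2; congr (_ - _).
  by rewrite mulr_suml; apply: eq_bigr => i _; rewrite quarkE -!mulrA phi2.
have lrn : L2 (fun x => r (x - n%:~R)) by exact: L2_shift.
have hr : L2dot f (fun x => r (x - n%:~R)) = 0.
  apply: hf => // q m qp.
  have -> : dilate 0 m (quark q) = (fun x : R => quark q (x - m%:~R) : R[i]) by apply/funext => x; rewrite dilate0.
  have [->|mn] := eqVneq m n.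
    have := dot_shift (- n%:~R) (lq q) lr => ->.
    by rewrite dotC // hc // rmorph0.
  apply: dot_disjoint => x; rewrite quarkE rphi.
  have mn0 : m - n != 0 by rewrite subr_eq0.
  case: (phi_shift0 (x - n%:~R) mn0); last first.
    rewrite intrB (_ : x - n%:~R - (m%:~R - n%:~R) = x - m%:~R); last by ring.
    by move=> ->; left; rewrite mulr0.
  by move=> ->; right; rewrite mulr0.
have rr : L2dot r r = 0.
  rewrite {1}(_ : r = fun x => h x - S x) // dotBl //.
  have -> : L2dot S r = 0.
    rewrite dot_suml //; last by move=> i; exact: L2Z.
    by rewrite big1 // => i _; rewrite dotZl // dotC // hc // rmorph0 mulr0.
  rewrite subr0 -hr -(dot_shift n%:~R lf lrn); rewrite !dotE; congr cint; apply/funext => x.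
  rewrite addrK /h; case: (phi01 x) => p01; first by rewrite rphi p01 !mulr0 rmorph0 !mulr0.
  by rewrite p01 mul1r.
have r0 : r = cst 0 %[ae mu] by apply: N2_eq0 => //; move: rr; rewrite dot_self => -[].
exists (\poly_(i < p.+1) (c i / 2 ^+ i)); split; first exact: size_poly.
apply: aeS r0 => x hx x01; have /eqP := hx I; rewrite subr_eq0 => /eqP.
rewrite /h phiE x01 mul1r => ->; rewrite horner_poly /S; apply: eq_bigr => i _.
by rewrite quarkE phiE x01 mulr1 rmorphXn /= rmorphM /= exprMn rmorph_nat mulrA divfK // expf_neq0 // pnatr_eq0.
Qed.

(** The alternating flip of the filter B, which is orthogonal to B; the profile
    [D] will be arbitrary on the unit interval. *)
Definition antiwave (D : R -> R[i]) : R -> R[i] := fun x =>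
  \sum_(j < size B) ((-1) ^+ j * B`_j)%:C * D (2 * x - 1 + j%:R).

Lemma L2_half (a : R) D : L2 D -> L2 (fun x => D (2 * x + a)).
Proof. by apply: L2_affine; rewrite pnatr_eq0. Qed.

Lemma antiwave_L2 D : L2 D -> L2 (antiwave D).
Proof.
move=> lD; apply: L2_sum => j; apply: L2Z.
by have := L2_half (- 1 + j%:R) lD; under eq_fun do rewrite addrA.
Qed.

(** The inner product is a multiple of the sum of (-1)^j B_i B_j over i + j
    equal to a fixed odd number, and exchanging i and j changes its sign. *)
Lemma antiwave_orth D q (s : int) : L2 D -> (forall x, D x = D x * phi x) ->
  L2dot (fun x => quarklet b q (x - s%:~R)) (antiwave D) = 0.
Proof.
move=> lD hD.
have lA (i : int) : L2 (fun x => quark q (2 * x - i%:~R) : R[i]) by exact: L2_half (lq q).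
have lB (j : nat) : L2 (fun x => D (2 * x - 1 + j%:R)).
  by have := L2_half (- 1 + j%:R) lD; under eq_fun do rewrite addrA.
pose a (i : nat) := i%:Z - k.*2%:Z + 2 * s.
have E1 : (fun x => quarklet b q (x - s%:~R)) =
    fun x => \sum_(i < size B) (B`_i)%:C * quark q (2 * x - (a i)%:~R).
  apply/funext => x; rewrite (quarkletE hb); apply: eq_bigr => i _; congr (_ * quark q _).
  by rewrite /a [(_ + 2 * s)%:~R]intrD intrM; ring.
rewrite E1 dot_suml; [|by move=> i; exact: L2Z|exact: antiwave_L2].
pose I0 := L2dot (quark q) D.
have E2 (i j : nat) : L2dot (fun x => quark q (2 * x - (a i)%:~R)) (fun x => D (2 * x - 1 + j%:R)) =
    (2^-1 * (a i + j%:Z == 1)%:R)%:C * I0.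
  have [e|e] := eqVneq (a i + j%:Z) 1.
    have h2 : (2 : R) != 0 by rewrite pnatr_eq0.
    rewrite /I0 (dot_affine (- (a i)%:~R) h2 (lq q) lD) mulr1 mulrA -rmorphM /= ger0_norm //.
    rewrite mulVf // rmorph1 mul1r; congr L2dot; apply/funext => x; congr D.
    by rewrite (_ : a i = 1 - j%:Z) ?intrB -?pmulrn; [ring|rewrite -e addrK].
  rewrite mulr0 rmorph0 mul0r; apply: dot_disjoint => x; rewrite quarkE hD.
  have e0 : 1 - j%:Z - a i != 0 by apply: contra_neq e; lia.
  case: (phi_shift0 (2 * x - (a i)%:~R) e0); first by move=> ->; left; rewrite mulr0.
  rewrite (_ : 2 * x - (a i)%:~R - _ = 2 * x - 1 + j%:R); last by rewrite !intrB -pmulrn; ring.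
  by move=> ->; right; rewrite mulr0.
have E3 : \sum_(i < size B) L2dot (fun x => (B`_i)%:C * quark q (2 * x - (a i)%:~R)) (antiwave D) =
    (\sum_(i < size B) \sum_(j < size B) (-1) ^+ j * B`_i * B`_j * (a i + j%:Z == 1)%:R)%:C * (2^-1%:C * I0).
  rewrite rmorph_sum mulr_suml; apply: eq_bigr => i _.
  rewrite dotZl //; last exact: antiwave_L2.
  rewrite dot_sumr //; last by move=> j; exact: L2Z.
  rewrite rmorph_sum mulr_sumr mulr_suml; apply: eq_bigr => j _.
  by rewrite dotZr_real // E2 !rmorphM /=; ring.
rewrite E3; set S := \sum_(i < _) _.
suff -> : S = 0 by rewrite rmorph0 mul0r.
have : S = - S.
  rewrite {1}/S exchange_big /= -sumrN; apply: eq_bigr => i _; rewrite -sumrN; apply: eq_bigr => j _.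
  have -> : (a j + i%:Z == 1) = (a i + j%:Z == 1) by rewrite /a; congr (_ == _); ring.
  have [e|e] := eqVneq (a i + j%:Z) 1; last by rewrite !mulr0 oppr0.
  have -> : (-1) ^+ i = - (-1) ^+ j :> R.
    have : odd (i + j) by move: e; rewrite /a; lia.
    rewrite oddD -signr_odd -[in RHS]signr_odd.
    by case: (odd i); case: (odd j) => //= _; rewrite ?expr0 ?expr1 ?opprK.
  ring.
by move: (S) => x e; lra.
Qed.

(** This is orthogonality to the antiwaves, tested with the cut-off [D] of the
    left side itself. *)
Lemma perp2_wave f (n : int) : perp2 0 (quarklet b) f -> \forall t \ae mu, 0 <= t < 1 ->
  \sum_(j < size B) ((-1) ^+ j * B`_j)%:C * f (2^-1 * t + 2^-1 * (2 * n%:~R + 1 - j%:R)) = 0.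
Proof.
move=> [lf hf]; have h2 : (2 : R) != 0 by rewrite pnatr_eq0.
have h2' : (2^-1 : R) != 0 by rewrite invr_eq0.
pose c (j : nat) : R := (-1) ^+ j * B`_j.
pose a (j : nat) : R := 2^-1 * (2 * n%:~R + 1 - j%:R).
have lfa (j : nat) : L2 (fun t => f (2^-1 * t + a j)) by exact: L2_affine.
pose G t := \sum_(j < size B) (c j)%:C * f (2^-1 * t + a j).
have lG : L2 G by apply: L2_sum => j; exact: L2Z.
pose D t := G t * phi t.
have lD : L2 D.
  rewrite (_ : D = fun t => phi t * G t); last by apply/funext => t; rewrite mulrC.
  apply: (L2_bddM (M := 1)) lG; first exact: L2_meas (lq 0).
  by move=> x; case: (phi01 x) => ->; rewrite /sqc /= expr0n addr0 ?expr1n ?expr0n.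
have Dphi x : D x = D x * phi x by rewrite /D -mulrA phi2.
have lA := antiwave_L2 lD.
have h0 : L2dot f (fun x => antiwave D (x - n%:~R)) = 0.
  apply: hf => [|q m qp]; first exact: L2_shift.
  rewrite -[RHS](antiwave_orth q (m - n) lD Dphi).
  have lsh : L2 (fun x => quarklet b q (x - (m - n)%:~R)) by apply: L2_shift; exact: (quarklet_L2 hb q).
  rewrite -(dot_shift (- n%:~R) lsh lA); congr L2dot; apply/funext => x.
  by rewrite dilate0 intrB; congr (quarklet b q _); ring.
have E : L2dot f (fun x => antiwave D (x - n%:~R)) = 2^-1%:C * L2dot G D.
  have lB (j : nat) : L2 (fun x => D (2 * (x - n%:~R) - 1 + j%:R)).
    have := L2_half (- 2 * n%:~R - 1 + j%:R) lD; congr L2; apply/funext => x; congr D; ring.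
  rewrite dot_sumr //; last by move=> j; exact: L2Z.
  rewrite /G dot_suml //; last by move=> j; exact: L2Z.
  rewrite mulr_sumr; apply: eq_bigr => j _; rewrite dotZr_real // dotZl // mulrCA; congr (_ * _).
  rewrite (dot_affine (a j) h2' lf (lB j)) ger0_norm ?invr_ge0 //; congr (_ * L2dot _ _).
  by apply/funext => t; congr D; rewrite /a; field.
have GD : L2dot G D = 0.
  have /eqP := h0; rewrite E mulf_eq0 => /orP[/eqP[] /eqP|/eqP //].
  by rewrite invr_eq0 pnatr_eq0.
have DD : L2dot D D = 0.
  rewrite -GD !dotE; congr cint; apply/funext => x; rewrite /D.
  by case: (phi01 x) => ->; [rewrite !mulr0 rmorph0 !mulr0|rewrite !mulr1].
have D0 : D = cst 0 %[ae mu] by apply: N2_eq0 => //; move: DD; rewrite dot_self => -[].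
apply: aeS D0 => t ht t01; have := ht I; rewrite /D phiE t01 mulr1; exact.
Qed.

Lemma sum_double (T : nmodType) (F : nat -> T) N :
  \sum_(j < N.*2) F j = \sum_(i < N) (F i.*2 + F i.*2.+1).
Proof.
elim: N => [|N ih]; first by rewrite !big_ord0.
by rewrite doubleS !big_ord_recr /= ih addrA.
Qed.

Lemma mask_coef_diff i : B`_i.*2 - B`_i.*2.+1 = 2 * (i == k)%:R.
Proof.
have := congr1 (fun P : {poly R} => P`_i) (mask_even_odd R k).
by move: (mask_poly R k) => P; rewrite coefB coef_even_poly coef_odd_poly coefZ coefXn.
Qed.

(** The relation [perp2_wave] between the polynomial pieces reads 2 Q_(n-k) = -
    sum_i B_(2i) (Q_(n-i)(X+1) - Q_(n-i)), because B_(2i) - B_(2i+1) is 2 for i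
    = k and 0 otherwise. The right side has smaller degree, uniformly in n, so
    all pieces vanish. *)
Lemma perp2_inter f : perp2 0 quark f -> perp2 0 (quarklet b) f -> f = cst 0 %[ae mu].
Proof.
move=> hf hw.
have [Q hQ] := choice (fun n => perp2_quark_poly n hf).
have aQ := fun n => (hQ n).2.
pose N := size B.
have rel n : \sum_(i < N) ((B`_i.*2)%:C *: ((Q (n - i%:Z) \Po ('X + 1)) - Q (n - i%:Z))) +
    2%:R *: Q (n - k%:Z) = 0.
  pose H := \sum_(i < N) ((B`_i.*2)%:C *: (Q (n - i%:Z) \Po ('X + 1)) -
     (B`_i.*2.+1)%:C *: Q (n - i%:Z)).
  have -> : \sum_(i < N) ((B`_i.*2)%:C *: ((Q (n - i%:Z) \Po ('X + 1)) - Q (n - i%:Z))) +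
    2%:R *: Q (n - k%:Z) = H.
    have kN : (k < N)%N.
      rewrite ltnNge; apply/negP => Nk; have := mask_coef_diff k.
      rewrite !nth_default ?eqxx ?mulr1 ?subrr //; last 2 first.
      - by apply: leq_trans Nk _; lia.
      - by apply: leq_trans Nk _; lia.
      by move=> /eqP; rewrite eq_sym pnatr_eq0.
    have -> : 2%:R *: Q (n - k%:Z) = \sum_(i < N) (2 * (i == k :> nat)%:R)%:C *: Q (n - i%:Z).
      rewrite (bigD1 (Ordinal kN)) //= eqxx mulr1 big1 ?addr0 ?rmorph_nat // => i ik.
      rewrite (_ : (i == k :> nat) = false) ?mulr0 ?rmorph0 ?scale0r //.
      by apply: contra_neqF ik => /eqP e; apply: val_inj.
    rewrite -big_split; apply: eq_bigr => i _ /=.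
    rewrite -mask_coef_diff scalerBr rmorphB /= scalerBl addrA subrK //.
  apply: poly_ae0.
  have h1 (i : nat) : \forall t \ae mu, 0 <= 2^-1 * t + 0 < 1 ->
      f (2^-1 * t + 0 + (n - i%:Z)%:~R) = (Q (n - i%:Z)).[(2 * (2^-1 * t + 0))%:C].
    by apply: (ae_affine 0 _ (aQ (n - i%:Z))); rewrite invr_eq0 pnatr_eq0.
  have h3 (i : nat) : \forall t \ae mu, 0 <= 2^-1 * t + 2^-1 < 1 ->
      f (2^-1 * t + 2^-1 + (n - i%:Z)%:~R) = (Q (n - i%:Z)).[(2 * (2^-1 * t + 2^-1))%:C].
    by apply: (ae_affine 2^-1 _ (aQ (n - i%:Z))); rewrite invr_eq0 pnatr_eq0.
  apply: aeS (aeI (perp2_wave n hw) (aeI (aeA h1) (aeA h3))) => t [w [q1 q2]] t01.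
  have {}w := w t01; have /andP[t0 t1] := t01.
  rewrite -[RHS]w.
  have sN : (size B <= N.*2)%N by rewrite /N -addnn leq_addr.
  rewrite (big_ord_widen N.*2 (fun j => ((-1) ^+ j * B`_j)%:C *
     f (2^-1 * t + 2^-1 * (2 * n%:~R + 1 - j%:R)))) // big_mkcond.
  rewrite (eq_bigr (fun j : 'I_N.*2 => ((-1) ^+ j * B`_j)%:C *
     f (2^-1 * t + 2^-1 * (2 * n%:~R + 1 - j%:R)))); last first.
    by move=> j _; case: ltnP => // h; rewrite nth_default // mulr0 rmorph0 mul0r.
  rewrite (sum_double (fun j => ((-1) ^+ j * B`_j)%:C *
     f (2^-1 * t + 2^-1 * (2 * n%:~R + 1 - j%:R)))).
  rewrite horner_sum; apply: eq_bigr => i _.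
  have s1 : (-1) ^+ i.*2 = 1 :> R by rewrite -mul2n exprM sqrrN !expr1n.
  rewrite !hornerE horner_comp !hornerE exprS s1 mulr1 mul1r mulN1r rmorphN mulNr.
  have -> : 2^-1 * t + 2^-1 * (2 * n%:~R + 1 - (i.*2)%:R) = 2^-1 * t + 2^-1 + (n - i%:Z)%:~R.
    by rewrite intrB -pmulrn -mul2n natrM; field.
  have -> : 2^-1 * t + 2^-1 * (2 * n%:~R + 1 - (i.*2.+1)%:R) = 2^-1 * t + 0 + (n - i%:Z)%:~R.
    by rewrite intrB -pmulrn -[(i.*2.+1)%:R]natr1 -mul2n natrM; field.
  rewrite q1 ?q2; [|by apply/andP; split; lra|by apply/andP; split; lra].
  congr (_ * (Q _).[_] - _ * (Q _).[_]).
    by rewrite (_ : 2 * _ = t + 1) ?rmorphD //=; field.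
  by congr (_%:C); field.
(* each use of [rel] lowers the degrees of all pieces by one *)
have sz d : forall n, (size (Q n) <= p.+1 - d)%N.
  elim: d => [|d ih] n; first by rewrite subn0; exact: (hQ n).1.
  have /eqP := rel (n + k%:Z); rewrite addrK addrC addr_eq0 => /eqP e.
  have -> : size (Q n) = size (2%:R *: Q n) by rewrite size_scale // pnatr_eq0.
  rewrite e size_polyN; apply: (leq_trans (size_sum _ _ _)); apply/bigmax_leqP => i _.
  apply: (leq_trans (size_scale_leq _ _)); apply: (leq_trans (size_poly_diff _)).
  by rewrite subnS -!subn1 leq_sub2r.
have Q0 n : Q n = 0 by apply/eqP; rewrite -size_poly_eq0 -leqn0; have := sz p.+1 n; rewrite subnn.
have f0 (n : int) : \forall x \ae mu, 0 <= x - n%:~R < 1 -> f x = 0.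
  have := ae_affine (- n%:~R) (oner_neq0 R) (aQ n); apply: aeS => x.
  by rewrite mul1r subrK Q0 horner0.
apply: aeS (aeI (aeA (fun n => f0 n%:Z)) (aeA (fun n => f0 (- n%:Z)))) => x [hp hn] _.
have c : 0 <= x - (Num.floor x)%:~R < 1.
  by have := floor_itv x; rewrite intrD => /andP[]; move: (Num.floor x) => m; lra.
move: c; case: (Num.floor x) => m; first exact: hp.
by rewrite NegzE; exact: hn.
Qed.

End Perp.

(** * Scales of subspaces *)

Section Families.
Context {R : realType}.
Local Notation mu := (@lebesgue_measure R).
Local Open Scope complex_scope.
Implicit Types (f g h : R -> R[i]).
Variables (J : choiceType) (U : J -> set (R -> R[i])).

Section Chain.
Variables (rank : J -> int) (P : int -> set (R -> R[i])).
Hypothesis rank_inj : injective rank.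
Hypothesis UL : forall i f, U i f -> L2 f.
Hypothesis U_P : forall i f (j : int), rank i < j -> U i f -> P j f.
Hypothesis P0 : forall j, P j (fun=> 0).
Hypothesis PD : forall j f g, P j f -> P j g -> P j (fun x => f x + g x).
Hypothesis PN : forall j f, P j f -> P j (fun x => - f x).
Hypothesis P_ae : forall j f g, f = g %[ae mu] -> L2 g -> P j f -> P j g.
Hypothesis U_P0 : forall i f, U i f -> P (rank i) f -> f = cst 0 %[ae mu].

(** In a vanishing sum the term of top rank is minus the sum of the others,
    hence lies in [P] of its own rank and is null; induction on the number of
    terms. *)
Lemma direct_chain : direct_family U.
Proof.
move=> s w; move: {2}(size s) (erefl (size s)) => n; elim: n s => [|n ih] s.
  by move=> /eqP; rewrite size_eq0 => /eqP ->.
move=> sn us hU h0.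
have [i0 [i0s imax]] : exists i0, i0 \in s /\ forall i, i \in s -> rank i <= rank i0.
  have : s != [::] by case: (s) sn.
  elim: (s) => // a t; case: t => [|c t] iht _.
    by exists a; rewrite inE eqxx; split => // i; rewrite inE => /eqP ->.
  have [//|i1 [i1t i1m]] := iht; have [le|lt] := leP (rank a) (rank i1).
    exists i1; rewrite inE i1t orbT; split => // i; rewrite inE => /orP[/eqP -> //|]; exact: i1m.
  exists a; rewrite inE eqxx; split => // i; rewrite inE => /orP[/eqP -> //|/i1m h].
  exact: le_trans h (ltW lt).
have ps := perm_to_rem i0s; set t := rem i0 s in ps.
have ts i : i \in t -> i \in s by exact: mem_rem.
have sumE x : \sum_(i <- s) w i x = w i0 x + \sum_(i <- t) w i x.
  by rewrite (perm_big _ ps) big_cons.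
have Pt : P (rank i0) (fun x => \sum_(i <- t) w i x).
  have : forall i, i \in t -> P (rank i0) (w i).
    move=> i it; apply: (U_P _ (hU i (ts i it))); rewrite lt_neqAle imax ?ts // andbT.
    apply/eqP => /rank_inj e; move: it; rewrite e /t mem_rem_uniq // inE eqxx //.
  elim: (t) => [|a u ihu] hu; first by under eq_fun do rewrite big_nil; exact: P0.
  under eq_fun do rewrite big_cons; apply: PD; first by apply: hu; rewrite inE eqxx.
  by apply: ihu => i iu; apply: hu; rewrite inE iu orbT.
have w0 : w i0 = cst 0 %[ae mu].
  apply: U_P0; first exact: hU.
  apply: (P_ae _ _ (PN Pt)); last exact: UL (hU i0 i0s).
  by apply: aeS h0 => x hx _; have := hx I; rewrite sumE => /eqP; rewrite addr_eq0 => /eqP.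
have h1 : (fun x => \sum_(i <- t) w i x) = cst 0 %[ae mu].
  by apply: aeS (aeI h0 w0) => x [hx hw] _; have := hx I; rewrite sumE (hw I) add0r.
have st : size t = n by rewrite /t size_rem // sn.
have ut : uniq t by exact: rem_uniq.
have h2 := ih t st ut (fun i it => hU i (ts i it)) h1.
move=> i; rewrite (perm_mem ps) inE => /orP[/eqP -> //|]; exact: h2.
Qed.

End Chain.

Hypothesis UD : forall i f g, U i f -> U i g -> U i (fun x => f x + g x).
Hypothesis UZ : forall i (c : R[i]) f, U i f -> U i (fun x => c * f x).

Lemma sum_space1 i f : U i f -> sum_space U f.
Proof.
move=> Uf; exists [:: i], (fun=> f); split => //; first by move=> j; rewrite inE => /eqP ->.
by apply/funext => x; rewrite big_seq1.
Qed.

Lemma sum_space0 : sum_space U (fun=> 0).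
Proof. by exists [::], (fun=> fun=> 0); split => //; apply/funext => x; rewrite big_nil. Qed.

Lemma sum_space_add1 i f g : sum_space U f -> U i g -> sum_space U (fun x => f x + g x).
Proof.
move=> [s [w [us hU ->]]] Ug; have [is_|is_] := boolP (i \in s).
  exists s, (fun j x => w j x + (if j == i then g x else 0)); split => //.
    move=> j js; case: eqVneq => [ji|_]; last by under eq_fun do rewrite addr0; exact: hU.
    by rewrite ji; apply: UD => //; exact: hU.
  apply/funext => x; rewrite big_split /=; congr (_ + _).
  rewrite (perm_big _ (perm_to_rem is_)) big_cons eqxx big_seq big1 => [|j]; first exact: esym (addr0 _).
  by rewrite mem_rem_uniq // inE => /andP[/negPf ->].
exists (i :: s), (fun j => if j == i then g else w j); split.
- by rewrite /= is_.
- move=> j; rewrite inE => /orP[/eqP ->|js]; first by rewrite eqxx.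
  by case: eqVneq => [->//|_]; exact: hU.
- apply/funext => x; rewrite big_cons eqxx addrC; congr (_ + _).
  rewrite big_seq [RHS]big_seq; apply: eq_bigr => j js; case: eqVneq => // ji.
  by rewrite ji (negPf is_) in js.
Qed.

Lemma sum_spaceD f g : sum_space U f -> sum_space U g -> sum_space U (fun x => f x + g x).
Proof.
move=> hf [s [w [us hU ->]]]; elim: s us hU => [|i s ih] us hU.
  by under eq_fun do rewrite big_nil addr0.
under eq_fun do rewrite big_cons addrCA addrC; apply: (@sum_space_add1 i); last first.
  by apply: hU; rewrite inE eqxx.
by apply: ih => [|j js]; [case/andP: us|apply: hU; rewrite inE js orbT].
Qed.

Lemma sum_spaceZ (c : R[i]) f : sum_space U f -> sum_space U (fun x => c * f x).
Proof.
move=> [s [w [us hU ->]]]; exists s, (fun i x => c * w i x); split => // [i is_|].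
  by apply: UZ; exact: hU.
by apply/funext => x; rewrite mulr_sumr.
Qed.

Lemma sum_space_span (A : set (R -> R[i])) : (forall f, A f -> sum_space U f) ->
  lin_span A `<=` sum_space U.
Proof.
move=> hA f [n [c [g [Ag ->]]]]; elim: n c g Ag => [|n ih] c g Ag.
  by under eq_fun do rewrite big_ord0; exact: sum_space0.
under eq_fun do rewrite big_ord_recr /=; apply: sum_spaceD; first by apply: ih => i; exact: Ag.
by apply: sum_spaceZ; apply: hA.
Qed.

End Families.

Section Scales.
Context {R : realType}.
Local Notation mu := (@lebesgue_measure R).
Local Open Scope complex_scope.
Implicit Types (f g h rho : R -> R[i]).

Lemma scaleK (j : int) (x : R) : 2 ^ j * (2 ^ (- j) * x) = x.
Proof. by rewrite mulrA -expfzDr ?pnatr_eq0 // subrr expr0z mul1r. Qed.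

Lemma dot_dilate (j m : int) f rho : L2 f -> L2 rho ->
  L2dot (dilate j m f) rho = 0 <-> L2dot (fun x => f (x - m%:~R)) (fun x => rho (2 ^ (- j) * x)) = 0.
Proof.
move=> lf lr; have a0 := @scale_neq0 R (- j).
have ld := L2_dilate j m lf.
rewrite (dot_affine 0 a0 ld lr).
have -> : (fun x => dilate j m f (2 ^ (- j) * x + 0)) =
    fun x => (2 `^ (j%:~R / 2))%:C * f (x - m%:~R).
  by apply/funext => x; rewrite addr0 /dilate scaleK.
have -> : (fun x => rho (2 ^ (- j) * x + 0)) = (fun x => rho (2 ^ (- j) * x)).
  by apply/funext => x; rewrite addr0.
rewrite dotZl; [|exact: L2_shift|exact: L2_scale].
split=> [/eqP|->]; last by rewrite !mulr0.
rewrite !mulf_eq0 => /orP[/eqP[] /eqP|/orP[/eqP[] /eqP|/eqP //]].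
  by rewrite normr_eq0 (negPf a0).
by rewrite powR_eq0 pnatr_eq0.
Qed.

Lemma closed_span_ae (A : set (R -> R[i])) f g : A `<=` L2 -> f = g %[ae mu] -> L2 g ->
  closed_span A f -> closed_span A g.
Proof.
move=> AL fg lg; have sL := span_L2 AL; move=> /(clP _ sL)[lf hf]; apply/(clP _ sL); split => // e e0.
have [u Au hu] := hf e e0; exists u => //; apply: le_lt_trans hu.
have lu := sL _ Au.
rewrite (@N2_ae _ (fun x => g x - u x) (fun x => f x - u x)) //.
- by apply: L2_meas; exact: L2B.
- by apply: L2_meas; exact: L2B.
- by apply: aeS fg => x hx _; rewrite hx.
Qed.

Variables (p : nat).

Definition gens (j : int) (g : nat -> R -> R[i]) : set (R -> R[i]) :=
  [set f | exists (q : nat) (m : int), (q <= p)%N /\ f = dilate j m (g q)].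

Lemma gens_L2 j (g : nat -> R -> R[i]) : (forall q, (q <= p)%N -> L2 (g q)) -> gens j g `<=` L2.
Proof. by move=> lg _ [q [m [qp ->]]]; apply: L2_dilate; exact: lg. Qed.

(** Dilation reduces statements on double complements to scale 0. *)
Lemma perp2_scale (j : int) (g : nat -> R -> R[i]) f : (forall q, (q <= p)%N -> L2 (g q)) ->
  perp2 p j g f -> perp2 p 0 g (fun x => f (2 ^ (- j) * x)).
Proof.
move=> lg [lf hf]; have a0 := @scale_neq0 R (- j); have a1 := @scale_neq0 R j.
split=> [|rho lr hr]; first exact: L2_scale.
have lr' : L2 (fun x => rho (2 ^ j * x)) by exact: L2_scale.
have rE : (fun x => rho (2 ^ j * (2 ^ (- j) * x))) = rho by apply/funext => x; rewrite scaleK.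
have /eqP : L2dot f (fun x => rho (2 ^ j * x)) = 0.
  apply: hf => // q m qp; apply/(dot_dilate j m (lg q qp) lr'); rewrite rE.
  by rewrite -[RHS](hr q m qp); congr L2dot; apply/funext => x; rewrite dilate0.
rewrite (dot_affine 0 a0 lf lr') mulf_eq0 => /orP[/eqP[] /eqP|/eqP <-].
  by rewrite normr_eq0 (negPf a0).
by congr L2dot; apply/funext => x; rewrite addr0 ?scaleK.
Qed.

Lemma perp2_span (j j' : int) (g g' : nat -> R -> R[i]) :
  (forall q, (q <= p)%N -> L2 (g' q)) ->
  (forall q m, (q <= p)%N -> lin_span (gens j' g') (dilate j m (g q))) ->
  perp2 p j g `<=` perp2 p j' g'.
Proof.
move=> lg' hs f [lf hf]; split=> // rho lr hr; apply: hf => // q m qp.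
apply: (span_dot0 (gens_L2 (j := j') lg') lr _ (hs q m qp)) => _ [q' [m' [q'p ->]]].
exact: hr.
Qed.

Lemma perp2_add (j : int) (g : nat -> R -> R[i]) f h : perp2 p j g f -> perp2 p j g h ->
  perp2 p j g (fun x => f x + h x).
Proof.
move=> [lf hf] [lh hh]; split=> [|rho lr hr]; first exact: L2D.
by rewrite dotDl // hf // hh // addr0.
Qed.

Lemma perp2_opp (j : int) (g : nat -> R -> R[i]) f : perp2 p j g f -> perp2 p j g (fun x => - f x).
Proof.
move=> [lf hf]; split=> [|rho lr hr]; first exact: L2N.
by rewrite dotNl // hf // oppr0.
Qed.

Lemma perp2_0 (j : int) (g : nat -> R -> R[i]) : perp2 p j g (fun=> 0).
Proof. by split=> [|rho lr hr]; [exact: L2_0|exact: dot0l]. Qed.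

Lemma perp2_ae (j : int) (g : nat -> R -> R[i]) f h : f = h %[ae mu] -> L2 h ->
  perp2 p j g f -> perp2 p j g h.
Proof.
move=> fh lh [lf hf]; split=> // rho lr hr; rewrite -[RHS](hf rho lr hr) !dotE; apply: cint_ae.
- by apply: cmeasM; [exact: L2_meas|apply: cmeasJ; exact: L2_meas].
- by apply: cmeasM; [exact: L2_meas|apply: cmeasJ; exact: L2_meas].
- by apply: aeS fh => x hx _; rewrite hx.
Qed.

Lemma quark_refine q (x : R) : quark q x =
  (2 ^- q)%:C * (quark q (2 * x) + \sum_(i < q.+1) ('C(q, i)%:R)%:C * quark i (2 * x - 1)) :> R[i].
Proof.
have c2 : (2 ^- q)%:C * ((2 * x) ^+ q)%:C = (x ^+ q)%:C.
  by rewrite -rmorphM /= exprMn mulrA mulVf ?mul1r // expf_neq0 // pnatr_eq0.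
rewrite quarkE phi_refine tsumD -polyC1 tsumC -['X]expr1 tsumXn rmorph1 mul1r !mulrDr; congr (_ + _).
  by rewrite [X in _ = _ * X]quarkE mulrA c2.
have -> : \sum_(i < q.+1) ('C(q, i)%:R)%:C * quark i (2 * x - 1) =
    ((2 * x) ^+ q)%:C * (quark 0 (2 * x - 1) : R[i]).
  have e : 2 * x = 1 + (2 * x - 1) by ring.
  rewrite [X in (X ^+ q)%:C]e exprDn rmorph_sum mulr_suml; apply: eq_bigr => i _ /=.
  rewrite quarkE mulrA -rmorphM /=; congr (_%:C * _).
  by rewrite expr1n mul1r [LHS]mulr_natl.
by rewrite mulrA c2.
Qed.

Lemma span_gens (j : int) (g : nat -> R -> R[i]) (q : nat) (m : int) : (q <= p)%N ->
  lin_span (gens j g) (fun x => g q (2 ^ j * x - m%:~R)).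
Proof.
by move=> qp; under eq_fun do rewrite shift_dilate; apply: spanZ; apply: sub_span; exists q, m.
Qed.

(** Quarks refine: the binomial formula expresses a quark through quarks of at
    most the same degree at the next scale ([quark_refine]). *)
Lemma perp2_quark_mono (j : int) : @perp2 R p j quark `<=` perp2 p (j + 1) quark.
Proof.
apply: perp2_span => [q _|q m qp]; first exact: quark_L2.
rewrite /dilate; apply: spanZ; under eq_fun do rewrite quark_refine.
have e1 (x : R) : 2 ^ (j + 1) * x = 2 * (2 ^ j * x).
  by rewrite expfzDr ?pnatr_eq0 // expr1z; ring.
apply: spanZ; apply: spanD.
  have := span_gens (j + 1) quark (2 * m) qp; congr lin_span; apply/funext => x.
  by congr (quark q); rewrite e1 intrM; ring.
apply: span_sum => i; apply: spanZ.
have ip : (i <= p)%N by apply: leq_trans _ qp; rewrite -ltnS.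
have := span_gens (j + 1) quark (2 * m + 1) ip; congr lin_span; apply/funext => x.
by congr (quark i); rewrite e1 intrD intrM; ring.
Qed.

Variables (k : nat) (b : int -> R).
Hypothesis hb : is_quarklet_mask k.*2.+1 b.

Lemma perp2_quarklet_mono (j : int) : perp2 p j (quarklet b) `<=` perp2 p (j + 1) quark.
Proof.
apply: perp2_span => [q _|q m qp]; first exact: quark_L2.
rewrite /dilate; apply: spanZ; under eq_fun do rewrite (quarkletE hb).
apply: span_sum => i; apply: spanZ.
have := span_gens (j + 1) quark (2 * m + (i%:Z - k.*2%:Z)) qp; congr lin_span; apply/funext => x.
congr (quark q); rewrite expfzDr ?pnatr_eq0 // expr1z.
by rewrite [(2 * m + _)%:~R]intrD intrM; ring.
Qed.

Lemma perp2_disjoint (j : int) f : perp2 p j quark f -> perp2 p j (quarklet b) f ->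
  f = cst 0 %[ae mu].
Proof.
move=> h1 h2; have a1 := @scale_neq0 R j.
have h := perp2_inter hb (perp2_scale (fun q _ => @quark_L2 R q) h1)
   (perp2_scale (fun q _ => quarklet_L2 hb q) h2).
have := ae_affine 0 a1 h; apply: aeS => x hx _; have := hx I.
by rewrite addr0 /= -{2}[j]opprK scaleK.
Qed.

End Scales.

(** * The decompositions *)

Section Assembly.
Context {R : realType}.
Local Notation mu := (@lebesgue_measure R).
Local Open Scope complex_scope.
Implicit Types (f g h rho : R -> R[i]).
Variables (k p : nat) (b : int -> R) (psis : nat -> R -> R[i]).
Hypothesis hb : is_quarklet_mask k.*2.+1 b.
Hypothesis hpsis : modified_quarklets b p psis.
Local Notation W := (Wstar psis p).
Local Notation WW := (fun j : int => sum_space (Wstarstar_family psis p j)).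
Local Notation V := (Vspace p 0 : set (R -> R[i])).

Let LS q : (q <= p)%N -> L2 (psis q). Proof. by case: hpsis => h _ _; exact: h. Qed.
Let LQ q : (q <= p)%N -> L2 (quarklet b q). Proof. by move=> _; exact: quarklet_L2 hb q. Qed.
Let S0 : psis 0%N = quarklet b 0 %[ae mu]. Proof. by case: hpsis. Qed.
Let lquark q : (q <= p)%N -> L2 (quark q : R -> R[i]). Proof. by move=> _; exact: quark_L2. Qed.
Let gS j := gens_L2 (j := j) LS.

Let gens1_L2 (j : int) q : (q <= p)%N -> [set f | exists m : int, f = dilate j m (psis q)] `<=` L2.
Proof. by move=> qp _ [m ->]; apply: L2_dilate; exact: LS. Qed.

(** Closed spans of modified quarklets reach the double complement of the
    quarklets by [trans_orth_star], after dilation to scale 0. *)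
Lemma W_perp2 (j : int) f : W j f -> perp2 p j (quarklet b) f.
Proof.
move=> hf; have lf : L2 f by case: hf. split=> // rho lr hr.
have lr' : L2 (fun x => rho (2 ^ (- j) * x)) by apply: L2_scale => //; exact: scale_neq0.
apply: (clspan_dot0 (@gS j) lr _ hf) => _ [q [m [qp ->]]].
apply/(dot_dilate j m (LS qp) lr).
have [_ _ rec] := hpsis.
apply: (trans_orth_star LQ LS S0 rec lr' _ m qp) => q' m' q'p.
by apply/(dot_dilate j m' (LQ q'p) lr); exact: hr.
Qed.

Lemma V_perp2 f : V f -> perp2 p 0 quark f.
Proof.
move=> hf; have lf : L2 f by case: hf. split=> // rho lr hr.
apply: (clspan_dot0 (gens_L2 (j := 0) lquark) lr _ hf) => _ [q [m [qp ->]]]; exact: hr.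
Qed.

Lemma WD (j : int) f g : W j f -> W j g -> W j (fun x => f x + g x).
Proof. exact: clspanD (@gS j). Qed.

Lemma WZ (j : int) (c : R[i]) f : W j f -> W j (fun x => c * f x).
Proof. exact: clspanZ (@gS j). Qed.

Lemma W0 (j : int) : W j (fun=> 0).
Proof. by apply: spanI; [exact: span0|exact: gS]. Qed.

Lemma VD f g : V f -> V g -> V (fun x => f x + g x).
Proof. exact: clspanD (gens_L2 (j := 0) lquark). Qed.

Lemma VZ (c : R[i]) f : V f -> V (fun x => c * f x).
Proof. exact: clspanZ (gens_L2 (j := 0) lquark). Qed.

Lemma WW1D (j : int) (i : 'I_p.+1) f g : Wstarstar_family psis p j i f ->
  Wstarstar_family psis p j i g -> Wstarstar_family psis p j i (fun x => f x + g x).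
Proof. by apply: clspanD; apply: gens1_L2; rewrite -ltnS. Qed.

Lemma WW1Z (j : int) (i : 'I_p.+1) (c : R[i]) f : Wstarstar_family psis p j i f ->
  Wstarstar_family psis p j i (fun x => c * f x).
Proof. by apply: clspanZ; apply: gens1_L2; rewrite -ltnS. Qed.

Lemma WW_W (j : int) : WW j `<=` W j.
Proof.
move=> f [s [w [_ hw ->]]].
elim: s hw => [|i s ih] hw; first by under eq_fun do rewrite big_nil; exact: W0.
under eq_fun do rewrite big_cons; apply: WD; last first.
  by apply: ih => l ls; apply: hw; rewrite inE ls orbT.
have := hw i (mem_head _ _); apply: clS; apply: spanS => _ [m ->].
by exists (i : nat), m; split => //; rewrite -ltnS.
Qed.

Lemma WWD (j : int) f g : WW j f -> WW j g -> WW j (fun x => f x + g x).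
Proof. by apply: sum_spaceD => i u v; exact: WW1D. Qed.

Lemma WWZ (j : int) (c : R[i]) f : WW j f -> WW j (fun x => c * f x).
Proof. by apply: sum_spaceZ => i e u; exact: WW1Z. Qed.

(** The chain for the decompositions with base: the base space has rank -1,
    below which there is only the null space. *)
Let P (j : int) : set (R -> R[i]) :=
  if 0 <= j then perp2 p j quark else [set f | L2 f /\ f = cst 0 %[ae mu]].

Lemma perp2_quark_le (j : int) (n : nat) : @perp2 R p j quark `<=` perp2 p (j + n%:Z) quark.
Proof.
elim: n => [|n ih] f hf; first by rewrite addr0.
by have := perp2_quark_mono (ih _ hf); rewrite -addrA -[n.+1]addn1 PoszD.
Qed.

Lemma W_perp2_lt (i j : int) f : i < j -> W i f -> perp2 p j quark f.
Proof.
move=> ij /W_perp2 /(perp2_quarklet_mono hb) h.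
have := perp2_quark_le (absz (j - (i + 1))%R) h; congr (perp2 p _ quark f); lia.
Qed.

Lemma W_disjoint (j : int) f : W j f -> perp2 p j quark f -> f = cst 0 %[ae mu].
Proof. by move=> /W_perp2 h1 h2; exact: (perp2_disjoint hb h2 h1). Qed.

Lemma direct_W (U : int -> set (R -> R[i])) : (forall j, U j `<=` W j) -> direct_family U.
Proof.
move=> UW; apply: (@direct_chain R int U id (fun j => perp2 p j quark)) => //.
- by move=> j f /UW [].
- by move=> i f j ij /UW; exact: W_perp2_lt.
- by move=> j; exact: perp2_0.
- by move=> j f g; exact: perp2_add.
- by move=> j f; exact: perp2_opp.
- by move=> j f g; exact: perp2_ae.
- by move=> j f /UW; exact: W_disjoint.
Qed.

Lemma direct_base (U : int -> set (R -> R[i])) : (forall j, U j `<=` W j) ->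
  direct_family (with_base V U).
Proof.
move=> UW.
apply: (@direct_chain R (option nat) (with_base V U) (fun o => if o is Some j then j%:Z else -1) P).
- by move=> [i|] [j|] //= [->].
- by move=> [j|] f /= => [/UW []|[]].
- move=> [i|] f j /= ij => [/UW h|/V_perp2 h].
    have j0 : 0 <= j by apply: le_trans (ltW ij).
    by rewrite /P j0; exact: (W_perp2_lt ij h).
  have j0 : 0 <= j by move: ij; lia.
  rewrite /P j0.
  by have := perp2_quark_le (absz j) h; congr (perp2 p _ quark f); lia.
- by move=> j; rewrite /P; case: ifP => _; [exact: perp2_0|split; [exact: L2_0|exact: aeT]].
- move=> j f g; rewrite /P; case: ifP => _; first exact: perp2_add.
  move=> [lf f0] [lg g0]; split; first exact: L2D.
  by apply: aeS (aeI f0 g0) => x [hf hg] Dx; rewrite (hf Dx) (hg Dx) /= addr0.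
- move=> j f; rewrite /P; case: ifP => _; first exact: perp2_opp.
  move=> [lf f0]; split; first exact: L2N.
  by apply: aeS f0 => x hf Dx; rewrite (hf Dx) /= oppr0.
- move=> j f g fg lg; rewrite /P; case: ifP => _; first exact: perp2_ae.
  move=> [lf f0]; split => //.
  by apply: aeS (aeI fg f0) => x [h1 h2] Dx; rewrite -(h1 Dx) (h2 Dx).
- move=> [j|] f /=; last by move=> _ [].
  by move=> /UW h; rewrite /P /=; exact: W_disjoint.
Qed.

(** The modified quarklet of degree 0 is a.e. the quarklet itself. *)
Lemma psi_W (j m : int) : Wstarstar psis 0 j (dilate j m (quarklet b 0)).
Proof.
have L0 := @gens1_L2 j _ (leq0n p).
apply: (closed_span_ae L0 _ (L2_dilate j m (LQ (leq0n p)))); last first.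
  by apply: spanI => //; apply: sub_span; exists m.
have := ae_affine (- m%:~R) (scale_neq0 j) S0; apply: aeS => x hx _.
by rewrite /dilate (hx I).
Qed.

Lemma psi_WW (j m : int) : WW j (dilate j m (quarklet b 0)).
Proof. exact: (@sum_space1 _ _ (Wstarstar_family psis p j) ord0 _ (psi_W j m)). Qed.

(** A total set whose elements lie in the members of the family is enough. *)
Lemma total_sum_space (I : choiceType) (U : I -> set (R -> R[i])) (A : set (R -> R[i])) :
  (forall i f g, U i f -> U i g -> U i (fun x => f x + g x)) ->
  (forall i (c : R[i]) f, U i f -> U i (fun x => c * f x)) ->
  (forall f, A f -> exists i, U i f) ->
  (forall f, L2 f -> closed_span A f) -> L2 = L2closure (sum_space U).
Proof.
move=> UD UZ AU hA; apply/seteqP; split=> f; last by case.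
move=> /hA; apply: clS; apply: (sum_space_span UD UZ) => g /AU [i Ug]; exact: sum_space1 Ug.
Qed.

Lemma total_W (U : int -> set (R -> R[i])) :
  (forall i f g, U i f -> U i g -> U i (fun x => f x + g x)) ->
  (forall i (c : R[i]) f, U i f -> U i (fun x => c * f x)) ->
  (forall j, WW j `<=` U j) -> L2 = L2closure (sum_space U).
Proof.
move=> UD UZ WU; apply: (@total_sum_space _ U (dilates (quarklet b 0))) => //; last exact: quarklet_total hb.
by move=> _ [j [m ->]]; exists j; apply: WU; exact: psi_WW.
Qed.

Lemma total_base (U : int -> set (R -> R[i])) :
  (forall i f g, U i f -> U i g -> U i (fun x => f x + g x)) ->
  (forall i (c : R[i]) f, U i f -> U i (fun x => c * f x)) ->
  (forall j, WW j `<=` U j) -> L2 = L2closure (sum_space (with_base V U)).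
Proof.
move=> UD UZ WU; apply: (@total_sum_space _ (with_base V U) (base_set b)); last exact: base_total hb.
- by move=> [i|]; [exact: UD|exact: VD].
- by move=> [i|]; [exact: UZ|exact: VZ].
- move=> _ [[m ->]|[j [m ->]]]; last by exists (Some j); apply: WU; exact: psi_WW.
  exists None; apply: spanI; last exact: (gens_L2 (j := 0) lquark).
  apply: sub_span; exists 0%N, m; split => //; apply/funext => x; by rewrite dilate0.
Qed.

(** By density it suffices to compare single dilated translates, and these
    reduce to [star_orth] at scale 0. *)
Lemma orthogonal_WW (j : int) : orthogonal_family (Wstarstar_family psis p j).
Proof.
move=> i i' f g ii' hf hg.
have ip : (i <= p)%N by rewrite -ltnS. have i'p : (i' <= p)%N by rewrite -ltnS.
have lf : L2 f by case: hf. have lg : L2 g by case: hg.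
apply: (clspan_dot0 (@gens1_L2 j _ ip) lg _ hf) => _ [m ->].
have ld := L2_dilate j m (LS ip).
rewrite dotC // (_ : L2dot g _ = 0) ?rmorph0 //.
apply: (clspan_dot0 (@gens1_L2 j _ i'p) ld _ hg) => _ [m' ->].
have ld' := L2_dilate j m' (LS i'p).
apply/(dot_dilate j m' (LS i'p) ld).
have -> : (fun x => dilate j m (psis i) (2 ^ (- j) * x)) =
    fun x => (2 `^ (j%:~R / 2))%:C * psis i (x - m%:~R).
  by apply/funext => x; rewrite /dilate scaleK.
rewrite dotZr_real; [|by apply: L2_shift; exact: LS|by apply: L2_shift; exact: LS].
have l1 : L2 (fun x => psis i' (x - (m' - m)%:~R)) by apply: L2_shift; exact: LS.
have [_ _ rec] := hpsis.
have i'i : (i' : nat) != i by rewrite eq_sym.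
have := dot_shift (- m%:~R) l1 (LS ip).
rewrite (star_orth LQ LS rec (m' - m) i'p ip i'i) => e.
rewrite (_ : L2dot _ _ = 0) ?mulr0 // -[RHS]e; congr L2dot; apply/funext => x.
by rewrite intrB; congr (psis i' _); ring.
Qed.

End Assembly.

Theorem theorem6p17 (R : realType) (mt p : nat) (hmt : (1 <= mt)%N)
  (hodd : (2 %| mt + 1)%N) (b : int -> R) (hb : is_quarklet_mask mt b)
  (psis : nat -> R -> complex R) (hpsis : modified_quarklets b p psis) :
  let W := Wstar psis p in
  let WW := fun j : int => sum_space (Wstarstar_family psis p j) in
  let V := Vspace p 0 in
  [/\ direct_family W /\ L2 = L2closure (sum_space W),
      (forall j : int, orthogonal_family (Wstarstar_family psis p j)) /\
      direct_family WW /\ L2 = L2closure (sum_space WW),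
      direct_family (with_base V W) /\
      L2 = L2closure (sum_space (with_base V W)) &
      direct_family (with_base V WW) /\
      L2 = L2closure (sum_space (with_base V WW))].
Proof.
have mtE : mt = (mt./2).*2.+1.
  by move: hodd; rewrite dvdn2 addn1 /= negbK => od; rewrite -[LHS]odd_double_half od.
rewrite mtE in hb => W WW V.
have WWW j : WW j `<=` W j by move=> f; exact: (WW_W hpsis).
have WD_ j f g : W j f -> W j g -> W j (fun x => f x + g x) := @WD _ _ _ _ hpsis j f g.
have WZ_ j c f : W j f -> W j (fun x => c * f x) := @WZ _ _ _ _ hpsis j c f.
have WWD_ j f g : WW j f -> WW j g -> WW j (fun x => f x + g x) := @WWD _ _ _ _ hpsis j f g.
have WWZ_ j c f : WW j f -> WW j (fun x => c * f x) := @WWZ _ _ _ _ hpsis j c f.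
have subW j : W j `<=` W j by [].
have subWW j : WW j `<=` WW j by [].
split.
- by split; [exact: (direct_W hb hpsis subW)|exact: (total_W hb hpsis WD_ WZ_ WWW)].
- split; first by move=> j; exact: (orthogonal_WW hb hpsis).
  by split; [exact: (direct_W hb hpsis WWW)|exact: (total_W hb hpsis WWD_ WWZ_ subWW)].
- by split; [exact: (direct_base hb hpsis subW)|exact: (total_base hb hpsis WD_ WZ_ WWW)].
- by split; [exact: (direct_base hb hpsis WWW)|exact: (total_base hb hpsis WWD_ WWZ_ subWW)].
Qed.
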